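(* Let $\mathcal{P}\subset\mathbb{R}^d$ be a convex polytope of dimension $d$, let $\Sigma$ be a simplex of dimension $d$, and fix some notion of volume $\operatorname{Vol}$. Then $$\operatorname{Asvol}(\mathcal{P}) = \frac{|\operatorname{Flags}(\mathcal{P})|}{(d+1)!}\,\operatorname{Asvol}(\Sigma).$$
   Context: Hilbert geometry. For a convex body $\Omega\subset\mathbb{R}^d$ (closure of a non-empty bounded open convex set), the Hilbert geometry on $\Omega$ is $\operatorname{int}\Omega$ with the distance $d_\Omega(p,q) = \frac12\log\frac{|qa|\,|pb|}{|pa|\,|qb|}$ for $p\ne q$, where $a,b$ are the points where the line through $p,q$ meets $\partial\Omega$, labelled so that $a,p,q,b$ occur in this order; $d_\Omega(p,p)=0$. $B_\Omega(p,R)$ is the closed ball of radius $R$ centred at $p$. Notion of volume. More generally, Hilbert geometries are defined on any non-empty open convex set $\Omega$ containing no whole line (if $a$ or $b$ is at infinity the corresponding ratio, $|qa|/|pa|$ or $|pb|/|qb|$, is taken to be $1$). A notion of volume assigns to each such $\Omega$ a Borel measure $\operatorname{Vol}_\Omega$ on $\Omega$ given by a positive density $h_\Omega$ with respect to Lebesgue measure, such that: (1) $h_\Omega(p)$ depends continuously on the pair $(\Omega,p)$, $p\in\Omega$, in the pointed Hausdorff topology; (2) it is monotone under inclusion: if $p\in\Omega_1\subset\Omega_2$ then $h_{\Omega_2}(p)\le h_{\Omega_1}(p)$; (3) it is invariant under projective transformations: a projective map taking $\Omega$ onto $\Omega'$ pushes $\operatorname{Vol}_\Omega$ to $\operatorname{Vol}_{\Omega'}$;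 (4) if $\Omega$ is an ellipsoid, $\operatorname{Vol}_\Omega$ is the standard (Riemannian hyperbolic) volume. The Busemann and Holmes--Thompson volumes are examples. For a convex body $\Omega$, write $\operatorname{Vol}$ for the measure $\operatorname{Vol}_{\operatorname{int}\Omega}$. Asymptotic volume. $\operatorname{Asvol}(\Omega):=\liminf_{R\to\infty}\frac{\operatorname{Vol}(B_\Omega(p,R))}{R^d}$, for any base point $p\in\operatorname{int}\Omega$ (the value does not depend on $p$). Flags. $\operatorname{Flags}(\mathcal{P})$ is the set of maximal flags of $\mathcal{P}$, i.e. the tuples $(f_0,\dots,f_d)$ of faces of $\mathcal{P}$ with $\dim f_i=i$ and each $f_i$ ($i<d$) contained in the relative boundary of $f_{i+1}$. $|\cdot|$ denotes cardinality. *)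

(* Defs.v *)
(* Points of R^d are row vectors 'rV[R]_d over R : realType.
   The library norm `|x| on 'rV[R]_d is the sup norm: it is used here only
   through the topology it induces, Euclidean lengths being written enorm. *)
From HB Require Import structures.
From mathcomp Require Import all_boot all_order all_algebra.
From mathcomp Require Import all_classical all_reals all_analysis.
From mathcomp Require Import measurable_realfun lebesgue_measure.

Set Implicit Arguments.
Unset Strict Implicit.
Unset Printing Implicit Defensive.
Import Order.TTheory GRing.Theory Num.Theory.
Import numFieldNormedType.Exports.
Local Open Scope classical_set_scope.
Local Open Scope ring_scope.

Definition borel_rV (R : realType) (n : nat) :=
  g_sigma_algebraType (@open 'rV[R]_n).

HB.instance Definition _ (R : realType) (n : nat) :=
  Measurable.on (borel_rV R n).

Section lebesgue_rV.
Context {R : realType}.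

Lemma open_borel_rV n (O : set 'rV[R]_n) : open O ->
  measurable (O : set (borel_rV R n)).
Proof. exact: sub_sigma_algebra. Qed.

Lemma open_bigcup_rat_ball n (O : set 'rV[R]_n) : open O ->
  O = \bigcup_(i : 'rV[rat]_n * nat)
    (ball (map_mx ratr i.1 : 'rV[R]_n) i.2.+1%:R^-1 `&`
     [set _ | ball (map_mx ratr i.1 : 'rV[R]_n) i.2.+1%:R^-1 `<=` O]).
Proof.
move=> oO; apply/seteqP; split => [x Ox|x [i _ [xi iO]]]; last exact: iO.
have /nbhs_ballP[e /= e0 eO] := oO _ Ox.
have [k ke] : exists k : nat, k.+1%:R^-1 + k.+1%:R^-1 < e.
  exists (Num.truncn (2 / e)).
  have k0 : 0 < (Num.truncn (2 / e)).+1%:R :> R by [].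
  have -> : (Num.truncn (2 / e)).+1%:R^-1 + (Num.truncn (2 / e)).+1%:R^-1
            = 2 / (Num.truncn (2 / e)).+1%:R :> R.
    by rewrite [RHS]mulr_natl mulr2n.
  by rewrite ltr_pdivrMr// mulrC -ltr_pdivrMr// truncnS_gt.
have k0 : 0 < k.+1%:R^-1 :> R by rewrite invr_gt0.
have /choice[q qx] : forall j : 'I_n, exists q : rat,
    ratr q \in `](x 0 j - k.+1%:R^-1), (x 0 j + k.+1%:R^-1)[.
  by move=> j; apply: rat_in_itvoo; rewrite ltrD2l gtrN.
have xq : ball (map_mx ratr (\row_j q j) : 'rV[R]_n) k.+1%:R^-1 x.
  split=> // i j; rewrite ord1 !mxE /ball/= ltr_distlC.
  have := qx j; rewrite in_itv/= => /andP[h1 h2].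
  by rewrite ltrBlDr h2 -ltrBlDr h1.
exists (\row_j q j, k) => //; split => //= y qy.
apply/eO/(le_ball (ltW ke)).
exact: ball_triangle (ball_sym xq) qy.
Qed.

Definition cons_rV n (z : measurableTypeR R * borel_rV R n) :
  borel_rV R n.+1 := row_mx (z.1%:M : 'rV_1) z.2.

Definition uncons_rV n (x : borel_rV R n.+1) :
    measurableTypeR R * borel_rV R n :=
  (x 0 0, rsubmx (x : 'rV_(1 + n))).

Lemma cons_rVK n : cancel (@cons_rV n) (@uncons_rV n).
Proof.
case=> a v; rewrite /uncons_rV /cons_rV/=; congr (_, _); last first.
  by rewrite row_mxKr.
rewrite (_ : 0 = lshift n (0 : 'I_1)); last exact: val_inj.
by rewrite (@row_mxEl _ 1 1 n) mxE eqxx.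
Qed.

Lemma uncons_rVK n : cancel (@uncons_rV n) (@cons_rV n).
Proof.
move=> x; rewrite /uncons_rV /cons_rV/=; rewrite -[RHS](@hsubmxK _ 1 1 n x).
congr (@row_mx R 1 1 n _ _); apply/rowP => i; rewrite !ord1 !mxE eqxx.
by congr (x _ _); exact: val_inj.
Qed.

Lemma measurable_cons_rV n : measurable_fun setT (@cons_rV n).
Proof.
apply: (@measurability _ _ _ (borel_rV R n.+1) _ _ (@open 'rV[R]_n.+1) erefl).
move=> _ [U oU <-]; rewrite setTI (open_bigcup_rat_ball oU) preimage_bigcup.
apply: countable_bigcupT_measurable => // -[q k] /=.
have [h|h] := pselect (ball (map_mx ratr q : 'rV[R]_n.+1) k.+1%:R^-1 `<=` U).
- set b := ball _ _.
  have -> : @cons_rV n @^-1` (b `&` [set _ | b `<=` U]) =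
    ball (ratr (q 0 0) : R) k.+1%:R^-1 `*`
    ball (map_mx ratr (rsubmx (q : 'rV_(1 + n))) : 'rV[R]_n) k.+1%:R^-1.
    apply/seteqP; split => [z [[_ bz] _]|z [b1 [_ b2]]].
      split; last first.
        split => // i j; have := bz i (rshift 1 j).
        by rewrite ord1 /cons_rV (@row_mxEr _ 1 1 n) !mxE.
      have := bz 0 0; rewrite mxE.
      by have := cons_rVK z; rewrite {2}(surjective_pairing z) => -[-> _].
    split => //; split => // i j; rewrite ord1 mxE; case: (@split_ordP 1 n j).
      move=> {}j ->; rewrite ord1 /cons_rV (@row_mxEl _ 1 1 n) mxE eqxx.
      by rewrite (_ : lshift n (0 : 'I_1) = 0)//; exact: val_inj.
    move=> {}j ->; rewrite /cons_rV (@row_mxEr _ 1 1 n).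
    by have := b2 0 j; rewrite !mxE.
  apply: measurableX; first by apply: open_measurable; apply: (@ball_open R R^o).
  by apply: open_borel_rV; exact: ball_open.
- rewrite (_ : _ @^-1` _ = set0)//; apply/seteqP; split => // z [] //.
Qed.

Lemma measurable_uncons_rV n : measurable_fun setT (@uncons_rV n).
Proof.
apply: measurable_fun_pair.
  apply: (measurability _ (RGenOpens.measurableE R)).
  move=> _ [_ [a [b ->]] <-]; rewrite setTI; apply: open_borel_rV.
  by apply: open_comp => [x _|]; [exact: coord_continuous|exact: interval_open].
apply: (@measurability _ _ _ (borel_rV R n) _ _ (@open 'rV[R]_n) erefl).
move=> _ [U oU <-]; rewrite setTI; apply: open_borel_rV.
apply: open_comp oU => x _ A /nbhs_ballP[e /= e0 eA].
apply/nbhs_ballP; exists e => //= y [_ xy]; apply: eA; split => // i j.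
by rewrite !mxE; exact: xy.
Qed.

Section lebesgue_cons.
Context n (m : {sigma_finite_measure set borel_rV R n -> \bar R}).

Definition lebesgue_cons (A : set (borel_rV R n.+1)) : \bar R :=
  pushforward (lebesgue_measure \x m)%E (@cons_rV n) A.

Let mf := @measurable_cons_rV n.

Let lebesgue_cons0 : lebesgue_cons set0 = 0%E.
Proof. exact: measure0. Qed.

Let lebesgue_cons_ge0 A : (0 <= lebesgue_cons A)%E.
Proof. exact: measure_ge0. Qed.

Let lebesgue_cons_sigma_additive : semi_sigma_additive lebesgue_cons.
Proof. exact: (@measure_semi_sigma_additive _ _ _ (pushforward _ _)). Qed.

HB.instance Definition _ := isMeasure.Build _ _ _ lebesgue_cons
  lebesgue_cons0 lebesgue_cons_ge0 lebesgue_cons_sigma_additive.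

Let lebesgue_cons_sigma_finite : sigma_finite setT lebesgue_cons.
Proof.
have /sigma_finiteP[F [TF ndF Foo]] := sigma_finiteT (@lebesgue_measure R).
have /sigma_finiteP[G [TG ndG Goo]] := sigma_finiteT m.
exists (fun k => @uncons_rV n @^-1` (F k `*` G k)).
  apply/esym; rewrite -subTset => x _.
  have : [set: R] (uncons_rV x).1 by [].
  have : [set: borel_rV R n] (uncons_rV x).2 by [].
  rewrite TF TG => -[j _ Gj] [i _ Fi]; exists (maxn i j) => //; split.
    by move: Fi; exact/subsetPset/ndF/leq_maxl.
  by move: Gj; exact/subsetPset/ndG/leq_maxr.
move=> k; have [mF Fk] := Foo k; have [mG Gk] := Goo k.
split.
  rewrite -[X in measurable X]setTI; apply: measurable_uncons_rV => //.
  exact: measurableX.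
rewrite /lebesgue_cons /pushforward -comp_preimage.
rewrite (_ : _ \o _ = id); last by apply/funext; exact: cons_rVK.
by rewrite preimage_id product_measure1E// lte_mul_pinfty// ge0_fin_numE.
Qed.

HB.instance Definition _ := Measure_isSigmaFinite.Build _ _ _ lebesgue_cons
  lebesgue_cons_sigma_finite.

End lebesgue_cons.

(* Lebesgue measure on the Borel sets of R^n, as an iterated product along
   R^(n+1) = R x R^n. *)
Fixpoint lebesgue_rV n : {sigma_finite_measure set borel_rV R n -> \bar R} :=
  if n is k.+1 then lebesgue_cons (lebesgue_rV k) else \d_(0 : borel_rV R 0).

End lebesgue_rV.

Section euclid.
Context {R : realType} {d : nat}.
Local Notation V := 'rV[R]_d.

Definition dotp (u v : V) : R := (u *m v^T) 0 0.

Definition enorm (u : V) : R := Num.sqrt (dotp u u).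

Definition boundary (A : set V) : set V := closure A `\` A°.

Definition affine_hull (S : set V) : set V :=
  [set x | exists n (t : 'I_n -> R) (y : 'I_n -> V),
    [/\ forall i, S (y i), \sum_i t i = 1 & x = \sum_i t i *: y i]].

Definition conv_hull (S : set V) : set V :=
  [set x | exists n (t : 'I_n -> R) (y : 'I_n -> V),
    [/\ forall i, S (y i), forall i, 0 <= t i, \sum_i t i = 1
      & x = \sum_i t i *: y i]].

(* The empty set has no dimension. *)
Definition set_dim (S : set V) (k : nat) : Prop :=
  exists (x0 : V) (U : {vspace V}),
    \dim U = k /\ affine_hull S = [set x | x - x0 \in U].

Definition rel_interior (S : set V) : set V :=
  [set x | S x /\ \forall y \near x, affine_hull S y -> S y].

Definition rel_boundary (S : set V) : set V := closure S `\` rel_interior S.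

Definition polytope (P : set V) : Prop :=
  exists s : seq V, P = conv_hull [set` s].

Definition affinely_independent n (v : 'I_n -> V) : Prop :=
  forall t : 'I_n -> R,
    \sum_i t i = 0 -> \sum_i t i *: v i = 0 -> forall i, t i = 0.

Definition simplex (S : set V) (k : nat) : Prop :=
  exists v : 'I_k.+1 -> V,
    affinely_independent v /\ S = conv_hull (range v).

(* c = 0 yields the improper faces P and set0; set0 never occurs in a flag,
   having no dimension. *)
Definition face (P F : set V) : Prop :=
  exists (c : V) (b : R), (forall x, P x -> dotp c x <= b) /\
    F = P `&` [set x | dotp c x = b].

Definition flags (P : set V) : set (d.+1.-tuple (set V)) :=
  [set f | (forall i : 'I_d.+1, face P (tnth f i) /\ set_dim (tnth f i) i) /\
    (forall i j : 'I_d.+1, j = i.+1 :> nat ->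
       tnth f i `<=` rel_boundary (tnth f j))].

(* The open sets carrying a Hilbert geometry. *)
Definition proper_domain (Omega : set V) : Prop :=
  [/\ open Omega, Omega !=set0, @convex_set R V Omega
    & ~ exists (x v : V), v != 0 /\ forall t : R, Omega (x + t *: v)].

(* The boundary points b on the line pq such that p, q, b occur in this
   order; there is exactly one or, when b is at infinity, none. *)
Definition exit_point (Omega : set V) (p q : V) : set V :=
  [set b | boundary Omega b /\ exists2 t : R, 1 < t & b = p + t *: (q - p)].

Definition exit_ratio (Omega : set V) (p q : V) : R :=
  if pselect (exit_point Omega p q !=set0) then
    let b := xget 0 (exit_point Omega p q) in enorm (b - p) / enorm (b - q)
  else 1.

Definition hilbert_dist (Omega : set V) (p q : V) : R :=
  if p == q then 0
  else 2^-1 * ln (exit_ratio Omega q p * exit_ratio Omega p q).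

Definition hilbert_ball (Omega : set V) (p : V) (r : R) : set V :=
  [set q | Omega q /\ hilbert_dist Omega p q <= r].

(* Basic neighbourhoods of (Omega, p) in the pointed Hausdorff topology:
   within distance r of the base points, the two sets are e-close. *)
Definition pointed_hausdorff_close (r e : R) (Omega : set V) (p : V)
    (Omega' : set V) (p' : V) : Prop :=
  [/\ enorm (p' - p) < e,
      forall x, Omega x -> enorm (x - p) <= r ->
        exists2 y, Omega' y & enorm (x - y) < e
    & forall x, Omega' x -> enorm (x - p') <= r ->
        exists2 y, Omega y & enorm (x - y) < e].

(* A (d+1) x (d+1) matrix acts on the homogeneous coordinates (x : 1);
   proj_map M x is meaningful when proj_denom M x != 0. *)
Definition proj_denom (M : 'M[R]_(d + 1)) (x : V) : R :=
  (row_mx x 1%:M *m M) 0 (rshift d 0).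

Definition proj_map (M : 'M[R]_(d + 1)) (x : V) : V :=
  (proj_denom M x)^-1 *: lsubmx (row_mx x 1%:M *m M).

Definition qform (S : 'M[R]_d) (v : V) : R := (v *m S *m v^T) 0 0.

Definition posdef (S : 'M[R]_d) : Prop :=
  S^T = S /\ forall v : V, v != 0 -> 0 < qform S v.

Definition ellipsoid (S : 'M[R]_d) (c : V) : set V :=
  [set x | qform S (x - c) < 1].

(* Gram matrix at x of the Riemannian metric of the Beltrami-Klein model
   (curvature -1) on ellipsoid S c: with y = x - c and q = qform S y,
   g_x(v, v) = (v S v^T) / (1 - q) + (y S v^T)^2 / (1 - q)^2. *)
Definition klein_metric (S : 'M[R]_d) (c x : V) : 'M[R]_d :=
  let y := x - c in let q := qform S y in
  (1 - q)^-1 *: S + (1 - q) ^- 2 *: ((S *m y^T) *m (y *m S)).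

Definition density_volume (h : V -> R) (A : set V) : \bar R :=
  (\int[@lebesgue_rV R d]_(x in (A : set (borel_rV R d))) (h x)%:E)%E.

Definition hyperbolic_volume (S : 'M[R]_d) (c : V) (A : set V) : \bar R :=
  density_volume (fun x => Num.sqrt (\det (klein_metric S c x))) A.

End euclid.

(* density Omega is irrelevant outside Omega, and for Omega which is not a
   proper domain. *)
Record volume_notion (R : realType) (d : nat) := VolumeNotion {
  density :> set 'rV[R]_d -> 'rV[R]_d -> R ;
  density_gt0 : forall Omega p, proper_domain Omega -> Omega p ->
    0 < density Omega p ;
  density_continuous : forall Omega p, proper_domain Omega -> Omega p ->
    forall e, 0 < e -> exists (r delta : R), 0 < delta /\
      forall Omega' p', proper_domain Omega' -> Omega' p' ->
        pointed_hausdorff_close r delta Omega p Omega' p' ->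
        `|density Omega' p' - density Omega p| < e ;
  density_monotone : forall Omega1 Omega2 p,
    proper_domain Omega1 -> proper_domain Omega2 ->
    Omega1 p -> Omega1 `<=` Omega2 -> density Omega2 p <= density Omega1 p ;
  volume_projective : forall (M : 'M[R]_(d + 1)) Omega Omega',
    proper_domain Omega -> proper_domain Omega' -> M \in unitmx ->
    (forall x, Omega x -> proj_denom M x != 0) ->
    proj_map M @` Omega = Omega' ->
    forall A : set 'rV[R]_d, measurable (A : set (borel_rV R d)) ->
      A `<=` Omega' ->
      density_volume (density Omega') A =
      density_volume (density Omega) (Omega `&` proj_map M @^-1` A) ;
  volume_ellipsoid : forall (S : 'M[R]_d) (c : 'rV[R]_d), posdef S ->
    forall A : set 'rV[R]_d, measurable (A : set (borel_rV R d)) ->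
      A `<=` ellipsoid S c ->
      density_volume (density (ellipsoid S c)) A = hyperbolic_volume S c A
}.

Definition body_volume (R : realType) (d : nat) (Vol : volume_notion R d)
    (K A : set 'rV[R]_d) : \bar R :=
  density_volume (Vol K°) A.

Definition asvol (R : realType) (d : nat) (Vol : volume_notion R d)
    (K : set 'rV[R]_d) (p : 'rV[R]_d) : \bar R :=
  limf_einf (fun r : R =>
    (body_volume Vol K (hilbert_ball K° p r) * (r ^- d)%:E)%E) (pinfty_nbhs R).

(* Main.v *)
(* In the homogeneous coordinates xi_0, ..., xi_d of a simplex, projective maps
   act by positive diagonal matrices and permutations, so the volume of the sector
   { xi_0 > xi_1 > ... > xi_d > exp(-T) xi_0 } of a simplex depends only on T; call
   it A(T). For a polytope P and a flag f, let c_i be the barycenter of the vertices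
   of f_i. The simplices of the c_i, over all flags, cover P. Such a
   simplex is contained, up to bounded factors on the coordinates, in a sector of
   the simplex with vertices c_i + s (c_i - c_(i-1)), itself contained in P, and a
   Hilbert ball of radius r only meets it where xi_d is at least of order exp(-2r).
   Conversely, the functionals defining the supporting
   hyperplanes of P at f_0, ..., f_(d-1), together with 1, are the coordinates of an
   unbounded simplex (a cone) containing P; a sufficiently thin sector of it lies in
   the simplex of the c_i, and the thin sectors of distinct flags are disjoint, as
   f_i is the face F of dimension i whose functional is the smallest there. By
   monotonicity of the volume, the ball of radius r has volume between
   |Flags(P)| A(2r - C) and |Flags(P)| A(2r + C), and the shift by C does not affect
   the lower limit of A(2r) / r^d. The same estimate holds for a simplex with
   the (d+1)! orderings of its vertices instead of the flags. *)
Require Import Defs.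
From HB Require Import structures.
From mathcomp Require Import all_boot all_order all_algebra.
From mathcomp Require Import finmap.
From mathcomp Require Import all_classical all_reals all_analysis.
From mathcomp Require Import fingroup perm measurable_realfun lebesgue_measure.
From mathcomp Require Import ring lra.

Set Implicit Arguments.
Unset Strict Implicit.
Unset Printing Implicit Defensive.
Import Order.TTheory GRing.Theory Num.Theory.
Import numFieldNormedType.Exports.
Local Open Scope classical_set_scope.
Local Open Scope ring_scope.

(** * Simplices in homogeneous coordinates *)

(** The growth A(T) is never evaluated: its lower limit could a priori be 0 or infinite, so the
    comparison stays in the extended reals and only bounded shifts of T are affordable. Hence both
    bodies must be cut into sectors of exactly the same shape, and here lies the obstacle. In the
    simplex of the barycenters c_i of a flag, the coordinates of a point come in every order, so
    this simplex is not a sector of itself. Dilating its vertices to c_i + s (c_i - c_(i-1)) gives a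
    larger simplex, in which the coordinates of its points decrease up to bounded factors. Sectors
    ask for a strict decrease; to gain it, coordinate j is multiplied by s^j, which leaves the
    simplex and A unchanged but moves the sectors. A small ratio s widens them enough to cover the
    flag simplex, a large one makes them thin enough to be disjoint for distinct flags. Polytope and
    simplex are then instances of one statement about a family of inner frames and a family of outer
    ones. *)

Section affine_functionals.
Context {R : realType} {d : nat}.
Local Notation V := 'rV[R]_d.

(* The columns of N are affine functionals on R^d, in homogeneous coordinates:
   aff N x j is the value of the j-th one at x. *)
Definition aff m (N : 'M[R]_(d + 1, m)) (x : V) (j : 'I_m) : R :=
  (row_mx x 1%:M *m N) 0 j.

Lemma affE m (N : 'M[R]_(d + 1, m)) x j :
  aff N x j = \sum_k x 0 k * N (lshift 1 k) j + N (rshift d 0) j.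
Proof.
rewrite /aff mxE big_split_ord/= big_ord1; congr (_ + _).
  by apply: eq_bigr => k _; rewrite row_mxEl.
by rewrite row_mxEr !mxE eqxx mul1r.
Qed.

Lemma aff_sum m (N : 'M[R]_(d + 1, m)) n (t : 'I_n -> R) (y : 'I_n -> V) j :
  \sum_i t i = 1 ->
  aff N (\sum_i t i *: y i) j = \sum_i t i * aff N (y i) j.
Proof.
move=> t1; under [RHS]eq_bigr do rewrite affE mulrDr.
rewrite big_split/= -mulr_suml t1 mul1r affE; congr (_ + _).
under [RHS]eq_bigr do rewrite mulr_sumr.
rewrite exchange_big/=; apply: eq_bigr => k _.
rewrite summxE mulr_suml; apply: eq_bigr => i _.
by rewrite mxE mulrA.
Qed.

Lemma affD m (N : 'M[R]_(d + 1, m)) x s u v j :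
  aff N (x + s *: (u - v)) j = aff N x j + s * (aff N u j - aff N v j).
Proof.
rewrite !affE opprD addrACA subrr addr0 -sumrB mulr_sumr addrAC -big_split/=.
congr (_ + _); apply: eq_bigr => k _; rewrite !mxE; ring.
Qed.

Lemma aff_segment m (N : 'M[R]_(d + 1, m)) x y t j :
  aff N (x + t *: (y - x)) j = (1 - t) * aff N x j + t * aff N y j.
Proof. by rewrite affD; ring. Qed.

Lemma affM m n (N : 'M[R]_(d + 1, m)) (B : 'M[R]_(m, n)) x j :
  aff (N *m B) x j = \sum_k aff N x k * B k j.
Proof. by rewrite /aff mulmxA mxE. Qed.

Lemma aff_col m (N : 'M[R]_(d + 1, m)) x j k : aff (col j N) x k = aff N x j.
Proof. by rewrite !affE !mxE; congr (_ + _); apply: eq_bigr => i _; rewrite mxE. Qed.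

Lemma continuous_aff m (N : 'M[R]_(d + 1, m)) j :
  continuous (fun x : V => aff N x j).
Proof.
rewrite (_ : (fun _ => _) = fun x : V =>
    \sum_k x 0 k * N (lshift 1 k) j + N (rshift d 0) j); last first.
  by apply/funext => x; rewrite affE.
move=> x; apply: (@continuousD R R V
  (fun x : V => \sum_k x 0 k * N (lshift 1 k) j)); last exact: cst_continuous.
apply: (@continuous_big R _ +%R) => [|k _]; first exact: add_continuous.
move=> y; apply: (@continuousM R V (fun x : V => x 0 k)).
  exact: coord_continuous.
exact: cst_continuous.
Qed.

Lemma row_mx1_inj (x y : V) : row_mx x 1%:M = row_mx y 1%:M :> 'rV_(d + 1) -> x = y.
Proof. by move=> xy; have [] := eq_row_mx xy. Qed.

Definition orthant m (N : 'M[R]_(d + 1, m)) : set V :=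
  [set x | forall j, 0 < aff N x j].

(* The second condition says that the vertices of the simplex [orthant N],
   given by the rows of [invmx N], are finite or at infinity in the direction
   of [orthant N]. *)
Definition frame (N : 'M[R]_(d + 1)) : Prop :=
  N \in unitmx /\ forall j, 0 <= invmx N j (rshift d 0).

(** Both conditions are homogeneous in the coordinates, hence projectively invariant. The pairs i =
    j make the sector empty for T <= 0, which disposes of small radii. *)
Definition sector (N : 'M[R]_(d + 1)) (T : R) : set V :=
  orthant N `&` [set x |
    (forall i j : 'I_(d + 1), (i < j)%N -> aff N x j < aff N x i) /\
    (forall i j : 'I_(d + 1), expR (- T) * aff N x i < aff N x j)].

Lemma open_forall (I : finType) (A : I -> set V) :
  (forall i, open (A i)) -> open [set x | forall i, A i x].
Proof.
move=> oA; rewrite openE => x Ax; apply: (@filter_forall V I A (nbhs x) _) => i.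
by have := oA i; rewrite openE; apply; exact: Ax.
Qed.

Lemma open_orthant m (N : 'M[R]_(d + 1, m)) : open (orthant N).
Proof.
apply: open_forall => j.
change (open ((fun x => aff N x j) @^-1` [set t | 0 < t])).
by apply: open_comp => [x _|]; [exact: continuous_aff|exact: open_gt].
Qed.

Lemma affB m (A B : 'M[R]_(d + 1, m)) s x j :
  aff (A - s *: B) x j = aff A x j - s * aff B x j.
Proof. by rewrite /aff mulmxBr -scalemxAr !mxE. Qed.

Lemma open_aff_lt m (A : 'M[R]_(d + 1, m)) s j k :
  open [set x | s * aff A x j < aff A x k].
Proof.
rewrite (_ : [set x | _] = orthant (col k A - s *: col j A)).
  exact: open_orthant.
apply/seteqP; split=> x.
  by move=> /= xjk i; rewrite affB !aff_col subr_gt0.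
by move=> /(_ 0); rewrite affB !aff_col subr_gt0.
Qed.

Lemma open_sector N T : open (sector N T).
Proof.
apply: openI; first exact: open_orthant.
apply: openI; apply: open_forall => i; apply: open_forall => j; last first.
  exact: open_aff_lt.
have [ij|ij] := boolP (i < j)%N; last first.
  by rewrite (_ : (fun _ => _) = setT)//; [exact: openT|exact/seteqP].
rewrite (_ : (fun _ => _) = [set x | 1 * aff N x j < aff N x i]).
  exact: open_aff_lt.
by apply/seteqP; split=> x /=; rewrite mul1r//; apply.
Qed.

Lemma sector_orthant N T : sector N T `<=` orthant N.
Proof. by move=> x []. Qed.

End affine_functionals.

Section sector_volume.
Context {R : realType} {d : nat}.
Local Notation V := 'rV[R]_d.

Lemma convex_setE (A : set V) :
  (forall x y t, A x -> A y -> 0 <= t <= 1 -> A (t *: x + (1 - t) *: y)) ->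
  @convex_set R V A.
Proof.
move=> cA x y l /set_mem Ax /set_mem Ay; apply/mem_set.
apply: cA => //; exact/andP.
Qed.

Lemma sumr_gt0 (I : finType) (F : I -> R) :
  (forall i, 0 <= F i) -> ~ (forall i, F i = 0) -> 0 < \sum_i F i.
Proof.
move=> F0 nF; rewrite lt0r sumr_ge0 => [|i _]; last exact: F0.
rewrite andbT; apply/eqP => /(psumr_eq0P (fun i _ => F0 i)) h.
by apply: nF => i; exact: h.
Qed.

Lemma invmx_last_neq0 (N : 'M[R]_(d + 1)) : N \in unitmx ->
  ~ (forall j, invmx N j (rshift d 0) = 0).
Proof.
move=> uN h; have /matrixP/(_ (rshift d 0) (rshift d 0)) := mulmxV uN.
rewrite !mxE eqxx big1 => [/eqP|j _]; last by rewrite h mulr0.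
by rewrite eq_sym oner_eq0.
Qed.

(** The denominator combines the positive coordinates of x with the last column of [invmx N'], which
    is nonnegative and nonzero. *)
Lemma frame_sum_gt0 (N N' : 'M[R]_(d + 1)) x : frame N -> frame N' ->
  orthant N x -> 0 < proj_denom (N *m invmx N') x.
Proof.
move=> [uN _] [uN' N'0] Nx; rewrite /proj_denom mulmxA mxE; apply: sumr_gt0.
  by move=> j; rewrite mulr_ge0// ltW//; exact: Nx.
move=> h; apply: (invmx_last_neq0 uN') => j; apply/eqP; have /eqP := h j.
by rewrite mulf_eq0 gt_eqF; [|exact: Nx].
Qed.

Lemma proper_orthant (N : 'M[R]_(d + 1)) : frame N -> proper_domain (orthant N).
Proof.
move=> fN; have [uN N0] := fN; split.
- exact: open_orthant.
(* The point at which all the functionals agree, in homogeneous coordinates; dividing by the last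
   one, [l], makes it a point of R^d. *)
- pose h : 'rV[R]_(d + 1) := const_mx 1 *m invmx N.
  pose l := h 0 (rshift d 0).
  have l0 : 0 < l.
    rewrite /l /h mxE; apply: sumr_gt0 => [j|hj].
      by rewrite mxE mul1r.
    by apply: (invmx_last_neq0 uN) => j; rewrite -[LHS]mul1r -(hj j) mxE.
  exists (l^-1 *: lsubmx h) => j; rewrite /aff.
  rewrite (_ : row_mx _ _ = l^-1 *: h); last first.
    rewrite -[h in RHS]hsubmxK scale_row_mx; congr row_mx.
    apply/rowP => i; rewrite ord1 [RHS]mxE [rsubmx _ _ _]mxE -/l.
    by rewrite mulVf ?gt_eqF// mxE eqxx.
  by rewrite -scalemxAl /h mulmxKV// !mxE mulr1 invr_gt0.
- apply: convex_setE => x y t Nx Ny /andP[t0 t1] j.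
  rewrite (_ : _ + _ = y + t *: (x - y)); last first.
    by rewrite scalerBr scalerBl scale1r addrCA.
  rewrite aff_segment; have := Nx j; have := Ny j.
  have [->|tN0] := eqVneq t 0; first by rewrite subr0 mul1r mul0r addr0.
  move=> y0 x0; rewrite ltr_wpDl ?mulr_ge0 ?subr_ge0 ?(ltW y0)// mulr_gt0//.
  by rewrite lt0r tN0.
(* An affine functional positive on a whole line has slope 0 along it; with all slopes 0,
   invertibility of N gives v = 0. *)
- move=> [x [v [v0 xv]]]; case/negP: v0.
  have hv j : (row_mx v 0 *m N : 'rV_(d + 1)) 0 j = 0.
    set a := LHS; apply/eqP/negPn/negP => a0.
    have aE t : aff N (x + t *: v) j = aff N x j + t * a.
      rewrite /aff /a (_ : row_mx _ _ = row_mx x 1%:M + t *: row_mx v 0).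
        by rewrite mulmxDl -scalemxAl !mxE.
      by rewrite scale_row_mx add_row_mx scaler0 addr0.
    have := xv (- (aff N x j / a)) j; rewrite aE mulNr divfK// subrr.
    by rewrite ltxx.
  have : row_mx v 0 *m N = 0 :> 'rV_(d + 1) by apply/rowP => j; rewrite hv mxE.
  move=> /(congr1 (mulmx^~ (invmx N))); rewrite mulmxK// mul0mx.
  rewrite -row_mx0 => h; have [-> _] := eq_row_mx h; exact: eqxx.
Qed.

Lemma row_mx_proj_map (M : 'M[R]_(d + 1)) (x : V) : proj_denom M x != 0 ->
  row_mx (proj_map M x) 1%:M = (proj_denom M x)^-1 *: (row_mx x 1%:M *m M).
Proof.
move=> D0; rewrite -[in RHS](hsubmxK (row_mx x 1%:M *m M)) scale_row_mx.
congr row_mx; apply/rowP => i; rewrite ord1 [RHS]mxE [rsubmx _ _ _]mxE.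
by rewrite mulVf// mxE eqxx.
Qed.

Variable Vol : volume_notion R d.

(* Any two simplices are exchanged by the projective map which matches their
   homogeneous coordinates. *)
Lemma sector_volume (N N' : 'M[R]_(d + 1)) T : frame N -> frame N' ->
  density_volume (Vol (orthant N)) (sector N T) =
  density_volume (Vol (orthant N')) (sector N' T).
Proof.
move=> fN fN'; have [uN _] := fN; have [uN' _] := fN'.
pose M := N *m invmx N'; pose M' := N' *m invmx N.
have D0 x : orthant N x -> 0 < proj_denom M x.
  by move=> Nx; exact: frame_sum_gt0.
have D'0 x : orthant N' x -> 0 < proj_denom M' x.
  by move=> Nx; exact: frame_sum_gt0.
have affp x j : orthant N x ->
    aff N' (proj_map M x) j = (proj_denom M x)^-1 * aff N x j.
  move=> Nx; rewrite /aff row_mx_proj_map ?gt_eqF ?D0//.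
  by rewrite -scalemxAl mxE -mulmxA /M mulmxKV.
have affp' x j : orthant N' x ->
    aff N (proj_map M' x) j = (proj_denom M' x)^-1 * aff N' x j.
  move=> Nx; rewrite /aff row_mx_proj_map ?gt_eqF ?D'0//.
  by rewrite -scalemxAl mxE -mulmxA /M' mulmxKV.
have im : proj_map M @` orthant N = orthant N'.
  apply/seteqP; split=> [_ [x Nx <-] j|x N'x].
    by rewrite affp// mulr_gt0 ?invr_gt0 ?D0.
  have Nx : orthant N (proj_map M' x).
    by move=> j; rewrite affp'// mulr_gt0 ?invr_gt0 ?D'0.
  exists (proj_map M' x) => //.
  suff : row_mx (proj_map M (proj_map M' x)) 1%:M = row_mx x 1%:M :> 'rV_(d + 1).
    exact: row_mx1_inj.
  have h : row_mx (proj_map M (proj_map M' x)) 1%:M =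
      ((proj_denom M (proj_map M' x))^-1 * (proj_denom M' x)^-1) *:
      row_mx x 1%:M :> 'rV_(d + 1).
    rewrite row_mx_proj_map ?gt_eqF ?D0// row_mx_proj_map ?gt_eqF ?D'0//.
    rewrite -scalemxAl scalerA /M' /M; congr (_ *: _).
    by rewrite !mulmxA mulmxKV// mulmxK.
  rewrite h; move: h => /rowP/(_ (rshift d 0)); rewrite [X in _ = X]mxE.
  by rewrite !row_mxEr !mxE eqxx mulr1 => <-; rewrite scale1r.
have uM : M \in unitmx by rewrite unitmx_mul uN unitmx_inv.
have Mneq0 x : orthant N x -> proj_denom M x != 0 by move=> /D0 /gt_eqF ->.
have mS : measurable (sector N' T : set (borel_rV R d)).
  by apply: open_borel_rV; exact: open_sector.
rewrite (volume_projective Vol (proper_orthant fN) (proper_orthant fN') uM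
  Mneq0 im mS (@sector_orthant _ _ _ _)).
congr density_volume; apply/seteqP; split=> x.
  move=> [Nx [x1 x2]]; split=> //; have D := D0 _ Nx.
  split; first by move=> j; rewrite affp// mulr_gt0 ?invr_gt0.
  split=> [i j ij|i j]; rewrite !affp// ?ltr_pM2l ?invr_gt0 ?x1//.
  by rewrite mulrCA ltr_pM2l ?invr_gt0.
move=> [Nx [_ [x1 x2]]]; split=> //; have D := D0 _ Nx; split=> [i j ij|i j].
  by have := x1 _ _ ij; rewrite !affp// ltr_pM2l ?invr_gt0.
by have := x2 i j; rewrite !affp// mulrCA ltr_pM2l ?invr_gt0.
Qed.

End sector_volume.

(** * Volumes *)

Section density_volume.
Context {R : realType} {d : nat}.
Local Notation V := 'rV[R]_d.

Lemma dotpE (u v : V) : dotp u v = \sum_j u 0 j * v 0 j.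
Proof. by rewrite /dotp mxE; apply: eq_bigr => j _; rewrite mxE. Qed.

Lemma enorm0 : enorm (0 : V) = 0.
Proof. by rewrite /enorm dotpE big1 ?sqrtr0// => j _; rewrite mxE mul0r. Qed.

Lemma ball_rVP (x y : V) e : 0 < e -> ball x e y <-> forall j, `|x 0 j - y 0 j| < e.
Proof.
move=> e0; split=> [[_ xy] j|xy]; first exact: xy.
by split => // i j; rewrite ord1; exact: xy.
Qed.

Lemma near_enorm (x : V) e : 0 < e -> \forall y \near x, enorm (y - x) < e.
Proof.
(* In a sup-norm ball of this radius the squared Euclidean norm is at most d e^2 / (d+1)^2 < e^2;
   the successor also covers d = 0. *)
move=> e0; apply/nbhs_ballP; exists (e / d.+1%:R) => [/=|y].
  by rewrite divr_gt0.
have de0 : 0 < e / d.+1%:R by rewrite divr_gt0.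
move=> /(ball_rVP _ _ de0) xy; rewrite -(ger0_norm (ltW e0)) -sqrtr_sqr.
rewrite /enorm ltr_sqrt ?exprn_gt0// dotpE.
apply: (@le_lt_trans _ _ (\sum_(j < d) (e / d.+1%:R) ^+ 2)).
  apply: ler_sum => j _; rewrite !mxE -expr2 -real_normK ?num_real// distrC.
  by rewrite lerXn2r ?nnegrE ?normr_ge0// ltW.
rewrite sumr_const card_ord expr_div_n -[ltLHS]mulr_natr -mulrA gtr_pMr ?exprn_gt0//.
rewrite mulrC ltr_pdivrMr ?exprn_gt0// mul1r -natrX ltr_nat.
by rewrite -mulnn leq_pmulr.
Qed.

Lemma openP (O : set V) : (forall x, O x -> \forall y \near x, O y) -> open O.
Proof. by move=> oO; rewrite openE => x /oO. Qed.

(* Without measurability of A and B: Hilbert balls need not be shown to be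
   measurable. *)
Lemma ge0_integral_subset dd (T : measurableType dd)
    (mu : {measure set T -> \bar R}) (A B : set T) (f : T -> \bar R) :
  (forall x, B x -> (0 <= f x)%E) -> A `<=` B ->
  (\int[mu]_(x in A) f x <= \int[mu]_(x in B) f x)%E.
Proof.
move=> f0 AB; rewrite !ge0_integralE//; last by move=> x /AB; exact: f0.
apply: le_ereal_sup => _ [h /= hf <-]; exists h => // x /=.
apply: le_trans (hf x) _; rewrite /patch; case: ifPn => [/set_mem/AB Bx|_].
  by rewrite mem_set.
by case: ifPn => // /set_mem; exact: f0.
Qed.

Variable Vol : volume_notion R d.
Local Notation B := (borel_rV R d).

(** With the domain kept fixed, pointed Hausdorff closeness reduces to closeness of the base points,
    so [density_continuous] gives continuity on the open set Omega. *)
Lemma measurable_density (Omega : set V) : proper_domain Omega ->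
  measurable_fun (Omega : set B) (Vol Omega : B -> R).
Proof.
move=> pO; have [oO _ _ _] := pO.
apply: (measurability _ (RGenOpens.measurableE R)).
move=> _ [_ [a [b ->]] <-]; apply: open_borel_rV.
apply: openP => x [Ox] /=; rewrite in_itv/= => /andP[ax xb].
have e0 : 0 < Num.min (Vol Omega x - a) (b - Vol Omega x).
  by rewrite lt_min !subr_gt0 ax.
have [r [e [ge0 h]]] := density_continuous Vol pO Ox e0.
near=> y.
have Oy : Omega y by near: y; exact: open_nbhs_nbhs.
split => //=; rewrite in_itv/=.
suff : `|Vol Omega y - Vol Omega x| < Num.min (Vol Omega x - a) (b - Vol Omega x).
  by rewrite lt_min !ltr_norml => /andP[/andP[h1 _] /andP[_ h2]]; lra.
apply: h => //; split.
- by near: y; exact: near_enorm.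
- by move=> z Oz _; exists z => //; rewrite subrr enorm0.
- by move=> z Oz _; exists z => //; rewrite subrr enorm0.
Unshelve. all: by end_near. Qed.

Lemma emeasurable_density (Omega A : set V) : proper_domain Omega ->
  open A -> A `<=` Omega ->
  measurable_fun (A : set B) (EFin \o (Vol Omega : B -> R)).
Proof.
move=> pO oA AO; have [oO _ _ _] := pO; apply/measurable_EFinP.
apply: (@measurable_funS _ _ B _ (Omega : set B) A) => //.
  exact: open_borel_rV.
exact: measurable_density.
Qed.

Lemma density_ge0 (Omega : set V) x : proper_domain Omega -> Omega x ->
  (0 <= (Vol Omega x)%:E)%E.
Proof. by move=> pO Ox; rewrite lee_fin ltW//; exact: density_gt0. Qed.

Lemma le_density_volume (Omega A A' : set V) : proper_domain Omega ->
  A `<=` A' -> A' `<=` Omega ->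
  (density_volume (Vol Omega) A <= density_volume (Vol Omega) A')%E.
Proof.
move=> pO AA' A'O; apply: ge0_integral_subset => // x A'x.
by apply: density_ge0 => //; exact: A'O.
Qed.

Lemma density_volume_anti (Omega Omega' A : set V) :
  proper_domain Omega -> proper_domain Omega' -> open A ->
  A `<=` Omega -> Omega `<=` Omega' ->
  (density_volume (Vol Omega') A <= density_volume (Vol Omega) A)%E.
Proof.
move=> pO pO' oA AO OO'; apply: ge0_le_integral.
- exact: open_borel_rV.
- by move=> x Ax; apply: density_ge0 => //; exact/OO'/AO.
- by apply: emeasurable_density => // x Ax; exact/OO'/AO.
- exact: emeasurable_density.
- by move=> x Ax; rewrite lee_fin; apply: density_monotone => //; exact: AO.
Qed.

Section finite_cover.
Variables (I : finType) (A : I -> set V) (Omega : set V).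
Hypotheses (pO : proper_domain Omega) (oA : forall i, open (A i))
  (AO : forall i, A i `<=` Omega).

Let open_bigsetU s : open (\big[setU/set0]_(i <- s) A i).
Proof. by elim/big_rec: _ => [|i S _ oS]; [exact: open0|exact: openU]. Qed.

Let bigsetU_sub s : \big[setU/set0]_(i <- s) A i `<=` Omega.
Proof. by elim/big_rec: _ => // i S _ SO x [/AO|/SO]. Qed.

Let bigsetUP x : (\big[setU/set0]_i A i) x <-> exists i, A i x.
Proof.
rewrite -bigcup_seq; split=> [[i _ Aix]|[i Aix]]; exists i => //.
exact: mem_index_enum.
Qed.

Lemma density_volume_cover (K : set V) : (forall x, K x -> exists i, A i x) ->
  (density_volume (Vol Omega) K <= \sum_i density_volume (Vol Omega) (A i))%E.
Proof.
move=> KA; apply: (@le_trans _ _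
    (density_volume (Vol Omega) (\big[setU/set0]_i A i))).
  by apply: le_density_volume => // x /KA; exact: (bigsetUP x).2.
elim: (index_enum I) => [|i s ih].
  by rewrite !big_nil /density_volume integral_set0.
rewrite !big_cons; apply: le_trans (leeD2l _ ih).
set U := \big[setU/set0]_(j <- s) A j.
have mA : measurable (A i : set B) by exact: open_borel_rV.
have mU : measurable (U : set B) by apply: open_borel_rV; exact: open_bigsetU.
have AUE : A i `|` U = A i `|` U `\` A i.
  by rewrite setUDr setDv setD0.
rewrite /density_volume AUE ge0_integral_setU//.
- apply: leeD2l; apply: ge0_integral_subset; last exact: subDsetl.
  by move=> x Ux; apply: density_ge0 => //; exact: bigsetU_sub Ux.
- exact: measurableD.
- apply: (@measurable_funS _ _ B _ (A i `|` U : set B)).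
  + exact: measurableU.
  + by rewrite -AUE.
  + apply: emeasurable_density => //.
      by apply: openU => //; exact: open_bigsetU.
    by move=> x [/AO|/bigsetU_sub].
- move=> x [Ax|[Ux _]]; apply: density_ge0 => //; [exact: AO Ax|].
  exact: bigsetU_sub Ux.
- by rewrite disj_set2E setDIK.
Qed.

Lemma density_volume_packing (K : set V) : (forall i, A i `<=` K) ->
  K `<=` Omega -> (forall i j x, A i x -> A j x -> i = j) ->
  (\sum_i density_volume (Vol Omega) (A i) <= density_volume (Vol Omega) K)%E.
Proof.
move=> AK KO tA; apply: (@le_trans _ _
    (density_volume (Vol Omega) (\big[setU/set0]_i A i))); last first.
  by apply: le_density_volume => // x /bigsetUP[i]; exact: AK.
rewrite /density_volume ge0_integral_bigsetU//.
- by move=> i; exact: open_borel_rV.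
- exact: index_enum_uniq.
- by move=> i j _ _ [x [Aix Ajx]]; exact: tA Aix Ajx.
- exact: emeasurable_density.
- by move=> x Ux; apply: density_ge0 => //; exact: bigsetU_sub Ux.
Qed.

End finite_cover.

End density_volume.

(** * Growth rates *)

Section limf_einf.
Context {R : realType}.
Local Open Scope ereal_scope.

(** Tail infima are compared although f is read at a point r' other than r, which is what absorbs a
    shift of the radius. *)
Lemma limf_einf_scale (f g : R -> \bar R) (k : R) : (0 < k)%R ->
  (forall M, exists M', forall r, (M' < r)%R ->
    exists2 r', (M < r')%R & k%:E * f r' <= g r) ->
  k%:E * limf_einf f (pinfty_nbhs R) <= limf_einf g (pinfty_nbhs R).
Proof.
move=> k0 fg; rewrite -lee_pdivlMl// [X in X <= _]limf_einfE.
apply: ge_ereal_sup => _ [A [M [_ MA]] <-]; rewrite lee_pdivlMl//.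
have [M' M'g] := fg M.
rewrite limf_einfE; apply: le_trans (ereal_sup_ubound _); last first.
  exists [set r | (M' < r)%R]; last reflexivity.
  by exists M'; split => //; exact: num_real.
apply: le_ereal_inf_tmp => _ [r /M'g[r' Mr' fgr] <-].
apply: le_trans fgr; rewrite lee_pmul2l//; apply: ereal_inf_lbound.
by exists r' => //; exact: MA.
Qed.

Lemma bernoulli_le (x : R) n : (0 <= x <= 1)%R -> (1 - x *+ n <= (1 - x) ^+ n)%R.
Proof.
move=> /andP[x0 x1]; elim: n => [|n ih]; first by rewrite mulr0n subr0 expr0.
rewrite exprS mulrS; have := ler_wpM2l (_ : 0 <= 1 - x)%R ih.
rewrite subr_ge0 => /(_ x1); apply: le_trans.
have : (0 <= x *+ n)%R by rewrite mulrn_wge0.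
nra.
Qed.

Lemma near_scale (e c : R) n : (0 < e < 1)%R -> exists M : R, forall r : R,
  (M < r)%R -> [/\ (0 < r)%R, (0 < r + c)%R & (e * r ^+ n <= (r + c) ^+ n)%R].
Proof.
(* By Bernoulli, (1 - |c| / r)^n >= 1 - n |c| / r, which is at least e beyond this bound; [n.+1] in
   place of n also ensures |c| < r. *)
move=> /andP[e0 e1]; exists (`|c| * n.+1%:R / (1 - e))%R => r Mr.
have e1' : (0 < 1 - e)%R by rewrite subr_gt0.
have r0 : (0 < r)%R.
  by apply: le_lt_trans Mr; rewrite divr_ge0// ?mulr_ge0// ltW.
have cr : (`|c| * n.+1%:R < r * (1 - e))%R by rewrite -ltr_pdivrMr.
have c0 : (0 <= `|c|)%R := normr_ge0 c.
have n0 : (0 <= n%:R :> R)%R := ler0n _ n.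
move: cr; rewrite -natr1 => cr.
have crr : (`|c| < r)%R by nra.
have rc : (r - `|c| <= r + c)%R by rewrite lerD2l lerNl ler_normr lerN2 lexx orbT.
have rc0 : (0 < r - `|c|)%R by rewrite subr_gt0.
split => //; first exact: lt_le_trans rc.
apply: (@le_trans _ _ ((r - `|c|) ^+ n))%R; last first.
  by apply: lerXn2r => //; rewrite nnegrE ltW//; exact: lt_le_trans rc.
have -> : (r - `|c| = (1 - `|c| / r) * r)%R by rewrite mulrBl mul1r divfK// gt_eqF.
rewrite exprMn ler_pM2r ?exprn_gt0//.
apply: le_trans (bernoulli_le n _); last first.
  by rewrite divr_ge0 ?(ltW r0)//= ler_pdivrMr// mul1r ltW.
rewrite lerBrDr -lerBrDl -mulrnAl ler_pdivrMr// -mulr_natr; nra.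
Qed.

(** Both inequalities compare the radii r and r - C / 2, at which the arguments of A match. The
    ratio of the powers of these radii tends to 1, so it costs only a factor e < 1, which
    [lee_mul01Pr] removes even when a limit is infinite. *)
Lemma limf_einf_sandwich (A V : R -> \bar R) (n d : nat) (C : R) :
  (forall T, 0 <= A T) -> (0 < n)%N ->
  (forall r, n%:R%:E * A (2 * r - C)%R <= V r) ->
  (forall r, V r <= n%:R%:E * A (2 * r + C)%R) ->
  limf_einf (fun r : R => V r * (r ^- d)%:E) (pinfty_nbhs R) =
  n%:R%:E * limf_einf (fun r : R => A (2 * r)%R * (r ^- d)%:E) (pinfty_nbhs R).
Proof.
move=> A0 n0 AV VA; set F := pinfty_nbhs R.
have nn0 : (0 < n%:R :> R)%R by rewrite ltr0n.
have V0 r : 0 <= V r by apply: le_trans (AV r); rewrite mule_ge0// lee_fin.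
have lim_ge0 (f : R -> \bar R) : (forall r, (0 < r)%R -> 0 <= f r) ->
    0 <= limf_einf f F.
  move=> f0; rewrite limf_einfE; apply: ereal_sup_ge.
  exists (ereal_inf (f @` [set r | (0 < r)%R])).
    by exists [set r | (0 < r)%R] => //; exists 0%R.
  by apply: le_ereal_inf_tmp => _ [r r0 <-]; exact: f0.
have rd0 r : (0 < r)%R -> 0 <= (r ^- d)%:E.
  by move=> r0; rewrite lee_fin invr_ge0 exprn_ge0// ltW.
have scaleV (e r r' : R) : (0 < r)%R -> (0 < r')%R ->
    (e * r ^+ d <= r' ^+ d)%R -> (e * r' ^- d <= r ^- d)%R.
  move=> r0 r'0 er; rewrite ler_pdivrMr ?exprn_gt0// mulrC.
  by rewrite ler_pdivlMr ?exprn_gt0.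
apply/eqP; rewrite eq_le; apply/andP; split.
  rewrite muleC -lee_pdivrMr//; apply/lee_mul01Pr.
    rewrite mule_ge0 ?lim_ge0// ?lee_fin ?invr_ge0 ?ltW// => r r0.
    by rewrite mule_ge0// ?rd0.
  move=> e e01; have [e0 e1] := andP e01.
  rewrite [X in _ * X]muleC muleA -EFinM.
  apply: limf_einf_scale; first by rewrite mulr_gt0 ?invr_gt0.
  move=> M; have [M1 hM1] := near_scale (- (C / 2)) d e01.
  exists (Num.max M1 (M + C / 2)%R) => r; rewrite gt_max => /andP[/hM1[r0 r'0 er] Mr].
  exists (r - C / 2)%R; first by rewrite ltrBrDr.
  set r' := (r - C / 2)%R in r'0 er *.
  have -> : A (2 * r)%R = A (2 * r' + C)%R by congr A; rewrite /r'; field.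
  apply: (@le_trans _ _ ((e * n%:R^-1)%:E *
      ((n%:R%:E * A (2 * r' + C)%R%E) * (r' ^- d)%:E))).
    apply: lee_wpmul2l; first by rewrite lee_fin mulr_ge0 ?invr_ge0 ?ltW.
    by apply: lee_wpmul2r; [exact: rd0|exact: VA].
  rewrite !muleA -EFinM divfK ?gt_eqF// muleAC -EFinM muleC.
  by apply: lee_wpmul2l => //; rewrite lee_fin; exact: scaleV.
apply/lee_mul01Pr.
  rewrite mule_ge0 ?lim_ge0// ?lee_fin// => r r0.
  by rewrite mule_ge0// ?rd0.
move=> e e01; have [e0 e1] := andP e01.
rewrite muleA -EFinM; apply: limf_einf_scale; first by rewrite mulr_gt0.
move=> M; have [M1 hM1] := near_scale (- (C / 2)) d e01.
exists (Num.max M1 (M + C / 2)%R) => r; rewrite gt_max => /andP[/hM1[r0 r'0 er] Mr].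
exists (r - C / 2)%R; first by rewrite ltrBrDr.
set r' := (r - C / 2)%R in r'0 er *.
have E : (2 * r' = 2 * r - C)%R by rewrite /r'; field.
rewrite E; apply: (@le_trans _ _ ((n%:R%:E * A (2 * r - C)%R) * (r ^- d)%:E)).
  rewrite [X in _ * X <= _]muleC muleA -EFinM [X in _ <= X * _]muleC.
  rewrite -[X in _ <= X]muleA -EFinM muleC; apply: lee_wpmul2l => //.
  by rewrite lee_fin mulrAC [leRHS]mulrC ler_wpM2r//; exact: scaleV.
by apply: lee_wpmul2r; [exact: rd0|exact: AV].
Qed.
End limf_einf.

(** * Hilbert distance *)

Section hilbert_distance.
Context {R : realType} {d : nat}.
Local Notation V := 'rV[R]_d.

Lemma nbhs_line (x v : V) t (A : set V) : nbhs (x + t *: v) A ->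
  exists2 e : R, 0 < e & forall s, `|s - t| < e -> A (x + s *: v).
Proof.
move=> /nbhs_ballP[e /= e0 eA].
pose M := 1 + \sum_j `|v 0 j|.
have M0 : 0 < M by rewrite ltr_pwDl// sumr_ge0.
exists (e / M) => [|s st]; first by rewrite divr_gt0.
apply/eA/(ball_rVP _ _ e0) => j; rewrite !mxE.
rewrite (_ : _ - _ = (t - s) * v 0 j); last by ring.
rewrite normrM distrC.
apply: (@le_lt_trans _ _ (`|s - t| * M)); last by rewrite -ltr_pdivlMr.
rewrite ler_wpM2l// /M (bigD1 j)//= addrCA lerDl addr_ge0// sumr_ge0//.
Qed.

Lemma enormZ t (u : V) : 0 <= t -> enorm (t *: u) = t * enorm u.
Proof.
move=> t0; rewrite /enorm !dotpE.
rewrite (_ : \sum_j _ = t ^+ 2 * \sum_j u 0 j * u 0 j); last first.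
  by rewrite mulr_sumr; apply: eq_bigr => j _; rewrite !mxE; ring.
by rewrite sqrtrM ?sqr_ge0// sqrtr_sqr ger0_norm.
Qed.

Lemma enorm_gt0 (u : V) : u != 0 -> 0 < enorm u.
Proof.
move=> u0; rewrite sqrtr_gt0 dotpE; apply: sumr_gt0 => [j|h].
  by rewrite -expr2 sqr_ge0.
case/eqP: u0; apply/rowP => j; rewrite mxE.
by have /eqP := h j; rewrite mulf_eq0 orbb => /eqP.
Qed.

Variable Omega : set V.
Hypothesis oO : open Omega.

(** The bounds below are derived for an arbitrary boundary point beyond q, which is all that [xget]
    provides; |b - p| / |b - q| becomes t / (t - 1). *)
Lemma exit_ratioP (p q : V) : p != q ->
  (~ (exit_point Omega p q !=set0) /\ exit_ratio Omega p q = 1) \/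
  exists t, [/\ 1 < t, boundary Omega (p + t *: (q - p)) &
    exit_ratio Omega p q = t / (t - 1)].
Proof.
move=> pq; rewrite /exit_ratio; case: pselect => [ex|nex]; [right|by left].
have := xgetPex 0 ex; rewrite /=.
set c := xget _ _ => -[bc [t t1 cE]]; exists t; split => //; first by rewrite -cE.
have e0 : 0 < enorm (q - p) by rewrite enorm_gt0// subr_eq0 eq_sym.
have -> : c - p = t *: (q - p) by rewrite cE addrC addKr.
have -> : c - q = (t - 1) *: (q - p).
  by rewrite cE; apply/rowP => j; rewrite !mxE; ring.
rewrite !enormZ ?subr_ge0 ?(ltW t1)// ?(le_trans ler01 (ltW t1))//.
by rewrite invfM mulrACA mulfV ?mulr1 ?gt_eqF.
Qed.

Lemma exit_ratio_ge1 (p q : V) : p != q -> 1 <= exit_ratio Omega p q.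
Proof.
move=> /exit_ratioP[[_ ->]//|[t [t1 _ ->]]].
by rewrite ler_pdivlMr ?subr_gt0// mul1r gerBl.
Qed.

Lemma not_boundary x : Omega x -> ~ boundary Omega x.
Proof. by move=> Ox [_]; apply; exact: open_nbhs_nbhs. Qed.

(** The exit point avoids the box of radius e around q, so (t - 1) D >= e, while t / (t - 1) = 1 + 1
    / (t - 1). *)
Lemma exit_ratio_le (p q : V) (e D : R) : p != q -> 0 < e -> 0 < D ->
  (forall y : V, (forall j, `|y 0 j - q 0 j| < e) -> Omega y) ->
  (forall j, `|q 0 j - p 0 j| <= D) ->
  exit_ratio Omega p q <= 1 + D / e.
Proof.
move=> pq e0 D0 eO qpD; have [[_ ->]|[t [t1 tb ->]]] := exit_ratioP pq.
  by rewrite lerDl divr_ge0 ?ltW.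
have t10 : 0 < t - 1 by rewrite subr_gt0.
have eD : e <= (t - 1) * D.
  rewrite leNgt; apply/negP => De; case: (not_boundary _ tb); apply: eO => j.
  apply: le_lt_trans De; rewrite !mxE (_ : _ - _ = (t - 1) * (q 0 j - p 0 j)).
    by rewrite normrM (gtr0_norm t10) ler_pM2l.
  ring.
have -> : t / (t - 1) = 1 + (t - 1)^-1 by field; rewrite gt_eqF.
by rewrite lerD2l ler_pdivlMr// mulrC ler_pdivrMr// mulrC.
Qed.

Lemma aff_closure m (N : 'M[R]_(d + 1, m)) j (A : set V) x :
  (forall y, A y -> 0 <= aff N y j) -> closure A x -> 0 <= aff N x j.
Proof.
move=> A0 Ax.
have cF : closed ((fun y => aff N y j) @^-1` [set t : R | 0 <= t]).
  by apply: closed_comp => [y _|]; [exact: continuous_aff|exact: closed_ge].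
by have := closureS A0 Ax; rewrite -((closure_id _).1 cF).
Qed.

Hypothesis bO : exists D : R, forall x, Omega x -> forall j, `|x 0 j| <= D.

Lemma exit_point_exists p q : Omega p -> Omega q -> p != q ->
  exit_point Omega p q !=set0.
Proof.
move=> Op Oq pq; have [D OD] := bO.
(* The exit point is taken at the supremum of S: it is a limit of points of Omega, and openness
   keeps it out of Omega. *)
pose S := [set t : R | Omega (p + t *: (q - p))].
have S1 : S 1 by rewrite /S/= scale1r addrC subrK.
have hS : has_sup S.
  split; first by exists 1.
  have [j /eqP qpj] : exists j, q 0 j - p 0 j <> 0.
    apply: contrapT => /forallNP h; case/eqP: pq; apply/rowP => j.
    by have /contrapT/subr0_eq -> := h j.
  exists ((D + D) / `|q 0 j - p 0 j|) => t St.
  rewrite ler_pdivlMr ?normr_gt0//.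
  apply: (@le_trans _ _ `|t * (q 0 j - p 0 j)|).
    by rewrite normrM ler_wpM2r// ler_norm.
  have -> : t * (q 0 j - p 0 j) = (p + t *: (q - p)) 0 j - p 0 j.
    by rewrite !mxE; ring.
  by apply: le_trans (ler_normB _ _) _; apply: lerD; exact: OD.
have nO : ~ Omega (p + sup S *: (q - p)).
  move=> sO; have [e e0 he] := nbhs_line (open_nbhs_nbhs (conj oO sO)).
  have : sup S + e / 2 <= sup S.
    apply: sup_upper_bound => //; apply: he.
    by rewrite addrC addKr gtr0_norm ?divr_gt0// ltr_pdivrMr// ltr_pMr// ltr1n.
  by rewrite gerDl leNgt divr_gt0.
have s1 : 1 < sup S.
  rewrite lt_neqAle sup_upper_bound// andbT; apply/eqP => s1; apply: nO.
  by rewrite -s1.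
exists (p + sup S *: (q - p)); split; last by exists (sup S).
split; last by move=> /interior_subset.
move=> A /nbhs_line[e e0 he].
have [t St te] := sup_adherent e0 hS.
exists (p + t *: (q - p)); split => //; apply: he.
by rewrite distrC ger0_norm ?subr_ge0 ?sup_upper_bound// ltrBlDr -ltrBlDl.
Qed.

(** The functional is still nonnegative at the exit point, where it equals (1 - t) f(p) + t f(q);
    hence f(p) / f(q) <= t / (t - 1). *)
Lemma exit_ratio_ge m (N : 'M[R]_(d + 1, m)) j p q :
  (forall x, Omega x -> 0 < aff N x j) -> Omega p -> Omega q -> p != q ->
  aff N p j / aff N q j <= exit_ratio Omega p q.
Proof.
move=> N0 Op Oq pq; have [[nex _]|[t [t1 [tb _] ->]]] := exit_ratioP pq.
  by case: nex; exact: exit_point_exists.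
have := aff_closure (fun y Oy => ltW (N0 y Oy)) tb; rewrite aff_segment => h.
rewrite ler_pdivrMr ?N0// mulrAC ler_pdivlMr ?subr_gt0//.
by move: h; rewrite mulrBl mul1r; lra.
Qed.

(** One exit ratio is at least f(p) / f(q) and the other at least 1. The factor 1/2 in the distance
    is the origin of the 2 r in all sectors. *)
Lemma hilbert_dist_ge m (N : 'M[R]_(d + 1, m)) j p q r :
  (forall x, Omega x -> 0 < aff N x j) -> Omega p -> Omega q ->
  hilbert_dist Omega p q <= r -> expR (- (2 * r)) * aff N p j <= aff N q j.
Proof.
move=> N0 Op Oq; rewrite /hilbert_dist; case: eqVneq => [->|pq].
  by move=> r0; rewrite ger_pMl ?N0// expR_le1 oppr_le0 mulr_ge0//.
move=> h; rewrite expRN mulrC ler_pdivrMr ?expR_gt0// mulrC -ler_pdivrMr ?N0//.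
have pq1 := exit_ratio_ge1 pq; have pq0 := lt_le_trans ltr01 pq1.
have qp1 : 1 <= exit_ratio Omega q p by rewrite exit_ratio_ge1// eq_sym.
apply: (le_trans (exit_ratio_ge N0 Op Oq pq)).
apply: (@le_trans _ _ (exit_ratio Omega q p * exit_ratio Omega p q)).
  by rewrite ler_peMl// ltW.
rewrite -ler_ln ?posrE ?expR_gt0 ?mulr_gt0 ?(lt_le_trans ltr01)//.
by rewrite expRK [leRHS]mulrC -ler_pdivrMr// [leLHS]mulrC.
Qed.

Lemma hilbert_dist_le (p q : V) (e e' D r : R) : 0 < e -> 0 < e' -> 0 < D -> 0 <= r ->
  (forall y : V, (forall j, `|y 0 j - p 0 j| < e) -> Omega y) ->
  (forall y : V, (forall j, `|y 0 j - q 0 j| < e') -> Omega y) ->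
  (forall j, `|q 0 j - p 0 j| <= D) ->
  (1 + D / e) * (1 + D / e') <= expR (2 * r) ->
  hilbert_dist Omega p q <= r.
Proof.
move=> e0 e'0 D0 r0 pO qO pqD h; rewrite /hilbert_dist; case: eqVneq => // pq.
rewrite [leLHS]mulrC ler_pdivrMr// [leRHS]mulrC -[leRHS]expRK ler_ln ?posrE ?expR_gt0//.
  apply: le_trans h; apply: ler_pM.
  - by rewrite (le_trans ler01)// exit_ratio_ge1// eq_sym.
  - by rewrite (le_trans ler01)// exit_ratio_ge1.
  - by apply: exit_ratio_le => // [|j]; [rewrite eq_sym|rewrite distrC].
  - exact: exit_ratio_le.
by rewrite mulr_gt0// (lt_le_trans ltr01)// exit_ratio_ge1// eq_sym.
Qed.

End hilbert_distance.

(** * Volume of a body covered and packed by sectors *)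

Section asymptotic_volume.
Context {R : realType} {d : nat}.
Local Notation V := 'rV[R]_d.
Variable Vol : volume_notion R d.

Lemma interior_boxP (A : set V) (x : V) : A° x <->
  exists2 e : R, 0 < e & forall y : V, (forall j, `|y 0 j - x 0 j| < e) -> A y.
Proof.
split=> [/nbhs_ballP[e /= e0 eA]|[e e0 eA]].
  exists e => // y xy; apply/eA/(ball_rVP _ _ e0) => j; rewrite distrC; exact: xy.
apply/nbhs_ballP; exists e => // y /(ball_rVP _ _ e0) xy; apply: eA => j.
by rewrite distrC; exact: xy.
Qed.

Lemma interior_box_open (A : set V) (x : V) (e : R) : 0 < e ->
  (forall y : V, (forall j, `|y 0 j - x 0 j| < e) -> A y) ->
  forall y : V, (forall j, `|y 0 j - x 0 j| < e) -> A° y.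
Proof.
move=> e0 eA y xy; apply: (@interiorS _ (ball x e)).
  move=> z /(ball_rVP _ _ e0) xz; apply: eA => j; rewrite distrC; exact: xz.
rewrite (interior_id _).1; last exact: ball_open.
by apply/(ball_rVP _ _ e0) => j; rewrite distrC; exact: xy.
Qed.

Lemma proper_interior (K : set V) :
  (forall x y t, K x -> K y -> 0 <= t <= 1 -> K (t *: x + (1 - t) *: y)) ->
  (exists D : R, forall x, K x -> forall j, `|x 0 j| <= D) ->
  K° !=set0 -> proper_domain K°.
Proof.
move=> cK [D KD] K0; split => //; first exact: open_interior.
- apply: convex_setE => x y t /interior_boxP[e e0 eK] /interior_boxP[e' e'0 e'K] t01.
  apply/interior_boxP; exists (Num.min e e') => [|z]; first by rewrite lt_min e0.
  move=> zxy; pose u := z - (t *: x + (1 - t) *: y).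
  rewrite (_ : z = t *: (x + u) + (1 - t) *: (y + u)); last first.
    by apply/rowP => j; rewrite !mxE; ring.
  have uj j : `|u 0 j| < Num.min e e' by rewrite !mxE; have := zxy j; rewrite !mxE.
  apply: cK => //; [apply: eK|apply: e'K] => j; rewrite [(_ + u) 0 j]mxE addrAC subrr add0r;
    by have := uj j; rewrite lt_min => /andP[].
- move=> [x [v [/eqP v0 xv]]]; apply: v0; apply/rowP => j; rewrite mxE.
  apply: contrapT => /eqP vj.
  have D0 : 0 <= D by have := KD _ (interior_subset (xv 0)) j; exact: le_trans.
  have := KD _ (interior_subset (xv ((D + D + 1) / v 0 j))) j.
  rewrite !mxE divfK// => h.
  have := KD _ (interior_subset (xv 0)) j; rewrite scale0r addr0 => h'.
  by move: h h'; rewrite !ler_norml => /andP[_ h] /andP[h' _]; lra.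
Qed.

(** A last column of ones in [invmx N] says that the vertices are finite and normalised; the
    coordinates are then barycentric, by expanding the constant functional 1. *)
Lemma sum_aff (N : 'M[R]_(d + 1)) (x : V) : N \in unitmx ->
  (forall j, invmx N j (rshift d 0) = 1) -> \sum_j aff N x j = 1.
Proof.
move=> uN N1; have <- : aff (1%:M : 'M[R]_(d + 1)) x (rshift d 0) = 1.
  by rewrite /aff mulmx1 row_mxEr mxE eqxx.
rewrite -(mulmxV uN) affM.
by apply: eq_bigr => j _; rewrite N1 mulr1.
Qed.

(** Same simplex, different sectors: for small s, coordinates that decrease up to a bounded factor
    become strictly decreasing; for large s, strict decrease forces each original coordinate to
    dominate the next. *)
Definition graded_frame (N : 'M[R]_(d + 1)) (s : R) : 'M[R]_(d + 1) :=
  N *m diag_mx (\row_j s ^+ j).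

Lemma aff_graded N s x j : aff (graded_frame N s) x j = s ^+ j * aff N x j.
Proof.
rewrite /aff /graded_frame mulmxA mul_mx_diag mxE [(\row__ _) _ _]mxE mulrC.
by rewrite /aff.
Qed.

Lemma orthant_graded N s : 0 < s -> orthant (graded_frame N s) = orthant N.
Proof.
move=> s0; apply/seteqP; split=> x Nx j; have := Nx j.
  by rewrite aff_graded pmulr_rgt0// exprn_gt0.
by rewrite aff_graded pmulr_rgt0// exprn_gt0.
Qed.

Lemma frame_graded N s : 0 < s -> frame N -> frame (graded_frame N s).
Proof.
move=> s0 [uN N0]; pose D : 'rV[R]_(d + 1) := \row_j s ^- j.
have DE : diag_mx (\row_j s ^+ j) *m diag_mx D = 1%:M :> 'M[R]_(d + 1).
  rewrite mulmx_diag -diag_const_mx; congr diag_mx; apply/rowP => j.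
  by rewrite !mxE mulfV// expf_neq0// gt_eqF.
have uN' : graded_frame N s \in unitmx.
  by rewrite unitmx_mul uN; have [] := mulmx1_unit DE.
split => // j; suff -> : invmx (graded_frame N s) = diag_mx D *m invmx N.
  by rewrite mul_diag_mx mxE mulr_ge0// mxE invr_ge0 exprn_ge0// ltW.
apply: (can_inj (mulKmx uN')); rewrite mulmxV// /graded_frame -mulmxA.
by rewrite [X in N *m X]mulmxA DE mul1mx mulmxV.
Qed.

(** By [sector_volume] all frames have the same growth, which serves as common unit for the polytope
    and the simplex. *)
Definition sector_growth (N : 'M[R]_(d + 1)) : \bar R :=
  limf_einf (fun r : R => density_volume (Vol (orthant N)) (sector N (2 * r)) *
    (r ^- d)%:E)%E (pinfty_nbhs R).

(* The simplices [N i] are contained in K and the simplices [M i] contain it;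
   with the monotonicity of the density, covering a Hilbert ball by sectors of the
   former bounds its volume from above, packing it with sectors of the latter
   bounds it from below. *)
Variables (K : set V) (p v : V) (I : finType) (N M : I -> 'M[R]_(d + 1)) (b : R).
Hypotheses
  (convK : forall x y t, K x -> K y -> 0 <= t <= 1 -> K (t *: x + (1 - t) *: y))
  (boundK : exists D : R, forall x, K x -> forall j, `|x 0 j| <= D)
  (Kp : K° p) (Kv : K° v) (b01 : 0 < b <= 1)
  (unitN : forall i, N i \in unitmx)
  (lastN : forall i j, invmx (N i) j (rshift d 0) = 1)
  (NK : forall i, orthant (N i) `<=` K)
  (coverN : forall x, K° x -> exists i, [/\ orthant (N i) x,
     forall j k : 'I_(d + 1), (j < k)%N -> b * aff (N i) x k <= aff (N i) x j &
     exists g : 'cV[R]_(d + 1), [/\ forall y, K° y -> 0 < aff g y 0,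
       b <= aff g p 0 & forall j, b * aff g x 0 <= aff (N i) x j]])
  (frameM : forall i, frame (M i))
  (KM : forall i, K° `<=` orthant (M i))
  (sectorM : forall i T x, sector (M i) T x ->
     exists2 t : R, b * expR (- T) <= t & forall y, K y -> K (x + t *: (y - v)))
  (disjM : forall i j T x, sector (M i) T x -> sector (M j) T x -> i = j).

Let frameN i : frame (N i).
Proof. by split => // j; rewrite lastN. Qed.

Let b0 : 0 < b. Proof. by case/andP: b01. Qed.

Let pO : proper_domain K°.
Proof. by apply: proper_interior => //; exists p. Qed.

Let NK' i : orthant (N i) `<=` K°.
Proof.
move=> x Nx; apply: (interiorS (@NK i)).
by apply: open_nbhs_nbhs; split => //; exact: open_orthant.
Qed.

Let boundKo : exists D : R, forall x, K° x -> forall j, `|x 0 j| <= D.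
Proof. by have [D KD] := boundK; exists D => x /interior_subset; exact: KD. Qed.

(** The ordering comes from [s < b]. The lower bound on the coordinates comes from the functional g
    of [coverN]: it cannot drop below exp(-2r) g(p) on the ball, and it bounds every coordinate from
    below. *)
Lemma hilbert_ball_sub_sectors : exists C : R, forall r x,
  hilbert_ball K° p r x -> exists i, sector (graded_frame (N i) (b / 2)) (2 * r + C) x.
Proof.
have [_ b1] := andP b01.
pose s := b / 2; have s0 : 0 < s by rewrite divr_gt0.
have sb : s < b by rewrite ltr_pdivrMr// ltr_pMr// ltr1n.
have s1 : s < 1 by exact: lt_le_trans sb _.
(* Grading costs at most s^d; the bounds on g(p) and on the coordinates in terms of g(x) cost b
   each; halving makes the inequality strict. *)
pose c := s ^+ d * (b * b) / 2.
have c0 : 0 < c by rewrite divr_gt0// !mulr_gt0// exprn_gt0.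
exists (- ln c) => r x [Kx pxr].
have [i [Nx slack [g [g0 gp gx]]]] := coverN Kx.
exists i; have fx j : aff (graded_frame (N i) s) x j = s ^+ j * aff (N i) x j.
  exact: aff_graded.
split; first by rewrite -/s orthant_graded.
split=> [j k jk|j k]; rewrite !fx.
  rewrite -(subnKC (ltnW jk)) exprD -mulrA ltr_pM2l ?exprn_gt0//.
  apply: lt_le_trans (slack _ _ jk); rewrite ltr_pM2r; last exact: Nx.
  apply: le_lt_trans sb; rewrite -[leRHS]expr1; apply: ler_wiXn2l.
  - exact: ltW.
  - exact: ltW.
  - by rewrite subn_gt0.
have := hilbert_dist_ge (open_interior K) boundKo g0 Kp Kx pxr => h.
have xj1 : aff (N i) x j <= 1.
  rewrite -(sum_aff x (unitN i) (lastN i)) (bigD1 j)//= lerDl sumr_ge0// => l _.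
  by apply/ltW; exact: Nx.
have sj1 : s ^+ j <= 1 by rewrite exprn_ile1// ltW.
have sjx : s ^+ j * aff (N i) x j <= 1.
  by rewrite -[leRHS]mulr1 ler_pM// ?exprn_ge0 ?ltW//; exact: Nx.
have ex : expR (- (2 * r)) * (b * b) <= aff (N i) x k.
  apply: le_trans (gx k); rewrite mulrCA ler_pM2l//.
  apply: le_trans h; rewrite ler_pM2l ?expR_gt0//.
apply: (@le_lt_trans _ _ (expR (- (2 * r)) * c)).
  rewrite opprD opprK expRD lnK ?posrE// ler_piMr// mulr_ge0 ?expR_ge0//.
  exact: ltW.
apply: (@lt_le_trans _ _ (s ^+ k * (expR (- (2 * r)) * (b * b)))); last first.
  by rewrite ler_pM2l// exprn_gt0.
rewrite [ltRHS]mulrCA ltr_pM2l ?expR_gt0// /c.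
apply: (@lt_le_trans _ _ (s ^+ d * (b * b))).
  by rewrite ltr_pdivrMr// ltr_pMr ?ltr1n// !mulr_gt0// exprn_gt0.
by rewrite ler_pM2r ?mulr_gt0// ler_wiXn2l ?ltW// -ltnS -[d.+1]addn1.
Qed.

(** The map y -> x + t (y - v) sends K into K and v to x, so it carries a box around v in K to a box
    around x whose radius is of order exp(-T); this bounds the exit ratio at x. *)
Lemma sectors_sub_hilbert_ball : exists C : R, forall i r,
  sector (M i) (2 * r - C) `<=` hilbert_ball K° p r.
Proof.
have /interior_boxP[ep ep0 epK] := Kp; have /interior_boxP[ev ev0 evK] := Kv.
have [D0 KD0] := boundK; pose D := `|D0| + `|D0| + 1.
have Dpos : 0 < D by rewrite ltr_wpDl// addr_ge0.
have DK x y j : K x -> K y -> `|x 0 j - y 0 j| <= D.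
  move=> Kx Ky; apply: le_trans (ler_normB _ _) _.
  have := KD0 _ Kx j; have := KD0 _ Ky j; have := ler_norm D0; rewrite /D; lra.
(* The first factor bounds the exit ratio at p. At x the box has radius
   [t * ev >= b * ev * expR (- T)], so the exit ratio there is at most exp(T) times the second
   factor. *)
pose c := (1 + D / ep) * (1 + D / (b * ev)).
have c1 : 1 <= c.
  by rewrite -[leLHS]mulr1 ler_pM// lerDl ?divr_ge0 ?mulr_ge0// ltW.
have c0 : 0 < c := lt_le_trans ltr01 c1.
exists (ln c) => i r x Mx; set T := 2 * r - ln c in Mx *.
(* From the pair i = j in the definition of a sector; it gives r >= 0, which [hilbert_dist_le]
   requires for x = p. *)
have T0 : 0 < T.
  have [Nx [_ /(_ (rshift d 0) (rshift d 0))]] := Mx.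
  rewrite -[X in _ < X]mul1r ltr_pM2r; last exact: Nx.
  by rewrite expR_lt1 oppr_lt0.
have [t tb tK] := sectorM Mx.
have t0 : 0 < t by apply: lt_le_trans tb; rewrite mulr_gt0// expR_gt0.
have xK (y : V) : (forall j, `|y 0 j - x 0 j| < t * ev) -> K y.
  move=> xy; rewrite (_ : y = x + t *: ((v + t^-1 *: (y - x)) - v)); last first.
    by rewrite addrAC subrr add0r scalerA mulfV ?gt_eqF// scale1r addrC subrK.
  apply: tK; apply: evK => j.
  rewrite (_ : _ - _ = t^-1 * (y 0 j - x 0 j)); last by rewrite !mxE; ring.
  by rewrite normrM gtr0_norm ?invr_gt0// mulrC ltr_pdivrMr// mulrC; have := xy j.
have te0 : 0 < t * ev by rewrite mulr_gt0.
have Kx : K° x by apply: (interior_box_open te0 xK) => j; rewrite subrr normr0.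
split => //.
have r0 : 0 <= r.
  have lc : 0 <= ln c by rewrite ln_ge0.
  by move: T0; rewrite /T; lra.
apply: (@hilbert_dist_le _ _ _ (open_interior K) p x ep (t * ev) D) => //.
- exact: interior_box_open.
- exact: interior_box_open.
- by move=> j; apply: DK; exact: interior_subset.
have -> : 2 * r = T + ln c by rewrite /T subrK.
rewrite expRD lnK ?posrE// /c mulrCA ler_pM2l; last first.
  by rewrite ltr_wpDr// divr_ge0// ltW.
rewrite mulrDr mulr1; apply: lerD.
  by rewrite -expR0 ler_expR ltW.
have bt : b <= t * expR T by rewrite -ler_pdivrMr ?expR_gt0// -expRN.
rewrite ler_pdivrMr// (_ : _ * (t * ev) = D * (t * expR T / b)); last first.
  by field; rewrite !gt_eqF.
by rewrite ler_peMr ?(ltW Dpos)// ler_pdivlMr// mul1r.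
Qed.

Theorem asvol_sectors N0 : frame N0 ->
  asvol Vol K p = (#|I|%:R%:E * sector_growth N0)%E.
Proof.
move=> fN0; have [C1 up] := hilbert_ball_sub_sectors.
have [C2 low] := sectors_sub_hilbert_ball.
pose A T := density_volume (Vol (orthant N0)) (sector N0 T).
pose C := Num.max C1 C2.
have b20 : 0 < b / 2 by rewrite divr_gt0.
have AS N' N'' T T' : frame N' -> frame N'' -> T <= T' ->
    (density_volume (Vol (orthant N')) (sector N' T) <=
     density_volume (Vol (orthant N'')) (sector N'' T'))%E.
  move=> fN' fN'' TT'; rewrite (sector_volume Vol T' fN'' fN').
  apply: le_density_volume; [exact: proper_orthant| |exact: sector_orthant].
  move=> x [Nx [x1 x2]]; split => //; split => // i j.
  apply: le_lt_trans (x2 i j); rewrite ler_pM2r; last exact: Nx.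
  by rewrite ler_expR lerN2.
have sumA T : (\sum_(i : I) A T = #|I|%:R%:E * A T)%E.
  by rewrite sumr_const mule_natl.
apply: (@limf_einf_sandwich _ A _ _ _ C).
- move=> T; apply: integral_ge0 => x Sx.
  by apply: density_ge0; [exact: proper_orthant|exact: sector_orthant Sx].
- by apply/card_gt0P; have [i _] := coverN Kp; exists i.
- move=> r; rewrite -sumA; apply: (@le_trans _ _
      (\sum_i density_volume (Vol K°) (sector (M i) (2 * r - C2)))%E).
    apply: lee_sum => i _; apply: (@le_trans _ _
        (density_volume (Vol (orthant (M i))) (sector (M i) (2 * r - C2)))).
      by apply: AS => //; rewrite lerD2l lerN2 le_max lexx orbT.
    apply: density_volume_anti => //; [exact: proper_orthant|exact: open_sector|].
    by move=> x /low[].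
  apply: density_volume_packing => //.
  + by move=> i; exact: open_sector.
  + by move=> i x /low[].
  + by move=> x [].
  + by move=> i j x; exact: disjM.
- move=> r; rewrite -sumA; pose S i := sector (graded_frame (N i) (b / 2)) (2 * r + C1).
  have SN i : S i `<=` orthant (N i).
    by rewrite -(orthant_graded (N i) b20); exact: sector_orthant.
  apply: (@le_trans _ _ (\sum_i density_volume (Vol K°) (S i))%E).
    apply: density_volume_cover => //.
    + by move=> i; exact: open_sector.
    + by move=> i x /SN /NK'.
    + exact: up.
  apply: lee_sum => i _; apply: (@le_trans _ _
      (density_volume (Vol (orthant (N i))) (S i))).
    by apply: density_volume_anti => //; [exact: proper_orthant|exact: open_sector].
  rewrite -(orthant_graded (N i) b20); apply: AS => //; first exact: frame_graded.
  by rewrite lerD2l le_max lexx.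
Qed.

End asymptotic_volume.

(** * Convex hulls and barycentric coordinates *)

Section convex_hulls.
Context {R : realType} {d : nat}.
Local Notation V := 'rV[R]_d.

Lemma conv_hull_convex (S : set V) x y t : conv_hull S x -> conv_hull S y ->
  0 <= t <= 1 -> conv_hull S (t *: x + (1 - t) *: y).
Proof.
move=> [n [a [u [Su a0 a1 ->]]]] [m [c [w [Sw c0 c1 ->]]]] /andP[t0 t1].
exists (n + m)%N, (fun i : 'I_(n + m) => match fintype.split i with inl j => t * a j
  | inr j => (1 - t) * c j end),
  (fun i : 'I_(n + m) => match fintype.split i with inl j => u j | inr j => w j end).
split.
- by move=> i; case: fintype.split.
- by move=> i; case: fintype.split => j; rewrite mulr_ge0// subr_ge0.
- rewrite big_split_ord/=.
  under eq_bigr do rewrite (unsplitK (inl _)).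
  under [X in _ + X]eq_bigr do rewrite (unsplitK (inr _)).
  by rewrite -!mulr_sumr a1 c1 !mulr1 addrC subrK.
- rewrite big_split_ord/=.
  under [X in _ = X + _]eq_bigr do rewrite (unsplitK (inl _)).
  under [X in _ = _ + X]eq_bigr do rewrite (unsplitK (inr _)).
  by rewrite !scaler_sumr; congr (_ + _); apply: eq_bigr => i _; rewrite scalerA.
Qed.

Lemma conv_hull_range n (a : 'I_n -> V) x : conv_hull (range a) x <->
  exists t : 'I_n -> R, [/\ forall i, 0 <= t i, \sum_i t i = 1 &
    x = \sum_i t i *: a i].
Proof.
split=> [[m [t [y [ay t0 t1 ->]]]]|[t [t0 t1 ->]]]; last first.
  by exists n, t, a; split => // i; exists i.
have /choice[f fE] : forall i, exists j, a j = y i.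
  by move=> i; have [j _ ajy] := ay i; exists j.
exists (fun j => \sum_(i | f i == j) t i); split.
- by move=> j; apply: sumr_ge0.
- by rewrite -t1 (partition_big f xpredT).
- rewrite (partition_big f xpredT)//=; apply: eq_bigr => j _.
  by rewrite scaler_suml; apply: eq_bigr => i /eqP <-; rewrite fE.
Qed.

Lemma conv_hull_bounded n (a : 'I_n -> V) :
  exists D : R, forall x, conv_hull (range a) x -> forall j, `|x 0 j| <= D.
Proof.
exists (\sum_i \sum_j `|a i 0 j|) => _ /conv_hull_range[t [t0 t1 ->]] j.
rewrite summxE; apply: le_trans (ler_norm_sum _ _ _) _; apply: ler_sum => i _.
rewrite mxE normrM (ger0_norm (t0 i)); apply: (@le_trans _ _ `|a i 0 j|).
  rewrite ler_piMl// -t1 (bigD1 i)//= lerDl sumr_ge0// => k _; exact: t0.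
by rewrite (bigD1 j)//= lerDl sumr_ge0.
Qed.

(** The columns of the inverse are the barycentric coordinate functionals, and the last column of
    ones is the frame condition for that inverse. *)
Definition points_mx (u : 'I_(d + 1) -> V) : 'M[R]_(d + 1) :=
  \matrix_(i, j) (row_mx (u i) 1%:M : 'rV_(d + 1)) 0 j.

Lemma row_points_mx (u : 'I_(d + 1) -> V) i :
  row i (points_mx u) = row_mx (u i) 1%:M.
Proof. by apply/rowP => j; rewrite !mxE. Qed.

Lemma mul_points_mx (u : 'I_(d + 1) -> V) (t : 'rV[R]_(d + 1)) :
  t *m points_mx u = row_mx (\sum_i t 0 i *: u i) (\sum_i t 0 i)%:M.
Proof.
rewrite mulmx_sum_row; under eq_bigr do rewrite row_points_mx.
apply/rowP => j; rewrite summxE; case: (@split_ordP d 1 j) => k ->.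
  rewrite row_mxEl summxE; apply: eq_bigr => i _.
  by rewrite mxE row_mxEl mxE.
rewrite row_mxEr ord1 [RHS]mxE eqxx mulr1n; apply: eq_bigr => i _.
by rewrite mxE row_mxEr mxE eqxx mulr1.
Qed.

Lemma points_mx_last (u : 'I_(d + 1) -> V) j : points_mx u j (rshift d 0) = 1.
Proof. by rewrite mxE row_mxEr mxE eqxx. Qed.

Lemma affM_points_mx m (G : 'M[R]_(d + 1, m)) (u : 'I_(d + 1) -> V) i j :
  (points_mx u *m G) i j = aff G (u i) j.
Proof. by rewrite /aff -row_points_mx -row_mul [RHS]mxE. Qed.

Section barycentric.
Variable u : 'I_(d + 1) -> V.
Hypothesis uu : points_mx u \in unitmx.

Lemma barycentric_unique (t : 'I_(d + 1) -> R) j : \sum_i t i = 1 ->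
  aff (invmx (points_mx u)) (\sum_i t i *: u i) j = t j.
Proof.
move=> t1; rewrite /aff; have := mul_points_mx u (\row_i t i).
under eq_bigr do rewrite mxE; under [X in row_mx _ X%:M]eq_bigr do rewrite mxE.
by rewrite t1 => <-; rewrite mulmxK// mxE.
Qed.

Lemma barycentric_sum x : \sum_j aff (invmx (points_mx u)) x j = 1.
Proof.
apply: sum_aff => [|j]; first by rewrite unitmx_inv.
by rewrite invmxK points_mx_last.
Qed.

Lemma barycentricE x : x = \sum_j aff (invmx (points_mx u)) x j *: u j.
Proof.
have := mul_points_mx u (row_mx x 1%:M *m invmx (points_mx u)).
by rewrite mulmxKV// => h; have [] := eq_row_mx h.
Qed.

Lemma orthant_points_conv :
  orthant (invmx (points_mx u)) `<=` conv_hull (range u).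
Proof.
move=> x Nx; rewrite (barycentricE x); apply/conv_hull_range.
exists (aff (invmx (points_mx u)) x); split => // [i|]; first exact/ltW/Nx.
exact: barycentric_sum.
Qed.

End barycentric.

(** If the functional vanished at x, a small step from x away from y would stay in K and make it
    negative. *)
Lemma aff_interior m (N : 'M[R]_(d + 1, m)) (K : set V) j x y :
  (forall z, K z -> 0 <= aff N z j) -> K y -> 0 < aff N y j -> K° x ->
  0 < aff N x j.
Proof.
move=> N0 Ky y0 Kx; rewrite lt0r N0 ?andbT; last exact: interior_subset.
apply/eqP => x0.
have : nbhs (x + 0 *: (y - x)) K by rewrite scale0r addr0.
move=> /nbhs_line[e e0 he]; have := he (- (e / 2)).
rewrite subr0 normrN gtr0_norm ?divr_gt0// ltr_pdivrMr// ltr_pMr// ltr1n => /(_ isT).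
move=> /N0; rewrite aff_segment x0 mulr0 add0r leNgt mulNr oppr_lt0.
by rewrite mulr_gt0// divr_gt0.
Qed.

End convex_hulls.

(** * Sorting permutations *)

Section sorting_permutations.
Context {R : realType}.

Lemma sorting_perm n (f : 'I_n -> R) :
  exists s : 'S_n, forall i j : 'I_n, (i < j)%N -> f (s j) <= f (s i).
Proof.
pose ge i j := f j <= f i; pose r := sort ge (enum 'I_n).
have szr : size r = n by rewrite size_sort size_enum_ord.
have ur : uniq r by rewrite sort_uniq enum_uniq.
have inj : injective (fun i : 'I_n => nth i r i).
  move=> i j; rewrite (set_nth_default i) ?szr// => /eqP.
  by rewrite nth_uniq ?szr// => /eqP/val_inj.
exists (perm inj) => i j ij; rewrite !permE (set_nth_default i j) ?szr//.
have sr : sorted ge r by apply: sort_sorted => k l; exact: le_total.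
have tr : transitive ge by move=> k l m lk km; exact: le_trans km lk.
by apply: (sorted_ltn_nth tr i sr) => //; rewrite inE szr.
Qed.

Lemma card_ord_ltn n (i : 'I_n) : #|[set l : 'I_n | (l < i)%N]%SET| = i.
Proof.
rewrite -sum1_card (eq_bigl (fun l : 'I_n => (l < i)%N)); last by move=> l; rewrite inE.
by rewrite (big_ord_narrow (ltnW (ltn_ord i))) sum_nat_const card_ord muln1.
Qed.

(** The position of a value is the number of greater values, which does not involve the
    permutation. *)
Lemma sorting_perm_unique n (f : 'I_n -> R) (s s' : 'S_n) :
  (forall i j : 'I_n, (i < j)%N -> f (s j) < f (s i)) ->
  (forall i j : 'I_n, (i < j)%N -> f (s' j) < f (s' i)) -> s = s'.
Proof.
have rank (r : 'S_n) i : (forall i j : 'I_n, (i < j)%N -> f (r j) < f (r i)) ->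
    #|[set k | f (r i) < f k]%SET| = i.
  move=> fr; rewrite -[RHS]card_ord_ltn -[RHS](card_imset _ (@perm_inj _ r)).
  apply: eq_card => k; rewrite [LHS]inE; apply/idP/imsetP => [fk|[l + ->]]; last first.
    by rewrite inE => /fr.
  exists ((r^-1)%g k); last by rewrite permKV.
  rewrite inE ltnNge; apply/negP; rewrite leq_eqVlt => /orP[/eqP/val_inj ik|/fr].
    by move: fk; rewrite ik permKV ltxx.
  by rewrite permKV => /lt_trans/(_ fk); rewrite ltxx.
move=> fs fs'; apply/permP => i; have := rank _ ((s'^-1)%g (s i)) fs'.
by rewrite permKV rank// => /val_inj {2}->; rewrite permKV.
Qed.

End sorting_permutations.

(** * The simplex *)

Section simplex_volume.
Context {R : realType} {d : nat}.
Local Notation V := 'rV[R]_d.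

Lemma affinely_independent_unit (u : 'I_(d + 1) -> V) :
  affinely_independent u -> points_mx u \in unitmx.
Proof.
move=> iu; rewrite -row_free_unit; apply: inj_row_free => t.
rewrite mul_points_mx -{1}row_mx0 => h; have [t0 s0] := eq_row_mx h.
apply/rowP => i; rewrite mxE; apply: (iu (fun i => t 0 i) _ t0).
by move: s0 => /matrixP/(_ 0 0); rewrite !mxE eqxx mulr1n.
Qed.

Variable Vol : volume_notion R d.

Lemma asvol_simplex (u : 'I_(d + 1) -> V) q : affinely_independent u ->
  (conv_hull (range u))° q ->
  asvol Vol (conv_hull (range u)) q =
  ((d + 1)`!%:R%:E * sector_growth Vol (invmx (points_mx u)))%E.
Proof.
move=> iu Kq; set K := conv_hull (range u) in Kq *.
have uu (s : 'S_(d + 1)) : points_mx (fun i => u (s i)) \in unitmx.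
  apply: affinely_independent_unit => t t1 tu i.
  rewrite -[i](permK s); apply: (iu (fun i => t ((s^-1)%g i))).
    by rewrite (reindex_perm s) -[RHS]t1; apply: eq_bigr => j _; rewrite permK.
  by rewrite (reindex_perm s) -[RHS]tu; apply: eq_bigr => j _; rewrite permK.
pose N (s : 'S_(d + 1)) := invmx (points_mx (fun i => u (s i))).
pose N1 := invmx (points_mx u); have u1 := affinely_independent_unit iu.
have NE s x j : aff (N s) x j = aff N1 x (s j).
  rewrite [in LHS](barycentricE u1 x) (reindex_perm s)/=.
  apply: (barycentric_unique (uu s) (t := fun i => aff N1 x (s i))).
  by rewrite -(barycentric_sum u1 x) [RHS](reindex_perm s).
have fN (W : 'M[R]_(d + 1)) : W \in unitmx ->
    (forall j, W j (rshift d 0) = 1) -> frame (invmx W).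
  by move=> uW W1; split=> [|j]; rewrite ?unitmx_inv// invmxK W1.
have lN s j : invmx (N s) j (rshift d 0) = 1 by rewrite invmxK points_mx_last.
have KP x : K x <-> forall j, 0 <= aff N1 x j.
  split=> [/conv_hull_range[t [t0 t1 ->]] j|x0].
    by rewrite barycentric_unique.
  rewrite (barycentricE u1 x); apply/conv_hull_range.
  by exists (aff N1 x); split => //; exact: barycentric_sum.
have Ku j : K (u j).
  apply/conv_hull_range; exists (fun i => (i == j)%:R); split => //.
  - by rewrite (bigD1 j)//= eqxx big1 ?addr0// => i /negbTE ->.
  - rewrite (bigD1 j)//= eqxx scale1r big1 ?addr0// => i /negbTE ->.
    by rewrite scale0r.
have Ko x : K° x -> forall j, 0 < aff N1 x j.
  move=> Kx j; apply: (aff_interior (fun z => (KP z).1 ^~ j) (Ku j)) Kx.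
  have -> : u j = \sum_i (i == j)%:R *: u i.
    rewrite (bigD1 j)//= eqxx scale1r big1 ?addr0// => i /negbTE ->.
    by rewrite scale0r.
  rewrite barycentric_unique ?eqxx//.
  by rewrite (bigD1 j)//= eqxx big1 ?addr0// => i /negbTE ->.
pose c : V := \sum_i ((d + 1)%:R^-1 : R) *: u i.
have d1 : (d + 1)%:R != 0 :> R by rewrite pnatr_eq0 addn1.
have d0 : 0 < (d + 1)%:R^-1 :> R by rewrite invr_gt0 ltr0n addn1.
have cE j : aff N1 c j = (d + 1)%:R^-1.
  apply: (barycentric_unique u1 (t := fun=> (d + 1)%:R^-1)).
  by rewrite sumr_const card_ord -[LHS]mulr_natr mulVf.
have NK s : orthant (N s) `<=` K.
  by move=> x Nx; apply/KP => j; have := Nx ((s^-1)%g j); rewrite NE permKV => /ltW.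
have Kc : K° c.
  apply: (interiorS (NK 1%g)); apply: open_nbhs_nbhs; split.
    exact: open_orthant.
  by move=> j; rewrite NE perm1 cE.
(* All factors lie in ]0, 1], so the product is at most each of them. *)
pose b := \prod_j aff N1 q j.
have q1 j : 0 <= aff N1 q j <= 1.
  have q0 := Ko _ Kq; rewrite ltW//= -(barycentric_sum u1 q) (bigD1 j)//= lerDl.
  by rewrite sumr_ge0// => i _; rewrite ltW.
have b0 : 0 < b by apply: prodr_gt0 => j _; exact: Ko.
have b1 : b <= 1 by apply: prodr_ile1 => j _; exact: q1.
have bq j : b <= aff N1 q j.
  rewrite /b (bigD1 j)//= ler_piMr//; first by case/andP: (q1 j).
  by apply: prodr_ile1 => i _; exact: q1.
rewrite -card_Sn.
(* The interior of the simplex is the orthant of each of its frames, so every ordering gives a frame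
   that is both an inner and an outer one. *)
apply: (@asvol_sectors _ _ Vol K q c _ N N b) => //.
- by move=> x y t; exact: conv_hull_convex.
- exact: conv_hull_bounded.
- by rewrite b0.
- by move=> s; rewrite unitmx_inv.
- move=> x Kx; have [s hs] := sorting_perm (aff N1 x).
  have x0 := Ko _ Kx; exists s; split.
  + by move=> j; rewrite NE.
  + move=> j k jk; rewrite !NE; apply: le_trans (hs _ _ jk).
    by rewrite ler_piMl// ltW.
  (* In decreasing order, the last coordinate bounds all the others from below. *)
  + exists (col (s (rshift d 0)) N1); split => [y Ky||j].
    * by rewrite aff_col; exact: Ko.
    * by rewrite aff_col.
    * rewrite aff_col NE; apply: (@le_trans _ _ (aff N1 x (s (rshift d 0)))).
        by rewrite ler_piMl// ltW.
      have [->//|jd] := eqVneq j (rshift d 0); apply: hs.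
      have := ltn_ord j; rewrite [X in (_ < X)%N]addn1 ltnS leq_eqVlt.
      rewrite /= addn0 => /orP[/eqP jd'|//]; case/eqP: jd.
      by apply/val_inj; rewrite /= addn0.
- by move=> s; apply: fN => // j; rewrite points_mx_last.
- by move=> s x Kx j; rewrite NE; exact: Ko.
- move=> s T x [Nx [_ xT]]; exists (expR (- T)).
    by rewrite ler_piMl// expR_ge0.
  move=> y /KP y0; apply/KP => j; rewrite affD cE.
  (* Adding exp(-T) (y - c) lowers coordinate j by at most exp(-T) / (d+1). Summing the sector
     inequalities over i, with coordinates of sum 1, shows that x can afford it. *)
  have xj : expR (- T) <= (d + 1)%:R * aff N1 x j.
    have -> : expR (- T) = \sum_i expR (- T) * aff N1 x i.
      by rewrite -mulr_sumr barycentric_sum// mulr1.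
    rewrite mulr_natl.
    rewrite -[X in _ *+ X]card_ord -sumr_const; apply: ler_sum => i _.
    have := xT ((s^-1)%g i) ((s^-1)%g j); rewrite !NE !permKV; exact: ltW.
  have : 0 <= expR (- T) * aff N1 y j by rewrite mulr_ge0 ?expR_ge0.
  suff : expR (- T) / (d + 1)%:R <= aff N1 x j by rewrite mulrBr; lra.
  rewrite ler_pdivrMr; last by rewrite ltr0n addn1.
  by rewrite [leRHS]mulrC; exact: xj.
- move=> s s' T x [_ [xs _]] [_ [xs' _]].
  apply: (sorting_perm_unique (f := aff N1 x)) => i j ij.
    by have := xs _ _ ij; rewrite !NE.
  by have := xs' _ _ ij; rewrite !NE.
by apply: fN => // j; rewrite points_mx_last.
Qed.

End simplex_volume.

(** * Faces of a polytope *)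

Section polytope_faces.
Context {R : realType} {d : nat}.
Local Notation V := 'rV[R]_d.

Lemma faceP (P F : set V) : face P F <-> exists g : 'cV[R]_(d + 1),
  (forall x, P x -> 0 <= aff g x 0) /\ F = P `&` [set x | aff g x 0 = 0].
Proof.
split=> [[c [e [ce ->]]]|[g [g0 ->]]].
  have gE x : aff (col_mx (- c^T) e%:M : 'cV[R]_(d + 1)) x 0 = e - dotp c x.
    rewrite affE col_mxEd mxE eqxx mulr1n addrC dotpE -sumrN; congr (_ + _).
    by apply: eq_bigr => k _; rewrite col_mxEu !mxE mulrN mulrC.
  exists (col_mx (- c^T) e%:M); split=> [x /ce|]; first by rewrite gE subr_ge0.
  by congr (_ `&` _); apply/seteqP; split=> x /=; rewrite gE => /eqP;
    rewrite ?subr_eq0 => /eqP h; apply/eqP; rewrite ?subr_eq0 h.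
pose c : V := \row_k - g (lshift 1 k) 0.
have gE x : aff g x 0 = g (rshift d 0) 0 - dotp c x.
  rewrite affE dotpE addrC -sumrN; congr (_ + _).
  by apply: eq_bigr => k _; rewrite mxE mulNr opprK mulrC.
exists c, (g (rshift d 0) 0); split=> [x /g0|]; first by rewrite gE subr_ge0.
by congr (_ `&` _); apply/seteqP; split=> x /=; rewrite gE => /eqP;
  rewrite ?subr_eq0 => /eqP h; apply/eqP; rewrite ?subr_eq0 h.
Qed.

Variables (n : nat) (a : 'I_n -> V).
Let P := conv_hull (range a).

(** The generators [a] may repeat or fail to be extreme points; a face is recorded by all the
    generators it contains. *)
Definition verts (F : set V) : {set 'I_n} := [set i | `[< F (a i) >]]%SET.

Lemma in_verts F i : (i \in verts F) = `[< F (a i) >].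
Proof. by rewrite inE. Qed.

Lemma vertP F i : reflect (F (a i)) (i \in verts F).
Proof. by rewrite in_verts; exact: asboolP. Qed.

Lemma hull_vert i : P (a i).
Proof.
apply/conv_hull_range; exists (fun j => (j == i)%:R); split => //.
- by rewrite (bigD1 i)//= eqxx big1 ?addr0// => j /negbTE ->.
- rewrite (bigD1 i)//= eqxx scale1r big1 ?addr0// => j /negbTE ->.
  by rewrite scale0r.
Qed.

Lemma face_sub F : face P F -> F `<=` P.
Proof. by move=> [c [e [_ ->]]] x []. Qed.

Lemma aff_hull_ge0 (g : 'cV[R]_(d + 1)) x : (forall i, 0 <= aff g (a i) 0) ->
  P x -> 0 <= aff g x 0.
Proof.
move=> g0 /conv_hull_range[t [t0 t1 ->]]; rewrite aff_sum// sumr_ge0// => i _.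
by rewrite mulr_ge0.
Qed.

Lemma faceI F (g : 'cV[R]_(d + 1)) : face P F -> (forall i, i \in verts F -> 0 <= aff g (a i) 0) ->
  face P (F `&` [set x | aff g x 0 = 0]).
Proof.
move=> /faceP[l [l0 FE]] g0.
(* on the vertices outside F, a large multiple of l dominates g *)
pose m := 1 + \sum_i `|aff g (a i) 0| / `|aff l (a i) 0|.
have m0 : 0 <= m by rewrite addr_ge0// sumr_ge0// => i _; rewrite divr_ge0.
have affDm x : aff (g + m *: l) x 0 = aff g x 0 + m * aff l x 0.
  by rewrite /aff mulmxDr -scalemxAr !mxE.
apply/faceP; exists (g + m *: l).
have gm_gt0 i : i \notin verts F -> 0 < aff (g + m *: l) (a i) 0.
  move=> iF; rewrite affDm; have li : 0 < aff l (a i) 0.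
    rewrite lt0r l0 ?andbT; last exact: hull_vert.
    apply: contra iF => /eqP li; apply/vertP; rewrite FE; split => //.
    exact: hull_vert.
  have : `|aff g (a i) 0| <= (m - 1) * aff l (a i) 0.
    rewrite -ler_pdivrMr// -{1}(gtr0_norm li) /m addrC addrA addNr add0r.
    by rewrite (bigD1 i)//= lerDl; apply: sumr_ge0 => j _; rewrite divr_ge0.
  by rewrite ler_norml mulrBl mul1r => /andP[+ _]; lra.
have gm0 i : 0 <= aff (g + m *: l) (a i) 0.
  have [iF|/gm_gt0/ltW//] := boolP (i \in verts F).
  by rewrite affDm addr_ge0 ?g0// mulr_ge0// l0//; exact: hull_vert.
have F0 x : F x -> 0 <= aff g x 0.
  rewrite FE => -[Px lx]; have := aff_hull_ge0 gm0 Px.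
  by rewrite affDm lx mulr0 addr0.
split=> [x|]; first exact: aff_hull_ge0.
apply/seteqP; split=> x.
  by rewrite {1}FE => -[[Px lx] gx]; split => //=; rewrite affDm lx gx mulr0 addr0.
move=> [Px] /= gx; suff lx : aff l x 0 = 0.
  by rewrite FE; split => //=; move: gx; rewrite affDm lx mulr0 addr0.
move: Px gx => /[dup] Px /conv_hull_range[t [t0 t1 xE]] gx.
have tg i : t i * aff (g + m *: l) (a i) 0 = 0.
  move: gx; rewrite xE aff_sum// => /psumr_eq0P -> // j _.
  by rewrite mulr_ge0.
rewrite xE aff_sum// big1// => i _; apply/eqP.
rewrite mulf_eq0; have /eqP := tg i; rewrite mulf_eq0 => /orP[->//|/eqP gi].
have /vertP : i \in verts F by apply: contraT => /gm_gt0; rewrite gi ltxx.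
by rewrite FE => -[_ /= ->]; rewrite eqxx orbT.
Qed.

(** Rows outside S are zeroed so that the format does not depend on S. The row space is the linear
    span of the affine hull in homogeneous coordinates; its rank is the affine dimension plus one,
    and 0 for the empty face. *)
Definition hull_mx (S : {set 'I_n}) : 'M[R]_(n, d + 1) :=
  \matrix_(i, j) (if i \in S then (row_mx (a i) 1%:M : 'rV_(d + 1)) 0 j else 0).

Lemma row_hull_mx S i :
  row i (hull_mx S) = if i \in S then row_mx (a i) 1%:M else 0.
Proof. by apply/rowP => j; rewrite !mxE; case: ifP => // _; rewrite !mxE. Qed.

Lemma hull_mx_mul0 S (g : 'cV[R]_(d + 1)) :
  hull_mx S *m g = 0 <-> forall i, i \in S -> aff g (a i) 0 = 0.
Proof.
split=> [h i iS|h].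
  move: h => /(congr1 (row i)); rewrite row_mul row_hull_mx iS row0.
  by move=> /rowP/(_ 0); rewrite [X in _ = X]mxE.
apply/row_matrixP => i; rewrite row_mul row_hull_mx row0; case: ifPn => [iS|_].
  by apply/rowP => j; rewrite ord1 [RHS]mxE; exact: h.
by rewrite mul0mx.
Qed.

Lemma submx_aff0 S (g : 'cV[R]_(d + 1)) x :
  (row_mx x 1%:M <= hull_mx S)%MS ->
  (forall i, i \in S -> aff g (a i) 0 = 0) -> aff g x 0 = 0.
Proof.
move=> /submxP[D DE] /hull_mx_mul0 h.
by rewrite /aff DE -mulmxA h mulmx0 [LHS]mxE.
Qed.

Lemma hull_mxS (S S' : {set 'I_n}) : S \subset S' -> (hull_mx S <= hull_mx S')%MS.
Proof.
move=> /fintype.subsetP SS'; apply/row_subP => i; rewrite row_hull_mx.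
case: ifPn => [iS|_]; last exact: sub0mx.
by have := row_sub i (hull_mx S'); rewrite row_hull_mx SS'.
Qed.

(** A functional nonnegative on P that vanishes at a convex combination vanishes at every generator
    of nonzero weight. *)
Lemma face_convP F x : face P F -> F x <-> exists t : 'I_n -> R,
  [/\ forall i, 0 <= t i, \sum_i t i = 1, x = \sum_i t i *: a i &
  forall i, i \notin verts F -> t i = 0].
Proof.
move=> /faceP[g [g0 FE]]; split=> [|[t [t0 t1 -> tF]]].
  rewrite {1}FE => -[/conv_hull_range[t [t0 t1 xE]] /= gx].
  exists t; split => // i iF; apply/eqP.
  move: gx; rewrite xE aff_sum// => /psumr_eq0P => /(_ _ i isT)/eqP.
  rewrite mulf_eq0 => /(_ _)/orP[j _| //|/eqP gi].
    by rewrite mulr_ge0// g0//; exact: hull_vert.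
  by case/vertP: iF; rewrite FE; split => //; exact: hull_vert.
rewrite FE; split; first by apply/conv_hull_range; exists t.
rewrite /= aff_sum// big1// => i _; have [/vertP|/tF ->] := boolP (i \in verts F).
  by rewrite FE => -[_ /= ->]; rewrite mulr0.
by rewrite mul0r.
Qed.

Lemma face_submx F x : face P F -> F x -> (row_mx x 1%:M <= hull_mx (verts F))%MS.
Proof.
move=> fF /(face_convP _ fF)[t [t0 t1 -> tF]].
rewrite (_ : row_mx _ _ = \sum_i t i *: row i (hull_mx (verts F))).
  by apply: summx_sub => i _; rewrite scalemx_sub// row_sub.
have rowE i : t i *: row i (hull_mx (verts F)) = t i *: row_mx (a i) 1%:M.
  by rewrite row_hull_mx; case: ifPn => // /tF ->; rewrite !scale0r.
under [RHS]eq_bigr do rewrite rowE scale_row_mx.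
apply/rowP => j; rewrite summxE; case: (@split_ordP d 1 j) => k ->.
  rewrite row_mxEl summxE; apply: eq_bigr => i _.
  by rewrite row_mxEl mxE.
rewrite row_mxEr ord1 mxE eqxx mulr1n -{1}t1; apply: eq_bigr => i _.
by rewrite row_mxEr !mxE eqxx mulr1.
Qed.

Definition face_rank F := \rank (hull_mx (verts F)).

Lemma verts_sub F G : F `<=` G -> verts F \subset verts G.
Proof. by move=> FG; apply/fintype.subsetP => i /vertP/FG/vertP. Qed.

Lemma face_rank_sub F G : F `<=` G -> (face_rank F <= face_rank G)%N.
Proof. by move=> FG; apply/mxrankS/hull_mxS/verts_sub. Qed.

(** Equal ranks make the two spans equal, so the functional that cuts out F vanishes on G. *)
Lemma face_rank_inj F G : face P F -> face P G -> F `<=` G ->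
  (face_rank G <= face_rank F)%N -> F = G.
Proof.
move=> fF fG FG rGF; apply/seteqP; split=> // x Gx.
have Px : P x by exact: face_sub Gx.
have /faceP[g [g0 FE]] := fF; rewrite FE; split => //=.
apply: (@submx_aff0 (verts F)) => [|i /vertP]; last by rewrite FE => -[].
apply: submx_trans (face_submx fG Gx) _.
by have [_ <-] := mxrank_leqif_sup (hull_mxS (verts_sub FG));
  rewrite eqn_leq rGF face_rank_sub.
Qed.

Lemma affine_hull_submx F x : face P F ->
  affine_hull F x <-> (row_mx x 1%:M <= hull_mx (verts F))%MS.
Proof.
move=> fF; split=> [[m [t [y [Fy t1 ->]]]]|].
  rewrite (_ : row_mx _ _ = \sum_i t i *: row_mx (y i) 1%:M); last first.
    apply/rowP => j; rewrite summxE; case: (@split_ordP d 1 j) => k ->.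
      rewrite row_mxEl summxE; apply: eq_bigr => i _.
      by rewrite mxE [RHS]mxE row_mxEl.
    rewrite row_mxEr ord1 mxE eqxx mulr1n -{1}t1; apply: eq_bigr => i _.
    by rewrite mxE row_mxEr mxE eqxx mulr1.
  by apply: summx_sub => i _; rewrite scalemx_sub// face_submx.
move=> /submxP[D]; rewrite mulmx_sum_row => DE.
have [i0 i0F] : exists i, i \in verts F.
  apply: contrapT => /forallNP nF; have := congr1 (fun A : 'rV_(d + 1) => A 0 (rshift d 0)) DE.
  rewrite row_mxEr mxE eqxx big1 => [|i _].
    by rewrite mxE => /eqP; rewrite oner_eq0.
  by rewrite row_hull_mx; case: ifPn => [/nF//|_]; rewrite scaler0.
exists n, (fun i => if i \in verts F then D 0 i else 0),
  (fun i => if i \in verts F then a i else a i0).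
have rowE i : D 0 i *: row i (hull_mx (verts F)) =
    (if i \in verts F then D 0 i else 0) *: row_mx (a i) 1%:M.
  by rewrite row_hull_mx; case: ifPn => // _; rewrite scaler0 scale0r.
split.
- by move=> i; case: ifPn => [/vertP//|_]; exact/vertP.
- have := congr1 (fun A : 'rV_(d + 1) => A 0 (rshift d 0)) DE.
  rewrite row_mxEr mxE eqxx mulr1n summxE => ->; apply: eq_bigr => i _.
  by rewrite rowE mxE row_mxEr mxE eqxx mulr1.
- apply/rowP => j.
  have := congr1 (fun A : 'rV_(d + 1) => A 0 (lshift 1 j)) DE.
  rewrite row_mxEl !summxE => ->; apply: eq_bigr => i _.
  rewrite rowE mxE row_mxEl [RHS]mxE; case: ifPn => //.
  by rewrite !mul0r.
Qed.

Lemma row_mx1B (x y : V) :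
  row_mx (x - y) 0 = row_mx x 1%:M - row_mx y 1%:M :> 'rV[R]_(d + 1).
Proof. by rewrite opp_row_mx add_row_mx subrr. Qed.

(** The span is the sum of the line of (x0 : 1) and of the directions (u : 0) with u in U; the last
    coordinate shows that the sum is direct, whence the successor. *)
Lemma face_rank_affine_hull F x0 (U : {vspace V}) : face P F ->
  affine_hull F = [set x | x - x0 \in U] -> face_rank F = (\dim U).+1.
Proof.
move=> fF FU; pose H := hull_mx (verts F).
have hull x : (row_mx x 1%:M <= H)%MS <-> x - x0 \in U.
  rewrite -(affine_hull_submx x fF) FU; exact: iff_refl.
pose B : 'M[R]_(\dim U, d) := \matrix_i (vbasis U)`_i.
have memB u : u \in U = (u <= B)%MS.
  apply/idP/idP => [uU|/submxP[D ->]].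
    rewrite (coord_vbasis uU) summx_sub// => i _; rewrite scalemx_sub//.
    by have := row_sub i B; rewrite rowK.
  rewrite mulmx_sum_row memv_suml// => i _; rewrite memvZ// rowK.
  by rewrite vbasis_mem// mem_nth// size_tuple.
have fB : row_free B.
  apply: inj_row_free => D; rewrite mulmx_sum_row => DB.
  have /freeP fr := basis_free (vbasisP U).
  apply/rowP => i; rewrite [RHS]mxE; apply: (fr (fun i => D 0 i)).
  by rewrite -[RHS]DB; apply: eq_bigr => j _; rewrite rowK.
pose J : 'M[R]_(d, d + 1) := row_mx 1%:M 0; pose E := B *m J.
have EJ m (C : 'M[R]_(m, d)) : C *m J = row_mx C 0.
  by rewrite /J mul_mx_row mulmx1 mulmx0.
have fJ : row_free J.
  by apply: inj_row_free => D; rewrite EJ -row_mx0 => h; have [] := eq_row_mx h.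
have subE u : (row_mx u 0 <= E)%MS = (u \in U).
  by rewrite memB /E -EJ submxMfree.
have HE : (H :=: row_mx x0 1%:M + E)%MS.
  apply/eqmxP/andP; split.
    apply/row_subP => i; rewrite row_hull_mx; case: ifPn => [iF|_]; last exact: sub0mx.
    rewrite -[row_mx _ _](subrK (row_mx x0 1%:M)) addrC -row_mx1B.
    apply: addmx_sub_adds => //; rewrite subE; apply/hull.
    by have := row_sub i H; rewrite row_hull_mx iF.
  rewrite addsmx_sub; apply/andP; split; first by apply/hull; rewrite subrr mem0v.
  apply/row_subP => i; rewrite /E row_mul EJ rowK -[_`_i](addKr x0) addrC row_mx1B.
  apply: addmx_sub; last by rewrite eqmx_opp; apply/hull; rewrite subrr mem0v.
  apply/hull; rewrite addrC addKr vbasis_mem// mem_nth// size_tuple//.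
rewrite /face_rank -/H HE; have := mxrank_sum_cap (row_mx x0 1%:M) E.
rewrite (_ : (_ :&: _)%MS = 0) ?mxrank0 ?addn0; last first.
  apply/eqP; rewrite -submx0; apply/row_subP => i.
  set w := row i _; have : (w <= row_mx x0 1%:M :&: E)%MS by exact: row_sub.
  rewrite sub_capmx => /andP[/sub_rVP[c wc] /submxP[D wD]].
  suff c0 : c = 0 by rewrite wc c0 scale0r sub0mx.
  have : w 0 (rshift d 0) = c by rewrite wc mxE row_mxEr mxE eqxx mulr1.
  by rewrite wD /E mulmxA EJ row_mxEr mxE => <-.
move=> ->; rewrite /E mxrankMfree// (eqP fB) rank_rV; case: eqVneq => // h.
have := congr1 (fun A : 'rV_(d + 1) => A 0 (rshift d 0)) h.
by rewrite row_mxEr !mxE eqxx => /eqP; rewrite oner_eq0.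
Qed.

Lemma set_dimP F k : face P F -> set_dim F k <-> face_rank F = k.+1.
Proof.
move=> fF; split=> [[x0 [U [<- FU]]]|rF]; first exact: face_rank_affine_hull FU.
have [i0 i0F] : exists i, i \in verts F.
  apply: contrapT => /forallNP nF; suff : face_rank F = 0%N by rewrite rF.
  rewrite /face_rank (_ : hull_mx _ = 0) ?mxrank0//; apply/row_matrixP => i.
  by rewrite row_hull_mx row0; case: ifPn => // /nF.
pose x0 := a i0; pose b i := if i \in verts F then a i - x0 else 0.
pose U := <<[tuple b i | i < n]>>%VS.
have bU i : b i \in U by apply/memv_span/mapP; exists i => //; rewrite mem_enum.
have FU : affine_hull F = [set x | x - x0 \in U].
  apply/seteqP; split=> x.
    move=> [m [t [y [Fy t1 ->]]]] /=.
    have -> : \sum_i t i *: y i - x0 = \sum_i t i *: (y i - x0).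
      under [RHS]eq_bigr do rewrite scalerBr.
      by rewrite sumrB -scaler_suml t1 scale1r.
    apply: memv_suml => i _; apply: memvZ.
    have /(face_convP _ fF)[r [r0 r1 -> rF0]] := Fy i.
    have -> : \sum_j r j *: a j - x0 = \sum_j r j *: b j.
      rewrite -[x0]scale1r -{1}r1 scaler_suml -sumrB; apply: eq_bigr => j _.
      by rewrite -scalerBr /b; case: ifPn => // /rF0 ->; rewrite !scale0r.
    by apply: memv_suml => j _; exact: memvZ.
  move=> /= /coord_span xE; apply/(affine_hull_submx x fF).
  rewrite -[row_mx _ _](subrK (row_mx x0 1%:M)) -row_mx1B xE.
  apply: addmx_sub; last by apply: face_submx => //; exact/vertP.
  rewrite (_ : row_mx _ _ = \sum_i coord [tuple b i | i < n] i (x - x0) *: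
    row_mx (b i) 0); last first.
    apply/rowP => j; rewrite summxE; case: (@split_ordP d 1 j) => k' ->.
      rewrite row_mxEl summxE; apply: eq_bigr => i _.
      by rewrite nth_mktuple mxE [RHS]mxE row_mxEl.
    by rewrite row_mxEr mxE big1// => i _; rewrite mxE row_mxEr mxE mulr0.
  apply: summx_sub => i _; apply: scalemx_sub; rewrite /b; case: ifPn => [iF|_].
    rewrite row_mx1B; apply: addmx_sub; last rewrite eqmx_opp;
      by apply: face_submx => //; exact/vertP.
  by rewrite row_mx0 sub0mx.
exists x0, U; split => //; apply/succn_inj.
by rewrite -(face_rank_affine_hull fF FU).
Qed.

End polytope_faces.

(** * Facets, relative interiors and barycentric subdivision *)

Section polytope_boundary.
Context {R : realType} {d n : nat}.
Local Notation V := 'rV[R]_d.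
Variable a : 'I_n -> V.
Let P := conv_hull (range a).
Local Notation verts := (verts a).
Local Notation hull F := (hull_mx a (verts F)).
Local Notation rank := (face_rank a).
Let vertP := vertP a.

(* Rotate the supporting hyperplane of G around G until it meets another vertex
   of F. *)
Lemma face_enlarge F G : face P F -> face P G -> G `<=` F ->
  ((rank G).+1 < rank F)%N ->
  exists G', [/\ face P G', G `<=` G', G' `<=` F & (rank G < rank G' < rank F)%N].
Proof.
move=> fF fG GF rGF; have /faceP[g [g0 GE]] := fG.
(* A rank gap of at least 2 leaves, in the span of F, a vector [w] killed by g but outside the span
   of G. It will certify that the enlarged face is not F. *)
have [w [wF wg wG]] : exists w : 'rV[R]_(d + 1),
    [/\ (w <= hull F)%MS, w *m g = 0 & ~~ (w <= hull G)%MS].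
  have : ~~ (hull F :&: kermx g <= hull G)%MS.
    apply: contraL rGF => /mxrankS KG; rewrite -leqNgt /face_rank.
    rewrite -(mxrank_mul_ker (hull F) g) -[X in (_ <= X)%N]add1n.
    by apply: leq_add => //; exact: rank_leq_col.
  move=> /row_subPn[i iG]; exists (row i (hull F :&: kermx g)%MS).
  have := row_sub i (hull F :&: kermx g)%MS; rewrite sub_capmx => /andP[iF /sub_kermxP ig].
  by split.
have [h [hG wh [i0 i0F hi0]]] : exists h : 'cV[R]_(d + 1),
    [/\ hull G *m h = 0, w *m h != 0 &
        exists2 i, i \in verts F & aff h (a i) 0 < 0].
  have [j jw] : exists j, w *m col j (cokermx (hull G)) != 0.
    apply: contrapT => /forallNP h; case/negP: wG; rewrite submxE.
    apply/eqP/rowP => j; rewrite [RHS]mxE; apply/eqP/contraT => wj.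
    case: (h j); apply: contra wj => /eqP/colP/(_ 0).
    by rewrite colE mulmxA -colE !mxE => ->.
  pose k := col j (cokermx (hull G)).
  have kG : hull G *m k = 0.
    by rewrite /k colE mulmxA mulmx_coker mul0mx.
  have [i iF ki] : exists2 i, i \in verts F & aff k (a i) 0 != 0.
    apply: contrapT => nk; case/negP: jw; rewrite -/k.
    have /submxP[D ->] := wF; rewrite -mulmxA (_ : hull F *m k = 0) ?mulmx0//.
    apply/hull_mx_mul0 => i iF; apply/eqP/contraT => ki.
    by case: nk; exists i.
  have [ki0|ki0] := ltP (aff k (a i) 0) 0; first by exists k; split => //; exists i.
  have kN x : aff (- k) x 0 = - aff k x 0 by rewrite /aff mulmxN mxE.
  exists (- k); split; rewrite ?mulmxN ?kG ?oppr0 ?oppr_eq0//.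
  by exists i => //; rewrite kN oppr_lt0 lt0r ki.
have hG0 i : i \in verts G -> aff h (a i) 0 = 0 by move/hull_mx_mul0: hG; apply.
(* [g + q i *: h] vanishes at generator i; the least value over the generators of F with h < 0 stops
   the rotation at the first one met, keeping the functional nonnegative on F. *)
pose q i := aff g (a i) 0 / - aff h (a i) 0.
have [i1] : exists i1, (i1 \in verts F) && (aff h (a i1) 0 < 0) /\
    forall i, (i \in verts F) && (aff h (a i) 0 < 0) -> q i1 <= q i.
  have i0P : (i0 \in verts F) && (aff h (a i0) 0 < 0) by rewrite i0F.
  case: (@Order.TotalTheory.arg_minP _ R _ i0
    (fun i => (i \in verts F) && (aff h (a i) 0 < 0)) q i0P) => i iP qi.
  by exists i.
move=> [/andP[i1F hi1] qi1].
have g0P i : 0 <= aff g (a i) 0 by apply: g0; exact: hull_vert.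
have i1G : i1 \notin verts G.
  by apply: contraL hi1 => /hG0 ->; rewrite ltxx.
have gi1 : 0 < aff g (a i1) 0.
  rewrite lt0r g0P andbT; apply: contra i1G => /eqP gi1; apply/vertP.
  by rewrite GE; split => //; exact: hull_vert.
have t0 : 0 < q i1 by rewrite divr_gt0// oppr_gt0.
pose g' := g + q i1 *: h.
have g'E x : aff g' x 0 = aff g x 0 + q i1 * aff h x 0.
  by rewrite /aff mulmxDr -scalemxAr !mxE.
pose G' := F `&` [set x | aff g' x 0 = 0].
have fG' : face P G'.
  apply: faceI => // i iF; rewrite g'E.
  have [hi|hi] := leP 0 (aff h (a i) 0).
    by rewrite addr_ge0// mulr_ge0// ltW.
  have := qi1 i; rewrite iF hi => /(_ isT); rewrite ler_pdivlMr ?oppr_gt0//.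
  by rewrite mulrN; lra.
have GG' : G `<=` G'.
  move=> x Gx; split; first exact: GF.
  rewrite /= g'E (submx_aff0 (face_submx fG Gx) hG0) mulr0 addr0.
  by move: Gx; rewrite GE => -[].
have i1G' : G' (a i1).
  split; first exact/vertP.
  rewrite /= g'E /q invrN mulrN mulNr divfK ?subrr//.
  by rewrite lt_eqF.
exists G'; split => //; first by move=> x [].
apply/andP; split; rewrite ltnNge; apply/negP => r.
  by case/negP: i1G; apply/vertP; rewrite (face_rank_inj fG fG' GG' r).
have G'F : G' = F by apply: face_rank_inj r => // x [].
(* If [G' = F], then [g'] kills the span of F, hence [w], whereas [w *m g = 0] and [w *m h != 0]. *)
case/negP: wh; have /submxP[D DE] := wF.
have : w *m g' = 0.
  rewrite DE -mulmxA (_ : hull F *m g' = 0) ?mulmx0//.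
  by apply/hull_mx_mul0 => i /vertP; rewrite -G'F => -[].
rewrite /g' mulmxDr wg add0r -scalemxAr => /eqP; rewrite scaler_eq0.
by rewrite gt_eqF.
Qed.

Lemma facet_above F G : face P F -> face P G -> G `<=` F -> (rank G < rank F)%N ->
  exists G', [/\ face P G', G `<=` G', G' `<=` F & (rank G').+1 = rank F].
Proof.
move=> fF; have [k] := ubnP (rank F - rank G)%N; elim: k G => // k ih G.
rewrite ltnS => rk fG GF rGF; have [rE|rN] := eqVneq (rank G).+1 (rank F).
  by exists G; split => //; exact: subset_refl.
have [|G1 [fG1 GG1 G1F /andP[r1 r2]]] := face_enlarge fF fG GF.
  by rewrite ltn_neqAle rN.
have [||//|G' [fG' G1G' G'F rG']] := ih G1 _ fG1 => //.
  by apply: leq_trans rk; rewrite ltn_sub2l.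
by exists G'; split => // x /GG1 /G1G'.
Qed.

Lemma continuous_rV (T : topologicalType) m (f : T -> 'rV[R]_m) :
  (forall j, continuous (fun x => f x 0 j)) -> continuous f.
Proof.
move=> cf x A /nbhs_ballP[e /= e0 eA].
have : \forall y \near x, forall j, ball (f x 0 j) e (f y 0 j).
  apply: (@filter_forall _ _ (fun j => [set y | ball (f x 0 j) e (f y 0 j)])
    (nbhs x) _).
  by move=> j; apply: (cf j x); exact: nbhsx_ballx.
by apply: filterS => y xy; apply: eA; split => // i j; rewrite ord1; exact: xy.
Qed.

Lemma conv_hull_compact : compact P.
Proof.
pose D := [set t : 'rV[R]_n | (forall i, 0 <= t 0 i) /\ \sum_i t 0 i = 1].
pose f (t : 'rV[R]_n) : V := \sum_i t 0 i *: a i.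
have -> : P = f @` D.
  apply/seteqP; split=> [x /conv_hull_range[t [t0 t1 ->]]|_ [t [t0 t1] <-]].
    exists (\row_i t i); first by split=> [i|]; [rewrite mxE|under eq_bigr do rewrite mxE].
    by rewrite /f; under eq_bigr do rewrite mxE.
  by apply/conv_hull_range; exists (t 0).
have csum (F : 'I_n -> R) : continuous (fun t : 'rV[R]_n => \sum_i t 0 i * F i).
  apply: (@continuous_big R _ +%R) => [|k _]; first exact: add_continuous.
  move=> y; apply: (@continuousM R 'rV[R]_n (fun x => x 0 k)).
    exact: coord_continuous.
  exact: cst_continuous.
apply: continuous_compact.
  apply: continuous_subspaceT; apply: continuous_rV => j.
  rewrite (_ : (fun _ => _) = (fun t : 'rV[R]_n => \sum_i t 0 i * a i 0 j)) //.
  by apply/funext => t; rewrite /f summxE; apply: eq_bigr => i _; rewrite mxE.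
apply: bounded_closed_compact.
  exists 1; split=> // M M1 t [t0 t1] /=.
  rewrite [leLHS]mx_normrE; apply/bigmax_leP; split=> [|[i j] _ /=].
    exact: le_trans ler01 (ltW M1).
  rewrite ord1 ger0_norm ?t0//; apply: le_trans (ltW M1).
  by rewrite -t1 (bigD1 j)//= lerDl sumr_ge0.
rewrite (_ : D = (\bigcap_i [set t : 'rV[R]_n | 0 <= t 0 i]) `&`
    [set t | \sum_i t 0 i = 1]); last first.
  by apply/seteqP; split=> t [t0 t1]; split => // i; [move=> _|]; exact: t0.
apply: closedI.
  apply: closed_bigI => i _.
  change (closed ((fun t : 'rV[R]_n => t 0 i) @^-1` [set r : R | 0 <= r])).
  by apply: closed_comp => [t _|]; [exact: coord_continuous|exact: closed_ge].
have E t : \sum_i t 0 i * 1 = \sum_i t 0 i :> R.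
  by apply: eq_bigr => i _; rewrite mulr1.
have : closed ((fun t : 'rV[R]_n => \sum_i t 0 i * 1) @^-1` [set r : R | r = 1]).
  by apply: closed_comp => [t _|]; [exact: csum|exact: closed_eq].
by congr (closed _); apply/seteqP; split=> t /=; rewrite E.
Qed.

Lemma face_compact F : face P F -> compact F.
Proof.
move=> /faceP[g [_ ->]]; apply: compact_closedI; first exact: conv_hull_compact.
change (closed ((fun x => aff g x 0) @^-1` [set r : R | r = 0])).
by apply: closed_comp => [x _|]; [exact: continuous_aff|exact: closed_eq].
Qed.

Lemma rV_hausdorff m : hausdorff_space 'rV[R]_m.
Proof. exact: norm_hausdorff. Qed.

Lemma face_closed F : face P F -> closed F.
Proof. by move=> /face_compact; apply: compact_closed; exact: rV_hausdorff. Qed.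

Lemma face_verts_inj F G : face P F -> face P G -> verts F = verts G -> F = G.
Proof.
move=> fF fG FG; apply/seteqP; split=> x.
  by move=> /(face_convP x fF) h; apply/(face_convP x fG); rewrite -FG.
by move=> /(face_convP x fG) h; apply/(face_convP x fF); rewrite FG.
Qed.

Lemma face_convex F x y t : face P F -> F x -> F y -> 0 <= t <= 1 ->
  F (x + t *: (y - x)).
Proof.
move=> /faceP[g [g0 ->]] [Px gx] [Py gy] /andP[t0 t1]; split.
  rewrite (_ : _ + _ = t *: y + (1 - t) *: x); last first.
    by apply/rowP => j; rewrite !mxE; ring.
  by apply: conv_hull_convex => //; rewrite t0.
by rewrite /= aff_segment gx gy !mulr0 addr0.
Qed.

Lemma dotp_ge0 (u : V) : 0 <= dotp u u.
Proof. by rewrite dotpE sumr_ge0// => j _; rewrite -expr2 sqr_ge0. Qed.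

Lemma dotp_gt0 (u : V) : u != 0 -> 0 < dotp u u.
Proof. by move=> /enorm_gt0; rewrite sqrtr_gt0. Qed.

Lemma nearest_point F y : face P F -> F !=set0 -> exists2 x, F x &
  forall z, F z -> dotp (y - x) (y - x) <= dotp (y - z) (y - z).
Proof.
move=> fF F0.
have cf : continuous (fun x : V => dotp (y - x) (y - x)).
  rewrite (_ : (fun _ => _) =
      fun x : V => \sum_j (y 0 j - x 0 j) * (y 0 j - x 0 j)); last first.
    by apply/funext => x; rewrite dotpE; apply: eq_bigr => j _; rewrite !mxE.
  apply: (@continuous_big R _ +%R) => [|j _]; first exact: add_continuous.
  have cj : continuous (fun x : V => y 0 j - x 0 j).
    move=> x; apply: (@continuousB R R V (fun=> y 0 j) (fun x => x 0 j)).
      exact: cst_continuous.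
    exact: coord_continuous.
  by move=> x; apply: (@continuousM R V (fun x => y 0 j - x 0 j)); exact: cj.
have [x xF xmin] := EVT_min_rV F0 (face_compact fF) (continuous_subspaceT cf).
exists x; first exact: set_mem.
by move=> z Fz; apply: xmin; exact: mem_set.
Qed.

(* The points of F outside its proper faces form its relative interior: a point
   y of the affine hull of F not in F is separated from F by the hyperplane
   through its projection on F, which hence lies in a proper face. *)
Lemma face_relint F z : face P F -> F z ->
  (forall G, face P G -> G `<=` F -> G z -> G = F) ->
  \forall y \near z, (row_mx y 1%:M <= hull F)%MS -> F y.
Proof.
move=> fF Fz nz.
(* A face is determined by its generators; indexing by subsets of ['I_n] makes avoiding all proper
   faces a finite intersection of neighbourhoods of z. *)
pose bad (S : {set 'I_n}) (G : set V) := [/\ face P G, G `<=` F, G <> F & verts G = S].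
have near_bad : \forall y \near z, forall S G, bad S G -> ~ G y.
  apply: (@filter_forall V {set 'I_n} (fun S => [set y | forall G, bad S G -> ~ G y])
    (nbhs z) _) => S.
  have [[G bG]|nG] := pselect (exists G, bad S G); last first.
    by near=> y => G bG; case: nG; exists G.
  have [fG GF GneF GS] := bG.
  have : nbhs z (~` G).
    apply: open_nbhs_nbhs; split; first by apply/closed_openC; exact: face_closed.
    by move=> Gz; apply: GneF; exact: nz.
  apply: filterS => y nGy G' [fG' G'F _ G'S] G'y; apply: nGy.
  by rewrite (face_verts_inj fG fG') // G'S.
have /nbhs_ballP[e /= e0 eb] := near_bad.
have e20 : 0 < e / 2 by rewrite divr_gt0.
have near_z := near_enorm z e20.
near=> y => yF; apply: contrapT => nFy.
have [x Fx xmin] := nearest_point y fF (ex_intro _ z Fz).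
have yz : enorm (y - z) < e / 2 by near: y.
have coordE (u : V) j : `|u 0 j| <= enorm u.
  rewrite -sqrtr_sqr ler_wsqrtr// dotpE (bigD1 j)//= expr2 lerDl sumr_ge0//.
  by move=> k _; rewrite -expr2 sqr_ge0.
(* x is at least as close to y as z is, hence within 2 (e / 2) of z. *)
have xz : ball z e x.
  apply/(ball_rVP _ _ e0) => j.
  have h1 := coordE (y - x) j; have h2 := coordE (y - z) j.
  have h3 : enorm (y - x) <= enorm (y - z) by rewrite ler_wsqrtr// xmin.
  rewrite !mxE in h1 h2; apply: le_lt_trans (ler_distD (y 0 j) _ _) _.
  by rewrite distrC; lra.
have cx w : F w -> dotp (y - x) (w - x) <= 0.
  move=> Fw; rewrite leNgt; apply/negP => c0.
  set c := dotp _ _ in c0; pose D := dotp (w - x) (w - x).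
  have D0 : 0 <= D := dotp_ge0 _.
  (* Moving from x towards w by t changes the squared distance to y by - 2 t c + t^2 D; t (c + D) =
     c makes this negative, against minimality. *)
  pose t := c / (c + D).
  have cD0 : 0 < c + D by rewrite ltr_pwDl.
  have t0 : 0 < t by rewrite divr_gt0.
  have t1 : t <= 1 by rewrite ler_pdivrMr// mul1r lerDl.
  have Ft : F (x + t *: (w - x)) by apply: face_convex => //; rewrite ltW.
  have := xmin _ Ft.
  have -> : dotp (y - (x + t *: (w - x))) (y - (x + t *: (w - x))) =
      dotp (y - x) (y - x) - 2 * t * c + t ^+ 2 * D.
    rewrite /c /D !dotpE !mulr_sumr -sumrB -big_split/=; apply: eq_bigr => j _.
    by rewrite !mxE; ring.
  have : t * (c + D) = c by rewrite divfK// gt_eqF.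
  move: t0 c0 D0 t1; clear; nra.
pose g : 'cV[R]_(d + 1) := col_mx (- (y - x)^T) (dotp (y - x) x)%:M.
have gE w : aff g w 0 = - dotp (y - x) (w - x).
  rewrite affE col_mxEd mxE eqxx mulr1n !dotpE -sumrN -big_split/=.
  by apply: eq_bigr => k _; rewrite col_mxEu !mxE; ring.
have fG : face P (F `&` [set w | aff g w 0 = 0]).
  apply: faceI => // i /vertP Fi; rewrite gE oppr_ge0; exact: cx.
apply: (eb _ xz _ _ (And4 fG _ _ erefl)) => //.
- move=> GF; have : aff g y 0 = 0.
    by apply: submx_aff0 yF _ => i /vertP; rewrite -GF => -[].
  rewrite gE => /eqP; rewrite oppr_eq0 gt_eqF// dotp_gt0// subr_eq0.
  by apply/eqP => yx; apply: nFy; rewrite yx.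
- by split => //=; rewrite gE subrr dotpE big1 ?oppr0// => j _; rewrite [X in _ * X]mxE mulr0.
Unshelve. all: by end_near. Qed.

(** An average over generators, repeated ones included: what matters is that each generator of F has
    weight at least 1/n. *)
Definition face_center (F : set V) : V :=
  #|verts F|%:R^-1 *: \sum_(i in verts F) a i.

Lemma face_center_in F : face P F -> F !=set0 -> F (face_center F).
Proof.
move=> fF [x /(face_convP _ fF)[t [_ t1 _ tF]]].
have n0 : #|verts F|%:R != 0 :> R.
  rewrite pnatr_eq0; apply/eqP => /cards0_eq F0; move: t1.
  rewrite big1 => [/eqP|i _]; first by rewrite eq_sym oner_eq0.
  by rewrite tF// F0 inE.
apply/(face_convP _ fF).
exists (fun i => if i \in verts F then #|verts F|%:R^-1 else 0); split.
- by move=> i; case: ifP.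
- by rewrite -big_mkcond/= sumr_const -[LHS]mulr_natr mulVf.
- rewrite /face_center scaler_sumr big_mkcond/=; apply: eq_bigr => i _.
  by case: ifP; rewrite ?scale0r.
- by move=> i /negbTE ->.
Qed.

Lemma aff_face_center (g : 'cV[R]_(d + 1)) F : face P F -> F !=set0 ->
  aff g (face_center F) 0 = #|verts F|%:R^-1 * \sum_(i in verts F) aff g (a i) 0.
Proof.
move=> fF F0; have /(face_convP _ fF)[t [t0 t1 cE tF]] := face_center_in fF F0.
have n0 : #|verts F|%:R != 0 :> R.
  rewrite pnatr_eq0; apply/eqP => /cards0_eq F0'; move: t1.
  rewrite big1 => [/eqP|i _]; first by rewrite eq_sym oner_eq0.
  by rewrite tF// F0' inE.
pose r i : R := if i \in verts F then #|verts F|%:R^-1 else 0.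
have -> : face_center F = \sum_i r i *: a i.
  rewrite /face_center scaler_sumr big_mkcond/=; apply: eq_bigr => i _.
  by rewrite /r; case: ifP; rewrite ?scale0r.
rewrite aff_sum; last by rewrite -big_mkcond/= sumr_const -[LHS]mulr_natr mulVf.
rewrite mulr_sumr [RHS]big_mkcond/=; apply: eq_bigr => i _.
by rewrite /r; case: ifP; rewrite ?mul0r.
Qed.

Lemma aff_face_center_gt0 (g : 'cV[R]_(d + 1)) F i : face P F -> F (a i) ->
  (forall x, P x -> 0 <= aff g x 0) -> 0 < aff g (a i) 0 ->
  0 < aff g (face_center F) 0.
Proof.
move=> fF Fi g0 gi; rewrite aff_face_center//; last by exists (a i).
have iF : i \in verts F by exact/vertP.
rewrite mulr_gt0 ?invr_gt0 ?ltr0n//; first by apply/card_gt0P; exists i.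
rewrite (bigD1 i)//= ltr_pwDl// sumr_ge0// => j _; apply: g0; exact: hull_vert.
Qed.

(** The ray from the center of F through x leaves F at a last point z. By [face_relint], z lies on a
    proper face, as the ray could otherwise be prolonged inside F, and [facet_above] enlarges that
    face to a facet. *)
Lemma face_exit F x : face P F -> F x -> x != face_center F ->
  exists G z t, [/\ face P G, G `<=` F, (rank G).+1 = rank F, G z &
    0 <= t <= 1 /\ x = (1 - t) *: z + t *: face_center F].
Proof.
move=> fF Fx xc; set c := face_center F in xc *.
have Fc : F c by apply: face_center_in => //; exists x.
have [D PD] := conv_hull_bounded a.
pose S := [set t : R | F (c + t *: (x - c))].
have S1 : S 1 by rewrite /S/= scale1r addrC subrK.
have hS : has_sup S.
  split; first by exists 1.
  have [j /eqP xcj] : exists j, x 0 j - c 0 j <> 0.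
    apply: contrapT => /forallNP h; case/eqP: xc; apply/rowP => j.
    by have /contrapT/subr0_eq -> := h j.
  exists ((D + D) / `|x 0 j - c 0 j|) => t St.
  rewrite ler_pdivlMr ?normr_gt0//.
  apply: (@le_trans _ _ `|t * (x 0 j - c 0 j)|).
    by rewrite normrM ler_wpM2r// ler_norm.
  have -> : t * (x 0 j - c 0 j) = (c + t *: (x - c)) 0 j - c 0 j.
    by rewrite !mxE; ring.
  apply: le_trans (ler_normB _ _) _; apply: lerD; apply: PD; exact: face_sub fF _ _.
pose T := sup S; have T1 : 1 <= T by exact: sup_upper_bound.
have T0 : 0 < T := lt_le_trans ltr01 T1.
pose z := c + T *: (x - c).
have Fz : F z.
  have -> : F = closure F by apply/closure_id; exact: face_closed.
  move=> A /nbhs_line[e e0 he].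
  have [t St te] := sup_adherent e0 hS.
  exists (c + t *: (x - c)); split => //; apply: he.
  by rewrite distrC ger0_norm ?subr_ge0 ?sup_upper_bound// ltrBlDr -ltrBlDl.
have [G [fG GF Gz GneF]] : exists G, [/\ face P G, G `<=` F, G z & G <> F].
  apply: contrapT => nG.
  have : \forall y \near z, (row_mx y 1%:M <= hull F)%MS -> F y.
    apply: face_relint => // G fG GF Gz; apply: contrapT => GneF; apply: nG.
    by exists G.
  move=> /nbhs_line[e e0 /(_ (T + e / 2))].
  rewrite addrC addKr gtr0_norm ?divr_gt0// ltr_pdivrMr// ltr_pMr// ltr1n.
  move=> /(_ isT) h; suff /h FT : (row_mx (c + (T + e / 2) *: (x - c)) 1%:M <= hull F)%MS.
    have : T + e / 2 <= T by apply: sup_upper_bound.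
    by rewrite gerDl leNgt divr_gt0.
  have -> : row_mx (c + (T + e / 2) *: (x - c)) 1%:M = row_mx c 1%:M +
      (T + e / 2) *: (row_mx x 1%:M - row_mx c 1%:M) :> 'rV_(d + 1).
    by rewrite -row_mx1B scale_row_mx scaler0 add_row_mx addr0.
  apply: addmx_sub; first exact: face_submx.
  by apply/scalemx_sub/addmx_sub; rewrite ?eqmx_opp; exact: face_submx.
have rGF : (rank G < rank F)%N.
  by rewrite ltnNge; apply/negP => r; apply: GneF; exact: face_rank_inj r.
have [G' [fG' GG' G'F rG']] := facet_above fF fG GF rGF.
(* From z = c + T (x - c) follows x = T^-1 z + (1 - T^-1) c. *)
exists G', z, (1 - T^-1); split => //; first exact: GG'.
split; first by rewrite subr_ge0 invf_le1// T1 gerBl invr_ge0 ltW.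
have key (u w : V) s : s != 0 ->
    w = (1 - (1 - s^-1)) *: (u + s *: (w - u)) + (1 - s^-1) *: u.
  by move=> s0; apply/rowP => j; rewrite !mxE; field.
by apply: key; rewrite gt_eqF.
Qed.

Lemma face_rank1 F x y : face P F -> rank F = 1%N -> F x -> F y -> x = y.
Proof.
move=> fF rF Fx Fy.
have xy : (row_mx x 1%:M <= (row_mx y 1%:M : 'rV[R]_(d + 1)))%MS.
  apply: submx_trans (face_submx fF Fx) _.
  have [_ <-] := mxrank_leqif_sup (face_submx fF Fy).
  rewrite -/(rank F) rF rank_rV.
  suff -> : (row_mx y 1%:M : 'rV[R]_(d + 1)) != 0 by [].
  apply/eqP => y0; have := congr1 (fun A : 'rV_(d + 1) => A 0 (rshift d 0)) y0.
  by rewrite row_mxEr !mxE eqxx => /eqP; rewrite oner_eq0.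
have /sub_rVP[k kE] := xy.
move: (kE) => /rowP/(_ (rshift d 0)); rewrite [RHS]mxE !row_mxEr mxE eqxx mulr1.
by move=> k1; move: kE; rewrite -k1 scale1r; exact: row_mx1_inj.
Qed.

(** Induction on the dimension: x lies between the center of F and a point of a facet, whose weights
    are multiplied by 1 - s. Hence the flag simplices cover P. *)
Lemma barycentric_subdivision k F x : face P F -> rank F = k.+1 -> F x ->
  exists (f : nat -> set V) (t : nat -> R),
  [/\ forall i, (i <= k)%N -> face P (f i) /\ rank (f i) = i.+1,
      f k = F, forall i, (i < k)%N -> f i `<=` f i.+1, forall i, 0 <= t i &
      \sum_(i < k.+1) t i = 1 /\ x = \sum_(i < k.+1) t i *: face_center (f i)].
Proof.
elim: k F x => [|k ih] F x fF rF Fx.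
  have Fc : F (face_center F) by apply: face_center_in => //; exists x.
  exists (fun=> F), (fun=> 1); split => //; first by move=> i; rewrite leqn0 => /eqP ->.
  rewrite !big_ord1 scale1r; split => //; exact: face_rank1 rF Fx Fc.
have Fc : F (face_center F) by apply: face_center_in => //; exists x.
have [G [z [s [fG GF rG Gz [s01 xE]]]]] : exists G z t,
    [/\ face P G, G `<=` F, (rank G).+1 = rank F, G z &
    0 <= t <= 1 /\ x = (1 - t) *: z + t *: face_center F].
  (* At the center itself no ray is available: any facet does, with weight s = 1 on the center, and
     one exists because a face of rank at least 2 has a second point. *)
  have [xc|xc] := eqVneq x (face_center F); last exact: face_exit.
  have [y Fy yc] : exists2 y, F y & y != face_center F.
    apply: contrapT => ny.
    have Fall y : F y -> y = face_center F.
      by move=> Fy; apply/eqP/contraT => yc; case: ny; exists y.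
    have : (rank F <= 1)%N.
      apply: leq_trans (rank_leq_row (row_mx (face_center F) 1%:M : 'rV[R]_(d + 1))).
      apply: mxrankS; apply/row_subP => i; rewrite row_hull_mx.
      by case: ifPn => [/vertP/Fall ->|_]; rewrite ?sub0mx ?submx_refl.
    by rewrite rF.
  have [G [z [t [fG GF rG Gz _]]]] := face_exit fF Fy yc.
  exists G, z, 1; split => //; rewrite ler01 lexx subrr scale0r scale1r add0r.
  by split.
have {}rG : rank G = k.+1 by apply/succn_inj; rewrite rG.
have [f [t [ff fk fS t0 [t1 zE]]]] := ih G z fG rG Gz.
have [s0 s1] := andP s01.
exists (fun i => if (i <= k)%N then f i else F),
  (fun i => if (i <= k)%N then (1 - s) * t i else s); split.
- move=> i ik; case: (leqP i k) => [|ki]; first exact: ff.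
  split => //; rewrite rF; congr _.+1; apply/eqP.
  by rewrite eqn_leq ik ki.
- by rewrite ltnn.
- move=> i; rewrite ltnS => ik; rewrite ik; case: (ltnP i k) => [|ki].
    exact: fS.
  by have -> : i = k by [apply/eqP; rewrite eqn_leq ik]; rewrite fk.
- by move=> i; case: ifP => // _; rewrite mulr_ge0// subr_ge0.
- rewrite !(big_ord_recr k.+1)/= ltnn.
  under eq_bigr => i _ do rewrite -ltnS ltn_ord.
  under [in X in _ /\ X]eq_bigr => i _ do rewrite -ltnS ltn_ord -scalerA.
  rewrite -mulr_sumr t1 mulr1 subrK; split => //.
  by rewrite -scaler_sumr -zE.
Qed.

End polytope_boundary.

(** * Flags *)

Section flag_chains.
Context {R : realType} {d n : nat}.
Local Notation V := 'rV[R]_d.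
Variable a : 'I_n -> V.
Let P := conv_hull (range a).
Local Notation verts := (verts a).
Local Notation rank := (face_rank a).
Local Notation center := (face_center a).
Let vertP := vertP a.

Lemma conv_hull_sum m (t : 'I_m -> R) (y : 'I_m -> V) :
  (forall i, P (y i)) -> (forall i, 0 <= t i) -> \sum_i t i = 1 ->
  P (\sum_i t i *: y i).
Proof.
move=> Py t0 t1; have /choice[r rE] := fun i => (conv_hull_range a (y i)).1 (Py i).
apply/conv_hull_range; exists (fun k => \sum_i t i * r i k); split.
- by move=> k; apply: sumr_ge0 => i _; rewrite mulr_ge0//; have [] := rE i.
- rewrite exchange_big/= -[RHS]t1; apply: eq_bigr => i _.
  by rewrite -mulr_sumr; have [_ -> _] := rE i; rewrite mulr1.
- under [RHS]eq_bigr do rewrite scaler_suml.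
  rewrite exchange_big/=; apply: eq_bigr => i _.
  have [_ _ {1}->] := rE i; rewrite scaler_sumr.
  by apply: eq_bigr => k _; rewrite scalerA.
Qed.

Definition face_support (F : set V) : 'cV[R]_(d + 1) :=
  xget 0 [set g | (forall x, P x -> 0 <= aff g x 0) /\
    F = P `&` [set x | aff g x 0 = 0]].

Lemma face_supportP F : face P F -> (forall x, P x -> 0 <= aff (face_support F) x 0) /\
  F = P `&` [set x | aff (face_support F) x 0 = 0].
Proof. by move=> /faceP/(xgetPex 0). Qed.

Lemma face_support_center_gt0 F G : face P F -> face P G -> ~ G `<=` F ->
  0 < aff (face_support F) (center G) 0.
Proof.
move=> fF fG GF; have [g0 FE] := face_supportP fF.
have [i Gi Fi] : exists2 i, G (a i) & ~ F (a i).
  apply: contrapT => nex; apply: GF => x /(face_convP x fG)[t [t0 t1 xE tG]].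
  apply/(face_convP x fF); exists t; split => // i /negP iF.
  apply: tG; apply/negP => /vertP Gi; apply: nex; exists i => // Fi.
  by apply: iF; exact/vertP.
apply: (aff_face_center_gt0 fG Gi g0).
rewrite lt0r g0 ?andbT; last exact: hull_vert.
by apply/eqP => gi; apply: Fi; rewrite FE; split => //; exact: hull_vert.
Qed.

(** A flag, with ranks for dimensions and plain inclusions for relative boundaries; [flags_chain]
    gives the equivalence. Indices beyond d carry no information. *)
Definition chain (f : nat -> set V) : Prop :=
  (forall i, (i <= d)%N -> face P (f i) /\ rank (f i) = i.+1) /\
  (forall i, (i < d)%N -> f i `<=` f i.+1).

(* The constant functional 1 plays the role of the support functional of the
   empty face. *)
Definition chain_fun (f : nat -> set V) (j : nat) : 'cV[R]_(d + 1) :=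
  if j is j'.+1 then face_support (f j') else col_mx 0 1%:M.

Definition chain_mx (f : nat -> set V) : 'M[R]_(d + 1) :=
  \matrix_(i, j) chain_fun f j i 0.

Lemma aff_chain_mx f x j : aff (chain_mx f) x j = aff (chain_fun f j) x 0.
Proof. by rewrite !affE !mxE; congr (_ + _); apply: eq_bigr => i _; rewrite mxE. Qed.

Lemma aff_one x : aff (col_mx 0 1%:M : 'cV[R]_(d + 1)) x 0 = 1.
Proof.
rewrite affE col_mxEd mxE eqxx big1 ?add0r// => k _.
by rewrite col_mxEu mxE mulr0.
Qed.

Lemma ltn_addn1 (i : 'I_(d + 1)) : (i <= d)%N.
Proof. by rewrite -ltnS -[X in (_ < X)%N]addn1. Qed.

Section chain.
Variable f : nat -> set V.
Hypothesis cf : chain f.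

Let ff i : (i <= d)%N -> face P (f i). Proof. by move=> /(proj1 cf)[]. Qed.

Lemma chain_homo i j : (i <= j <= d)%N -> f i `<=` f j.
Proof.
move=> /andP[ij jd]; rewrite -(subnKC ij) in jd *.
elim: (j - i)%N jd => [|k ih]; first by rewrite addn0 => _; exact: subset_refl.
rewrite addnS => h; apply: subset_trans (ih (ltnW h)) _.
exact: (proj2 cf).
Qed.

Lemma chain_nonempty i : (i <= d)%N -> f i !=set0.
Proof.
move=> /(proj1 cf)[fi ri]; have : (0 < rank (f i))%N by rewrite ri.
rewrite lt0n mxrank_eq0 => /eqP H0; apply: contrapT => /forallNP nf.
apply: H0; apply/row_matrixP => k; rewrite row_hull_mx row0.
by case: ifPn => // /vertP/nf.
Qed.

Lemma chain_center i : (i <= d)%N -> f i (center (f i)).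
Proof. by move=> id; apply: face_center_in; [exact: ff|exact: chain_nonempty]. Qed.

Lemma chain_centerP i : (i <= d)%N -> P (center (f i)).
Proof. by move=> id; exact: face_sub (ff id) _ (chain_center id). Qed.

Lemma chain_fun_ge0 j x : (j <= d)%N -> P x -> 0 <= aff (chain_fun f j) x 0.
Proof.
case: j => [_ _|j jd]; first by rewrite aff_one.
exact: (face_supportP (ff (ltnW jd))).1.
Qed.

(** Functional j belongs to the face of index j - 1, which contains the k-th center exactly when k <
    j. With [chain_fun_gt0], this triangularity drives the coordinate estimates. *)
Lemma chain_fun_eq0 j k : (k < j <= d)%N -> aff (chain_fun f j) (center (f k)) 0 = 0.
Proof.
case: j => // j /andP[kj jd]; have [_ fE] := face_supportP (ff (ltnW jd)).
have : f j (center (f k)).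
  apply: (@chain_homo k); first by rewrite -ltnS kj ltnW.
  by apply: chain_center; apply: leq_trans jd; rewrite ltnW.
by rewrite fE => -[].
Qed.

Lemma chain_fun_gt0 j k : (j <= k <= d)%N -> 0 < aff (chain_fun f j) (center (f k)) 0.
Proof.
case: j => [_|j /andP[jk kd]]; first by rewrite aff_one.
have jd : (j <= d)%N by rewrite (leq_trans (ltnW jk)).
apply: face_support_center_gt0; [exact: ff|exact: ff|move=> kj].
have := face_rank_sub a kj; have [_ ->] := (proj1 cf) _ kd.
by have [_ ->] := (proj1 cf) _ jd; rewrite ltnS leqNgt jk.
Qed.

Lemma chain_interior j x : (j <= d)%N -> P° x -> 0 < aff (chain_fun f j) x 0.
Proof.
move=> jd; apply: (aff_interior (K := P) (y := center (f d))).
- by move=> z; exact: chain_fun_ge0.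
- exact: chain_centerP.
- by rewrite chain_fun_gt0// jd leqnn.
Qed.

(** The product of the two matrices is triangular with positive diagonal, so both factors are
    invertible at once. *)
Lemma trig_points_unit (u : 'I_(d + 1) -> V) :
  (forall k j : 'I_(d + 1), (k < j)%N -> aff (chain_fun f j) (u k) 0 = 0) ->
  (forall k : 'I_(d + 1), 0 < aff (chain_fun f k) (u k) 0) ->
  points_mx u \in unitmx /\ chain_mx f \in unitmx.
Proof.
move=> u0 u1; have : points_mx u *m chain_mx f \in unitmx.
  rewrite unitmxE det_trig.
    rewrite unitfE; apply/prodf_neq0 => k _.
    by rewrite affM_points_mx aff_chain_mx gt_eqF.
  by apply/is_trig_mxP => k j kj; rewrite affM_points_mx aff_chain_mx u0.
by rewrite unitmx_mul => /andP[].
Qed.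

Definition chain_points (i : 'I_(d + 1)) : V := center (f i).

Lemma chain_units : points_mx chain_points \in unitmx /\ chain_mx f \in unitmx.
Proof.
apply: trig_points_unit => [k j kj|k].
  by rewrite chain_fun_eq0// kj ltn_addn1.
by rewrite chain_fun_gt0// leqnn ltn_addn1.
Qed.

(** Column 0 of [chain_mx f] is the functional 1, so column 0 of the identity
    [invmx (chain_mx f) *m chain_mx f] is the last column of the inverse: one vertex of the cone is
    finite, the others are at infinity. *)
Lemma frame_chain_mx : frame (chain_mx f).
Proof.
have [_ uG] := chain_units; split => // j.
pose o : 'I_(d + 1) := cast_ord (esym (addn1 d)) ord0.
have Go k : chain_mx f k o = (k == rshift d 0)%:R.
  rewrite mxE/=; case: (@split_ordP d 1 k) => i ->.
    by rewrite col_mxEu mxE eq_lrshift.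
  by rewrite col_mxEd ord1 mxE !eqxx.
have : (invmx (chain_mx f) *m chain_mx f) j o = invmx (chain_mx f) j (rshift d 0).
  rewrite mxE (bigD1 (rshift d 0))//= Go eqxx mulr1 big1 ?addr0// => k /negbTE kr.
  by rewrite Go kr mulr0.
by rewrite mulVmx// mxE => <-; exact: ler0n.
Qed.

(* [dilated_points s 0 = center (f 0)], since [0.-1 = 0]. *)
Definition dilated_points (s : R) (i : 'I_(d + 1)) : V :=
  center (f i) + s *: (center (f i) - center (f i.-1)).

Lemma dilated_units s : 0 < s -> points_mx (dilated_points s) \in unitmx.
Proof.
move=> s0; apply: (proj1 (trig_points_unit _ _)) => [k j kj|k].
  have kd := ltn_addn1 j.
  rewrite affD !chain_fun_eq0 ?subrr ?mulr0 ?addr0 ?kj//.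
  by rewrite (leq_ltn_trans (leq_pred k) kj).
have kd := ltn_addn1 k; rewrite affD.
have h : 0 < aff (chain_fun f k) (center (f k)) 0.
  by rewrite chain_fun_gt0// leqnn.
case: (posnP k) => [->|k0]; first by rewrite /= subrr mulr0 addr0 aff_one.
rewrite [X in _ - X]chain_fun_eq0 ?subr0 ?addr_gt0 ?mulr_gt0//.
by rewrite prednK// leqnn.
Qed.

(** A generator of the smaller face has weight at least 1/n >= s in the center of the larger one,
    and the dilation subtracts at most s from it. *)
Lemma dilated_points_in s i : 0 < s -> s * n%:R <= 1 -> P (dilated_points s i).
Proof.
move=> s0 sn; have id := ltn_addn1 i; have i1d := leq_trans (leq_pred i) id.
pose r k j : R := if j \in verts (f k) then #|verts (f k)|%:R^-1 else 0.
have vn0 k : (k <= d)%N -> (0 < #|verts (f k)|)%N.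
  move=> kd; have [x fx] := chain_nonempty kd.
  rewrite lt0n; apply/eqP => /cards0_eq v0.
  have /(face_convP _ (ff kd))[t [_ t1 _ tv]] := fx.
  move: t1; rewrite big1 => [/eqP|j _]; first by rewrite eq_sym oner_eq0.
  by rewrite tv// v0 inE.
have r1 k : (k <= d)%N -> \sum_j r k j = 1.
  move=> /vn0 h; rewrite -big_mkcond/= sumr_const -[LHS]mulr_natr mulVf//.
  by rewrite pnatr_eq0 -lt0n.
have rc k : center (f k) = \sum_j r k j *: a j.
  rewrite /face_center scaler_sumr big_mkcond/=; apply: eq_bigr => j _.
  by rewrite /r; case: ifP; rewrite ?scale0r.
apply/conv_hull_range; exists (fun j => r i j + s * (r i j - r i.-1 j)); split.
- move=> j; rewrite /r; case: (boolP (j \in verts (f i.-1))) => [ji1|_]; last first.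
    by rewrite subr0; case: ifP => _; rewrite ?mulr0 ?addr0// addr_ge0 ?mulr_ge0 ?invr_ge0// ltW.
  have ji : j \in verts (f i).
    move: ji1 => /vertP ji1; apply/vertP; apply: chain_homo ji1.
    by rewrite leq_pred.
  rewrite ji.
  have h1 : s <= #|verts (f i)|%:R^-1.
    rewrite -div1r ler_pdivlMr ?ltr0n ?vn0//; apply: le_trans sn.
    rewrite ler_pM2l// ler_nat; apply: leq_trans (max_card _) _.
    by rewrite card_ord.
  have h2 : s * #|verts (f i.-1)|%:R^-1 <= s.
    by rewrite ger_pMr// invf_le1 ?ltr0n ?ler1n ?vn0.
  have h3 : 0 <= s * #|verts (f i)|%:R^-1 by rewrite mulr_ge0 ?invr_ge0// ltW.
  by rewrite mulrBr; lra.
- by rewrite big_split/= -mulr_sumr sumrB !r1// subrr mulr0 addr0.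
- rewrite /dilated_points !rc -sumrB scaler_sumr -big_split/=.
  by apply: eq_bigr => j _; rewrite -scalerBl scalerA -scalerDl.
Qed.

Lemma chain_coords x (t : 'I_(d + 1) -> R) j : \sum_k t k = 1 ->
  x = \sum_k t k *: chain_points k ->
  aff (chain_fun f j) x 0 = \sum_k t k * aff (chain_fun f j) (center (f k)) 0.
Proof. by move=> t1 ->; rewrite aff_sum. Qed.

(* The two systems of coordinates are related by
   (1 + s) xi_k = t_k + s xi_(k+1) for k > 0, which is solved downwards. *)
Lemma dilated_coords (s : R) x (t : 'I_(d + 1) -> R) :
  0 < s -> (forall k, 0 <= t k) -> \sum_k t k = 1 ->
  x = \sum_k t k *: chain_points k ->
  let xi := aff (invmx (points_mx (dilated_points s))) x in
  [/\ forall k, 0 <= xi k, forall k, t k <= (1 + s) * xi k &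
     forall j k : 'I_(d + 1), (j <= k)%N -> (s / (1 + s)) ^+ (k - j) * xi k <= xi j].
Proof.
move=> s0 t0 t1 xE xi.
have uw := dilated_units s0; have [uc _] := chain_units.
(* Extended by zero to all indices, so that the recursion also holds at k = d, where the next
   coordinate is 0. *)
pose X k := if insub k is Some i then xi i else 0.
have XE (i : 'I_(d + 1)) : X i = xi i by rewrite /X valK.
have Xd k : (d < k)%N -> X k = 0.
  by move=> dk; rewrite /X insubF// addn1 ltnS leqNgt dk.
have E (i : nat) (k : 'I_(d + 1)) : (i <= d)%N ->
    aff (invmx (points_mx chain_points)) (center (f i)) k = (i == k :> nat)%:R.
  move=> id; have id1 : (i < d + 1)%N by rewrite addn1.
  have := affM_points_mx (invmx (points_mx chain_points)) chain_points
    (Ordinal id1) k.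
  by rewrite mulmxV// mxE => <-.
have sumX k : (k <= d)%N ->
    \sum_(j < d + 1) X j * (j.-1 == k)%:R = X k.+1 + (k == 0%N)%:R * X 0%N.
  move=> kd; rewrite addn1 big_ord_recl addrC.
  congr (_ + _); last by rewrite mulrC eq_sym.
  under eq_bigr do rewrite lift0/=.
  move: kd; rewrite leq_eqVlt => /orP[/eqP kd|kd].
    rewrite Xd ?kd// big1// => j _.
    by rewrite ltn_eqF ?mulr0.
  rewrite (bigD1 (Ordinal kd))//= eqxx mulr1 big1 ?addr0// => j jk.
  by rewrite -(inj_eq val_inj)/= in jk; rewrite (negbTE jk) mulr0.
(* At k = 0 the factor is 1 and not 1 + s, the vertex of index 0 being undilated. *)
have rel (k : 'I_(d + 1)) : t k + s * X k.+1 = (1 + s * (k != 0%N :> nat)%:R) * X k.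
  have := barycentric_unique uc k t1; rewrite -xE => <-.
  rewrite {1}(barycentricE uw x) aff_sum ?barycentric_sum//.
  under eq_bigr => j _ do
    rewrite affD !E ?ltn_addn1 ?(leq_trans (leq_pred j) (ltn_addn1 j))// -/(xi j) -XE
      mulrDr mulrCA mulrBr.
  rewrite big_split/= -mulr_sumr sumrB sumX ?ltn_addn1//.
  have -> : \sum_(j < d + 1) X j * (j == k :> nat)%:R = X k.
    rewrite (bigD1 k)//= eqxx mulr1 big1 ?addr0// => j jk.
    by rewrite (inj_eq val_inj) (negbTE jk) mulr0.
  by case: (posnP k) => [->|k0]; rewrite ?eqxx ?gtn_eqF//=; ring.
have X0 m k : (d < k + m)%N -> 0 <= X k.
  elim: m k => [|m ih] k; first by rewrite addn0 => /Xd ->.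
  rewrite addnS -addSn => /ih Xk; have [kd|/Xd ->//] := leqP k d.
  have kd1 : (k < d + 1)%N by rewrite addn1.
  have := rel (Ordinal kd1); rewrite /= => h.
  have c0 : 0 < 1 + s * (k != 0%N)%:R by rewrite ltr_pwDl// mulr_ge0// ltW.
  by rewrite -(pmulr_rge0 _ c0) -h addr_ge0// mulr_ge0// ltW.
have {}X0 k : 0 <= X k by apply: (X0 d.+1); rewrite addnS ltnS leq_addl.
have c1 (k : 'I_(d + 1)) : (1 + s * (k != 0%N :> nat)%:R) * X k <= (1 + s) * X k.
  by rewrite ler_wpM2r// lerD2l ler_piMr ?(ltW s0)// lern1 leq_b1.
have s10 : 0 < 1 + s by rewrite addr_gt0.
have step (k : 'I_(d + 1)) : s / (1 + s) * X k.+1 <= X k.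
  rewrite mulrAC ler_pdivrMr// [leRHS]mulrC; apply: le_trans (c1 k).
  by rewrite -rel lerDr.
have decay m k : (k + m <= d)%N -> (s / (1 + s)) ^+ m * X (k + m)%N <= X k.
  elim: m => [|m ih] km; first by rewrite expr0 mul1r addn0.
  rewrite addnS in km; apply: le_trans (ih (ltnW km)).
  have km1 : (k + m < d + 1)%N by rewrite addn1 ltnS ltnW.
  have b0 : 0 <= s / (1 + s) by rewrite divr_ge0 ?(ltW s0) ?(ltW s10).
  rewrite exprSr -mulrA ler_wpM2l//; first exact: exprn_ge0.
  by rewrite addnS; exact: (step (Ordinal km1)).
split=> [k|k|j k jk]; rewrite -?XE//.
  apply: le_trans (c1 k); rewrite -rel lerDl mulr_ge0//; exact: ltW.
have := decay (k - j)%N j; rewrite subnKC// => -> //; exact: ltn_addn1.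
Qed.

(* The functional of index j is triangular in the barycentric coordinates with
   respect to the centers and exceeds K times the next one; hence, downwards in j,
   these coordinates are positive and each dominates the sum of the following
   ones. *)
Lemma sector_coords (A e : R) T x : 0 < e -> 0 < A ->
  (forall j k, (j <= d)%N -> (k <= d)%N ->
     aff (chain_fun f j) (center (f k)) 0 <= A) ->
  (forall j k, (j <= k <= d)%N -> e <= aff (chain_fun f j) (center (f k)) 0) ->
  let K := (2 * A ^+ 2 / e + A) / e in
  sector (graded_frame (chain_mx f) K) T x ->
  let t := aff (invmx (points_mx chain_points)) x in
  [/\ forall k, 0 < t k,
     forall k : 'I_(d + 1), 2 * A / e * (\sum_(l < d + 1 | (k < l)%N) t l) <= t k &
     K ^- d / A * expR (- T) <= t (rshift d 0)].
Proof.
move=> e0 A0 mA me K [Nx [Nlt NT]] t.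
have K0 : 0 < K by rewrite divr_gt0// addr_gt0// divr_gt0// mulr_gt0// exprn_gt0.
(* K is chosen so that [K * e * S j <= G j] and G_j <= A t_j + A S_j, where S_j is the sum of the
   later coordinates, give t_j >= (2 A / e) S_j. *)
have Ke : K * e = 2 * A ^+ 2 / e + A by rewrite /K divfK// gt_eqF.
have KeA : A < K * e by rewrite Ke ltrDr divr_gt0// mulr_gt0// exprn_gt0.
have [uc _] := chain_units.
have t1 : \sum_k t k = 1 by exact: barycentric_sum.
pose G j := aff (chain_fun f j) x 0.
have GE (j : nat) : G j = \sum_k t k * aff (chain_fun f j) (center (f k)) 0.
  by rewrite /G {1}(barycentricE uc x) aff_sum.
have NG (j : 'I_(d + 1)) : aff (graded_frame (chain_mx f) K) x j = K ^+ j * G j.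
  by rewrite aff_graded aff_chain_mx.
have G0 (j : 'I_(d + 1)) : 0 < G j.
  by have := Nx j; rewrite NG pmulr_rgt0// exprn_gt0.
have Gstep (i j : 'I_(d + 1)) : j = i.+1 :> nat -> K * G j < G i.
  move=> ji; have := Nlt i j; rewrite ji ltnS leqnn => /(_ isT).
  by rewrite !NG ji exprSr -mulrA ltr_pM2l ?exprn_gt0.
pose S (j : nat) := \sum_(l < d + 1 | (j < l)%N) t l.
have step (j : 'I_(d + 1)) : (forall k : 'I_(d + 1), (j < k)%N -> 0 < t k) ->
    0 < t j /\ 2 * A / e * S j <= t j.
  move=> tk; have jd := ltn_addn1 j.
  have S0 : 0 <= S j by apply: sumr_ge0 => k /tk/ltW.
  have KS : K * e * S j <= G j.
    move: (jd); rewrite leq_eqVlt => /orP[/eqP jd'|jd'].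
      rewrite /S big_pred0 ?mulr0 ?ltW// => k.
      by rewrite jd' ltnNge ltn_addn1.
    have j1 : (j.+1 < d + 1)%N by rewrite [X in (_ < X)%N]addn1.
    have Gs : K * G j.+1 < G j := Gstep j (Ordinal j1) erefl.
    apply: ltW; apply: le_lt_trans Gs; rewrite -mulrA ler_pM2l//.
    rewrite (GE j.+1) mulr_sumr big_mkcond; apply: ler_sum => k _.
    case: ifPn => [jk|]; last first.
      rewrite -leqNgt => kj; rewrite chain_fun_eq0 ?mulr0//.
      by rewrite ltnS kj.
    rewrite mulrC; apply: ler_wpM2l; first exact/ltW/tk.
    by apply: me; rewrite jk ltn_addn1.
  have mj : 0 < aff (chain_fun f j) (center (f j)) 0.
    by rewrite chain_fun_gt0// leqnn.
  have GS : G j <= t j * aff (chain_fun f j) (center (f j)) 0 + A * S j.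
    rewrite GE (bigD1 j)//= lerD2l /S mulr_sumr big_mkcond [leRHS]big_mkcond/=.
    apply: ler_sum => k _; have [->|kj] := eqVneq k j; first by rewrite ltnn.
    rewrite ltn_neqAle eq_sym (inj_eq val_inj) kj/=; case: leqP => [jk|kj'].
      rewrite mulrC; apply: ler_wpM2r; last by apply: mA => //; exact: ltn_addn1.
      by apply/ltW/tk; rewrite ltn_neqAle jk andbT eq_sym (inj_eq val_inj).
    by rewrite chain_fun_eq0 ?mulr0// kj'.
  have AS : A * S j < G j.
    have [->|Sn] := eqVneq (S j) 0; first by rewrite mulr0.
    by apply: lt_le_trans KS; rewrite ltr_pM2r// lt0r Sn.
  have tm0 : 0 < t j * aff (chain_fun f j) (center (f j)) 0 by lra.
  have tj0 : 0 < t j by rewrite -(pmulr_lgt0 _ mj).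
  split => //; have tA : t j * aff (chain_fun f j) (center (f j)) 0 <= t j * A.
    by rewrite ler_pM2l// mA.
  rewrite -(ler_pM2r A0); apply: le_trans tA.
  have -> : 2 * A / e * S j * A = K * e * S j - A * S j by rewrite Ke; ring.
  lra.
have tpos m (j : 'I_(d + 1)) : (d < j + m)%N -> 0 < t j.
  elim: m j => [|m ih] j; first by rewrite addn0 ltnNge ltn_addn1.
  move=> jm; apply: (proj1 (step j _)) => k jk; apply: ih.
  by apply: leq_trans jm _; rewrite addnS -addSn leq_add2r.
have {}tpos j : 0 < t j by apply: (tpos d.+1); rewrite addnS ltnS leq_addl.
split=> [//|k|]; first by apply: (proj2 (step k _)).
(* Coordinate 0 is the constant 1; coordinate d is K^d t_d times a value at the last center, at most
   A. *)
set l := rshift d 0; have ld : l = d :> nat by rewrite /= addn0.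
pose o : 'I_(d + 1) := cast_ord (esym (addn1 d)) ord0.
have := NT o l; rewrite !NG ld expr0 mul1r /G aff_one mulr1 -/(G d) GE.
rewrite (bigD1 l)//= big1 => [|k kl]; last first.
  rewrite chain_fun_eq0 ?mulr0// leqnn andbT ltn_neqAle ltn_addn1 andbT.
  by rewrite -{2}ld (inj_eq val_inj).
rewrite addr0 -/l => h; rewrite mulrC mulrA ler_pdivrMr// ler_pdivrMr ?exprn_gt0//.
apply: ltW; apply: lt_le_trans h _; rewrite mulrC ler_pM2r ?exprn_gt0//.
by rewrite ler_pM2l// mA// addn0.
Qed.

End chain.

End flag_chains.

(** * The polytope, covered and packed along its chains of faces *)

Section polytope_volume.
Context {R : realType} {d n : nat}.
Local Notation V := 'rV[R]_d.
Variable a : 'I_n -> V.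
Let P := conv_hull (range a).
Local Notation verts := (verts a).
Local Notation rank := (face_rank a).
Local Notation center := (face_center a).
Local Notation chain := (chain a).
Local Notation chain_fun := (chain_fun a).
Local Notation chain_mx := (chain_mx a).
Let vertP := vertP a.

Lemma finite_ub (T : finType) (phi : T -> R) :
  exists2 A, 1 <= A & forall x, phi x <= A.
Proof.
exists (1 + \sum_x `|phi x|); first by rewrite lerDl sumr_ge0.
move=> x; rewrite (bigD1 x)//= addrCA (le_trans (ler_norm _))// lerDl.
by rewrite addr_ge0// sumr_ge0.
Qed.

Lemma finite_pos_lb (T : finType) (phi : T -> R) :
  exists2 e, 0 < e <= 1 & forall x, 0 < phi x -> e <= phi x.
Proof.
have [A A1 phiA] := finite_ub (fun x => (phi x)^-1).
have A0 := lt_le_trans ltr01 A1.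
exists A^-1; first by rewrite invr_gt0 A0 invf_le1.
by move=> x x0; rewrite -[leRHS]invrK lef_pV2// posrE invr_gt0.
Qed.

Lemma face_refl : face P P.
Proof.
apply/faceP; exists 0; split=> [x _|]; first by rewrite /aff mulmx0 mxE.
by apply/seteqP; split=> [x Px|x []//]; split => //=; rewrite /aff mulmx0 mxE.
Qed.

Hypothesis rankP : rank P = d.+1.

Lemma chain_top f : chain f -> f d = P.
Proof.
move=> cf; have [fd rd] := (proj1 cf) d (leqnn d).
apply: (face_rank_inj fd face_refl (face_sub fd)).
by rewrite rd rankP.
Qed.

(** The center lies on no proper face, so [face_relint] applies; full rank makes its span condition
    automatic. *)
Lemma center_interior : P !=set0 -> P° (center P).
Proof.
move=> P0; have Pc := face_center_in face_refl P0.
have := @face_relint _ _ _ a P _ face_refl Pc.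
have proper G : face P G -> G `<=` P -> G (center P) -> G = P.
  move=> fG GP Gc; apply: contrapT => GneP.
  have nPG : ~ P `<=` G by move=> PG; apply: GneP; exact/seteqP.
  have := face_support_center_gt0 fG face_refl nPG.
  have [_ GE] := face_supportP fG.
  by move: Gc; rewrite {1}GE => -[_ /= ->]; rewrite ltxx.
move=> /(_ proper); rewrite /interior; apply: filterS => y; apply.
apply: submx_full; rewrite /row_full -/(rank P) rankP addn1; exact: eqxx.
Qed.

Variables (Vol : volume_notion R d) (p : V) (I : finType) (fl : I -> nat -> set V).
Hypotheses (Pp : P° p) (cfl : forall i, chain (fl i))
  (fl_inj : forall i i', (forall j, (j <= d)%N -> fl i j = fl i' j) -> i = i')
  (fl_surj : forall f, chain f -> exists i, forall j, (j <= d)%N -> fl i j = f j).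

Lemma asvol_chains N0 : frame N0 ->
  asvol Vol P p = (#|I|%:R%:E * sector_growth Vol N0)%E.
Proof.
move=> fN0; have Pp' := interior_subset Pp.
(* Finitely many functionals at finitely many centers: one upper bound [A], and one lower bound [e]
   of the positive values, serve all pairs of flags. *)
pose phi (x : I * I * 'I_(d + 1) * 'I_(d + 1)) :=
  aff (chain_fun (fl x.1.1.1) x.1.2) (center (fl x.1.1.2 x.2)) 0.
have [A A1 phiA] := finite_ub phi; have A0 := lt_le_trans ltr01 A1.
have [e /andP[e0 e1] phie] := finite_pos_lb phi.
have ltd j : (j <= d)%N -> (j < d + 1)%N by rewrite addn1.
have mA i i' j k : (j <= d)%N -> (k <= d)%N ->
    aff (chain_fun (fl i) j) (center (fl i' k)) 0 <= A.
  by move=> jd kd; exact: (phiA (i, i', Ordinal (ltd _ jd), Ordinal (ltd _ kd))).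
have me i i' j k : (j <= d)%N -> (k <= d)%N ->
    0 < aff (chain_fun (fl i) j) (center (fl i' k)) 0 ->
    e <= aff (chain_fun (fl i) j) (center (fl i' k)) 0.
  by move=> jd kd; exact: (phie (i, i', Ordinal (ltd _ jd), Ordinal (ltd _ kd))).
pose K := (2 * A ^+ 2 / e + A) / e.
have K0 : 0 < K by rewrite divr_gt0// addr_gt0// divr_gt0// mulr_gt0// exprn_gt0.
have sec i T x := sector_coords (cfl i) e0 A0 (mA i i)
  (fun j k jk => me i i j k (leq_trans (proj1 (andP jk)) (proj2 (andP jk)))
     (proj2 (andP jk)) (chain_fun_gt0 (cfl i) jk)) (T := T) (x := x).
have [e2 /andP[e20 e21] pe2] := finite_pos_lb (fun i => aff (chain_fun (fl i) d) p 0).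
have n0 : (0 < n)%N.
  have [t [_ t1 _]] := (conv_hull_range a p).1 Pp'.
  case: (n) t t1 => // t; rewrite big_ord0 => /eqP.
  by rewrite eq_sym oner_eq0.
pose s : R := n%:R^-1; have s0 : 0 < s by rewrite invr_gt0 ltr0n.
have sn : s * n%:R <= 1 by rewrite mulVf// pnatr_eq0 -lt0n.
pose be := s / (1 + s); have s10 : 0 < 1 + s by rewrite addr_gt0.
have be0 : 0 < be by rewrite divr_gt0.
have be1 : be <= 1 by rewrite ler_pdivrMr// mul1r lerDr.
pose b1 := be ^+ d / (A * (1 + s)); have b10 : 0 < b1.
  by rewrite divr_gt0 ?exprn_gt0// mulr_gt0.
pose b2 := K ^- d / A; have b20 : 0 < b2 by rewrite divr_gt0// invr_gt0 exprn_gt0.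
(* [e2] bounds the functionals of index d at p, [b1] serves the covering by dilated simplices, and
   [b2] the weight of the last center in an outer sector. *)
pose b := Num.min (Num.min 1 e2) (Num.min b1 b2).
have b0 : 0 < b by rewrite !lt_min ltr01 e20 b10.
have [bl1 ble2 blb1 blb2] : [/\ b <= 1, b <= e2, b <= b1 & b <= b2].
  by split; rewrite !ge_min lexx ?orbT.
have P0 : P !=set0 by exists p.
have topE i : center (fl i d) = center P by rewrite chain_top.
apply: (@asvol_sectors _ _ Vol P p (center P) I
  (fun i => invmx (points_mx (dilated_points a (fl i) s)))
  (fun i => graded_frame (chain_mx (fl i)) K) b) => //.
- by move=> x y t; exact: conv_hull_convex.
- exact: conv_hull_bounded.
- exact: center_interior.
- by rewrite b0.
- by move=> i; rewrite unitmx_inv; exact: dilated_units.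
- by move=> i j; rewrite invmxK points_mx_last.
- move=> i; apply: subset_trans (orthant_points_conv (dilated_units (cfl i) s0)) _.
  move=> x /conv_hull_range[t [t0 t1 ->]]; apply: conv_hull_sum => // k.
  exact: dilated_points_in.
- move=> x Px; have Px' := interior_subset Px.
  have [f [t [ff fd fS t0 [t1 xE]]]] := barycentric_subdivision face_refl rankP Px'.
  have cf : chain f by split.
  have [i iE] := fl_surj cf; exists i; pose l : 'I_(d + 1) := rshift d 0.
  have ld : l = d :> nat by rewrite /= addn0.
  have t1' : \sum_(k < d + 1) t k = 1 by rewrite addn1.
  have xE' : x = \sum_(k < d + 1) t k *: chain_points a (fl i) k.
    have -> : x = \sum_(k < d + 1) t k *: center (f k) by rewrite addn1.
    by apply: eq_bigr => k _; rewrite /chain_points iE// ltn_addn1.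
  have [] := dilated_coords (cfl i) s0 (fun k : 'I_(d + 1) => t0 k) t1' xE'.
  set xi := aff _ x => xi0 txi dec.
  (* The functional of index d vanishes at every center but the last, so it measures the weight t_d;
     through it the Hilbert distance controls all coordinates. *)
  have GE : aff (chain_fun (fl i) d) x 0 =
      t d * aff (chain_fun (fl i) d) (center (fl i d)) 0.
    rewrite (chain_coords d t1' xE') (bigD1 l)//= big1 => [|k kl].
      by rewrite addr0 addn0.
    rewrite (chain_fun_eq0 (cfl i)) ?mulr0// leqnn andbT ltn_neqAle ltn_addn1 andbT.
    by rewrite -{2}ld (inj_eq val_inj).
  have Gd0 : 0 < aff (chain_fun (fl i) d) x 0 by exact: chain_interior.
  have td0 : 0 < t d.
    by rewrite lt0r t0 andbT; apply: contraTneq Gd0 => td; rewrite GE td mul0r ltxx.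
  have tl : t d <= (1 + s) * xi l by have := txi l; rewrite ld.
  have xil : 0 < xi l by rewrite -(pmulr_rgt0 _ s10); exact: lt_le_trans tl.
  have xil_le j : be ^+ d * xi l <= xi j.
    apply: le_trans (dec j l _); last by rewrite ld ltn_addn1.
    rewrite ler_pM2r// ler_wiXn2l ?(ltW be0)// ld; exact: leq_subr.
  have b1d : b1 <= be ^+ d.
    rewrite ler_pdivrMr ?mulr_gt0// ler_peMr ?exprn_ge0 ?(ltW be0)//.
    by rewrite -[leLHS]mulr1 ler_pM// lerDl ltW.
  split.
  + move=> j; apply: lt_le_trans (xil_le j).
    by rewrite mulr_gt0// exprn_gt0.
  + move=> j k jk; apply: le_trans (dec j k (ltnW jk)); apply: ler_wpM2r => //.
    apply: le_trans (le_trans blb1 b1d) _; rewrite ler_wiXn2l ?(ltW be0)//.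
    by apply: leq_trans (leq_subr _ _) _; exact: ltn_addn1.
  + exists (chain_fun (fl i) d); split.
    * by move=> y; exact: chain_interior.
    * by apply: le_trans ble2 _; apply: pe2; exact: chain_interior.
    * move=> j; apply: le_trans (xil_le j).
      apply: (@le_trans _ _ (b1 * (A * ((1 + s) * xi l)))).
        apply: ler_pM => //; [exact: ltW|exact: ltW|].
        rewrite GE mulrC; apply: ler_pM => //.
        - by apply: (chain_fun_ge0 (cfl i)) => //; exact: chain_centerP.
        - exact: mA.
      by rewrite [A * _]mulrA mulrA divfK// gt_eqF// mulr_gt0.
- by move=> i; apply: frame_graded => //; exact: frame_chain_mx.
- move=> i x Px; rewrite orthant_graded// => j.
  by rewrite aff_chain_mx; apply: chain_interior => //; exact: ltn_addn1.
- move=> i T x /sec[t0 _ tT]; set t := aff _ x in t0 tT.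
  exists (t (rshift d 0)).
    by apply: le_trans tT; rewrite ler_wpM2r// expR_ge0.
  move=> y Py; have [uc _] := chain_units (cfl i).
  rewrite (barycentricE uc x) -/t.
  (* The last center is that of P, so with ratio t_d the homothety merely replaces it by y in a
     convex combination. *)
  have -> : \sum_j t j *: chain_points a (fl i) j + t (rshift d 0) *: (y - center P) =
      \sum_j t j *: (if j == rshift d 0 then y else chain_points a (fl i) j).
    rewrite (bigD1 (rshift d 0))//= [RHS](bigD1 (rshift d 0))//= eqxx.
    rewrite -(topE i) scalerBr {1}/chain_points /= addn0.
    rewrite addrAC addrC [X in _ + X]addrC subrK addrC; congr (_ + _).
    by apply: eq_bigr => j /negbTE ->.
  apply: conv_hull_sum.
  + by move=> j; case: ifP => // _; apply: chain_centerP => //; exact: ltn_addn1.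
  + by move=> j; exact/ltW/t0.
  + exact: barycentric_sum.
- move=> i i' T x /[dup] Sx /sec[t0 tS _] /[dup] Sx' /sec[t0' tS' _].
  apply: fl_inj => j; rewrite leq_eqVlt => /orP[/eqP ->|jd].
    by rewrite !chain_top.
  apply: contrapT => fjN.
  (* In a sector of i1, the functional of its own face of index j is at most A S, S being the weight
     of the centers of index > j. The functional of another face of the same rank is at least e at
     the center of index j, hence at least e t_j >= 2 A S at x. Exchanging the two flags yields a
     contradiction. *)
  have key i1 i2 T1 : fl i1 j <> fl i2 j ->
      sector (graded_frame (chain_mx (fl i1)) K) T1 x ->
      aff (chain_fun (fl i1) j.+1) x 0 < aff (chain_fun (fl i2) j.+1) x 0.
    move=> f12 /sec[u0 uS _]; set u := aff _ x in u0 uS.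
    have [uc _] := chain_units (cfl i1).
    have u1 : \sum_k u k = 1 by exact: barycentric_sum.
    have xE : x = \sum_k u k *: chain_points a (fl i1) k by exact: barycentricE.
    pose j' := Ordinal (ltd _ (ltnW jd)).
    pose S := \sum_(k < d + 1 | (j < k)%N) u k.
    have S0 : 0 < S.
      rewrite /S (bigD1 (rshift d 0)) /= ?addn0// ltr_pwDl//.
      by apply: sumr_ge0 => k _; exact/ltW.
    have lo : 2 * A / e * S <= u j' := uS j'.
    have up1 : aff (chain_fun (fl i1) j.+1) x 0 <= A * S.
      rewrite (chain_coords _ u1 xE) mulr_sumr [leRHS]big_mkcond.
      apply: ler_sum => k _; case: ifPn => jk.
        rewrite mulrC; apply: ler_wpM2r; first exact/ltW.
        by apply: mA => //; exact: ltn_addn1.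
      by rewrite (chain_fun_eq0 (cfl i1)) ?mulr0// ltnS leqNgt jk.
    have gt0 : 0 < aff (chain_fun (fl i2) j.+1) (center (fl i1 j)) 0.
      have [f1 r1] := (proj1 (cfl i1)) j (ltnW jd).
      have [f2 r2] := (proj1 (cfl i2)) j (ltnW jd).
      apply: face_support_center_gt0 => // sub12; apply: f12.
      by apply: (face_rank_inj f1 f2 sub12); rewrite r1 r2.
    have low2 : u j' * e <= aff (chain_fun (fl i2) j.+1) x 0.
      rewrite {1}xE aff_sum// (bigD1 j')//; apply: (@le_trans _ _
        (u j' * aff (chain_fun (fl i2) j.+1) (center (fl i1 j)) 0)).
        by rewrite ler_pM2l//; apply: me => //; exact: ltnW.
      rewrite lerDl; apply: sumr_ge0 => k _; apply: mulr_ge0; first exact/ltW.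
      apply: (chain_fun_ge0 (cfl i2)) => //; apply: chain_centerP => //.
      exact: ltn_addn1.
    apply: le_lt_trans up1 _; apply: lt_le_trans low2.
    rewrite -ltr_pdivrMr//; apply: lt_le_trans lo.
    have ei0 : 0 < e^-1 by rewrite invr_gt0.
    by rewrite mulrAC (ltr_pM2r S0) (ltr_pM2r ei0) ltr_pMl// ltr1n.
  have := key _ _ _ fjN Sx.
  have := key _ _ _ (fun h => fjN (esym h)) Sx'.
  by move=> /lt_trans h /h; rewrite ltxx.
Qed.

End polytope_volume.

(** * Flags as chains, and the conclusion *)

Section flags_of_polytope.
Context {R : realType} {d n : nat}.
Local Notation V := 'rV[R]_d.
Variable a : 'I_n -> V.
Let P := conv_hull (range a).
Local Notation verts := (verts a).
Local Notation chain := (chain a).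
Let vertP := vertP a.

Lemma flags_chain (f : d.+1.-tuple (set V)) :
  flags P f <-> chain (nth set0 f).
Proof.
have tn i (id : (i <= d)%N) : nth set0 f i = tnth f (inord i).
  by rewrite (tnth_nth set0) inordK.
have tnE (i : 'I_d.+1) : tnth f i = nth set0 f i by rewrite (tnth_nth set0).
split=> [[ff fS]|[ff fS]].
  split=> i id.
    have [fi di] := ff (inord i); rewrite tn//; split => //.
    by move/(set_dimP _ fi) : di; rewrite inordK.
  have [fi1 _] := ff (inord i.+1).
  rewrite !tn ?(ltnW id)//; apply: subset_trans (fS (inord i) (inord i.+1) _) _.
    by rewrite !inordK// ltnW.
  move=> x [+ _]; rewrite -[closure _](closure_id _).1//.
  exact: face_closed fi1.
split=> [i|i j ji]; rewrite !tnE.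
  have [fi ri] := ff i (ltn_ord i); split => //.
  exact/(set_dimP _ fi).
have jd : (j <= d)%N by rewrite -ltnS.
have id : (i < d)%N by rewrite -ltnS -ji.
have [fi ri] := ff i (ltnW id); have [fj rj] := ff j jd.
have ij : nth set0 f i `<=` nth set0 f j by rewrite ji; exact: fS.
move=> x fix_; split; first exact/subset_closure/ij.
move=> [_]; have [g0 fiE] := face_supportP fi.
have nji : ~ nth set0 f j `<=` nth set0 f i.
  by move=> /(face_rank_sub a); rewrite ri rj ji ltnn.
have gc := face_support_center_gt0 fi fj nji.
set c := face_center a _ in gc; have fc : nth set0 f j c.
  by apply: face_center_in => //; exists x; exact: ij.
(* A small step from x away from the center of the larger face stays in its affine hull but makes
   the support functional of the smaller face negative, hence leaves P: x is not in the relative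
   interior. *)
move=> hx; have {hx} : \forall y \near x + 0 *: (c - x), affine_hull (nth set0 f j) y ->
    nth set0 f j y by rewrite scale0r addr0.
move=> /nbhs_line[e e0 /(_ (- (e / 2)))].
rewrite subr0 normrN gtr0_norm ?divr_gt0// ltr_pdivrMr// ltr_pMr// ltr1n => /(_ isT) h.
have : nth set0 f j (x + - (e / 2) *: (c - x)).
  apply: h; apply/(affine_hull_submx _ fj).
  have -> : row_mx (x + - (e / 2) *: (c - x)) 1%:M = row_mx x 1%:M +
      (- (e / 2)) *: (row_mx c 1%:M - row_mx x 1%:M) :> 'rV_(d + 1).
    by rewrite -row_mx1B scale_row_mx scaler0 add_row_mx addr0.
  apply: addmx_sub; first by apply: face_submx => //; exact: ij.
  apply/scalemx_sub/addmx_sub; rewrite ?eqmx_opp; apply: face_submx => //.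
  exact: ij.
move=> /(face_sub fj) /g0; rewrite aff_segment.
have -> : aff (face_support a (nth set0 f i)) x 0 = 0.
  by move: fix_; rewrite {1}fiE => -[].
rewrite mulr0 add0r leNgt mulNr oppr_lt0.
by rewrite mulr_gt0// divr_gt0.
Qed.

(** A face is recovered from its set of generators, so every flag comes from a tuple of subsets of
    ['I_n]. *)
Lemma finite_flags : finite_set (flags P).
Proof.
pose cv (S : {set 'I_n}) : set V := [set x | exists t : 'I_n -> R,
  [/\ forall i, 0 <= t i, \sum_i t i = 1, x = \sum_i t i *: a i &
  forall i, i \notin S -> t i = 0]].
apply: (@sub_finite_set _ _
  ((fun S : d.+1.-tuple {set 'I_n} => [tuple cv (tnth S i) | i < d.+1]) @` setT)).
  move=> f [ff _]; exists [tuple verts (tnth f i) | i < d.+1] => //.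
  apply: eq_from_tnth => i; rewrite !tnth_mktuple; apply/seteqP.
  by split=> x /(face_convP x (ff i).1).
by apply: finite_image; exact: finite_finset.
Qed.

End flags_of_polytope.

Theorem theorem4 (R : realType) (d : nat) (Vol : volume_notion R d)
    (P Sigma : set 'rV[R]_d) (p q : 'rV[R]_d)
    (hP : polytope P) (dimP : set_dim P d) (hSigma : simplex Sigma d)
    (hp : P° p) (hq : Sigma° q) :
  asvol Vol P p =
  (((#|` fset_set (flags P)|)%:R / (d.+1)`!%:R)%:E * asvol Vol Sigma q)%E.
Proof.
have [s PE] := hP; have [v [iv SE]] := hSigma.
(* Homogeneous coordinates are indexed by [d + 1], the vertices in [simplex] by [d.+1]. *)
pose u (i : 'I_(d + 1)) := v (cast_ord (addn1 d) i).
have vu i : v i = u (cast_ord (esym (addn1 d)) i) by rewrite /u cast_ordKV.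
have ru : range u = range v.
  apply/seteqP; split=> _ [i _ <-]; first by exists (cast_ord (addn1 d) i).
  by exists (cast_ord (esym (addn1 d)) i) => //; rewrite -vu.
have bij : bijective (cast_ord (addn1 d)).
  by exists (cast_ord (esym (addn1 d))); [exact: cast_ordK|exact: cast_ordKV].
have iu : affinely_independent u.
  move=> t t1 tu i; rewrite -[i](cast_ordK (addn1 d)).
  apply: (iv (fun j => t (cast_ord (esym (addn1 d)) j))).
    rewrite (reindex _ (onW_bij _ bij)) -[RHS]t1.
    by apply: eq_bigr => j _; rewrite cast_ordK.
  rewrite (reindex _ (onW_bij _ bij)) -[RHS]tu.
  by apply: eq_bigr => j _; rewrite cast_ordK.
have uu := affinely_independent_unit iu.
have fN : frame (invmx (points_mx u)).
  by split=> [|j]; rewrite ?unitmx_inv// invmxK points_mx_last.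
rewrite SE -ru (asvol_simplex Vol iu); last by rewrite ru -SE.
pose a := tnth (in_tuple s).
have PaE : P = conv_hull (range a).
  rewrite PE; congr conv_hull; apply/seteqP; split=> [x|_ [i _ <-]].
    by move=> /= /(tnthP (in_tuple s))[i ->]; exists i.
  exact: mem_tnth.
rewrite PaE in dimP hp *.
have rP := (set_dimP _ (face_refl a)).1 dimP.
pose F := fset_set (flags (conv_hull (range a))).
have inF f : (f \in F) = (f \in flags (conv_hull (range a))).
  by rewrite in_fset_set//; exact: finite_flags.
(* The growth is measured in the frame of Sigma, already used for the right-hand side, so that only
   the counting factors remain to be compared. *)
rewrite (@asvol_chains _ _ _ a rP Vol p F (fun f => nth set0 (val f)) hp _ _ _ _ fN).
- have -> : ((d + 1)`! = d.+1`!)%N by rewrite addn1.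
  rewrite muleA -EFinM divfK ?pnatr_eq0 -?lt0n ?fact_gt0//.
  by rewrite -cardfE.
- by move=> f; apply/flags_chain/set_mem; rewrite -inF; exact: valP.
- move=> f f' ff'; apply/val_inj/val_inj/(@eq_from_nth _ set0).
    by rewrite !size_tuple.
  by move=> i; rewrite size_tuple ltnS; exact: ff'.
- move=> f cf; pose g := [tuple f i | i < d.+1].
  have gE j : (j <= d)%N -> nth set0 g j = f j.
    move=> jd; have j1 : (j < d.+1)%N by [].
    by rewrite -[j]/(nat_of_ord (Ordinal j1)) -tnth_nth tnth_mktuple.
  have gF : g \in F.
    rewrite inF; apply/mem_set/flags_chain; have [ff fS] := cf.
    split=> i id; first by rewrite gE//; exact: ff.
    by rewrite !gE//; [exact: fS|exact: ltnW].
  by exists [` gF]%fset => j; exact: gE.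
Qed.
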